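(* There is a constant, independent of $h\in(0,h_0]$, such that $$|(v,w)-(v,w)_L|\lesssim h^2\,\|\nabla v\|_\Omega\,\|\nabla w\|_\Omega,\qquad v,w\in V_h^E.$$
   Context: $\Omega\subset\mathbb{R}^d$, $d\ge 2$, is an open connected (bounded) domain with smooth boundary $\Gamma=\partial\Omega$. $\Omega_0\supset\Omega$ is a polygonal domain, and $\mathcal{T}_{0,h}$, $h\in(0,h_0]$, is a family of quasi-uniform (shape regular) triangulations of $\Omega_0$ into simplices with mesh parameter $h$. The active mesh is $\mathcal{T}_h=\{T\in\mathcal{T}_{0,h}: T\cap\Omega\ne\emptyset\}$, with vertex set $\mathcal{X}_h$; $\Omega_h=\cup_{T\in\mathcal{T}_h}T$. Let $\mathcal{T}_{h,I}=\{T\in\mathcal{T}_h: T\subset\Omega\}$ and $\mathcal{T}_{h,B}=\mathcal{T}_h\setminus\mathcal{T}_{h,I}$. $W_h$ is the space of discontinuous piecewise linear functions on $\mathcal{T}_h$, $V_h=W_h\cap C^0(\Omega_h)$, $W_{h,I}=W_h|_{\mathcal{T}_{h,I}}$, $V_{h,I}=V_h|_{\mathcal{T}_{h,I}}$. Discrete extension: $S_h:\mathcal{T}_h\to\mathcal{T}_{h,I}$ is a mapping with $S_h(T)=T$ for $T\in\mathcal{T}_{h,I}$ and $\operatorname{diam}(T\cup S_h(T))\lesssim h$ for all $T\in\mathcal{T}_{h,B}$, uniformly in $T$ and $h\in(0,h_0]$; $h_0$ is assumed small enough that such a mapping exists. For $v\in\mathbb{P}_1(T)$ let $v^e\in\mathbb{P}_1(\mathbb{R}^d)$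 be its canonical polynomial extension. $F_h:W_{h,I}\to W_h$ is defined by $(F_hv)|_T=(v|_{S_h(T)})^e|_T$. The averaging operator $A_h:W_h\to V_h$ is $A_hw=\sum_{x\in\mathcal{X}_h}\langle w\rangle_x\varphi_x$, where $\varphi_x$ is the nodal basis function of $V_h$ at $x$, $\langle w\rangle_x=\sum_{T\in\mathcal{T}_h(x)}\kappa_{T,x}\,w|_T(x)$, $\mathcal{T}_h(x)=\{T\in\mathcal{T}_h:x\in T\}$, $\kappa_{T,x}\ge0$, $\sum_{T\in\mathcal{T}_h(x)}\kappa_{T,x}=1$. Set $E_h=A_h\circ F_h:V_{h,I}\to V_h$ and $V_h^E=E_hV_{h,I}$. Lumping: $(\cdot,\cdot)$ is the $L^2(\Omega)$ inner product and $\|\cdot\|_\Omega$ the $L^2(\Omega)$ norm. Let $\{\varphi_i\}_{i\in\mathcal{I}_{h,I}}$ be the nodal basis of $V_{h,I}$; $\{E_h\varphi_i\}_{i\in\mathcal{I}_{h,I}}$ is used as basis of $V_h^E$, and $\widehat v$ denotes the coefficient vector of $v\in V_h^E$ in this basis. The mass matrix $\widehat M_{h,I}=(\widehat m_{ij})$ has entries $\widehat m_{ij}=(E_h\varphi_i,E_h\varphi_j)$. The lumped mass matrix $\widehat M_L$ is the diagonal matrix whose diagonal entries are the row sums, $\widehat M_{L,ii}=\sum_{l\in\mathcal{I}_{h,I}}\widehat m_{il}$. The lumped inner product is $(v,w)_L=(\widehat M_L\widehat v,\widehat w)_{\mathcal{I}_{h,I}}$ (Euclidean inner product over $\mathcal{I}_{h,I}$)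 for $v,w\in V_h^E$. $a\lesssim b$ means $a\le Cb$ with $C$ independent of $h$ and the functions involved.
   Formalization: For arbitrary averaging weights the estimate fails (weights of uncut cells at a vertex may tend to 0 with h), so the assumption that the E_hφ_i form a basis is strengthened to h-uniform stability: h^d|a|² ≤ C‖Σ a_i E_hφ_i‖²_Ω. *)

(* Defs.v *)
From HB Require Import structures.
From mathcomp Require Import all_boot all_order all_algebra.
From mathcomp Require Import all_classical all_reals all_analysis.
Set Implicit Arguments.
Unset Strict Implicit.
Unset Printing Implicit Defensive.
Import Order.TTheory GRing.Theory Num.Theory.
Import numFieldNormedType.Exports.
Local Open Scope classical_set_scope.
Local Open Scope ring_scope.

(* 'rV[R]_n carries the product (= Borel) sigma-algebra, and [lebesgue_rV n] is
   the n-fold product of [lebesgue_measure]; see [lebesgue_rV_box]. *)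

Section measurable_rV.
Variables (R : realType) (n : nat).

Let coor (i : 'I_n) (x : 'rV[R]_n) : measurableTypeR R := x ord0 i.

Let rV_set0 : g_sigma_preimage coor set0.
Proof. exact: sigma_algebra0. Qed.

Let rV_setC A : g_sigma_preimage coor A -> g_sigma_preimage coor (~` A).
Proof. exact: sigma_algebraC. Qed.

Let rV_bigcup (F : (set 'rV[R]_n)^nat) :
  (forall i, g_sigma_preimage coor (F i)) ->
  g_sigma_preimage coor (\bigcup_i (F i)).
Proof. exact: sigma_algebra_bigcup. Qed.

HB.instance Definition _ := @isMeasurable.Build default_measure_display
  'rV[R]_n (g_sigma_preimage coor) rV_set0 rV_setC rV_bigcup.

Lemma measurable_coor (i : 'I_n) :
  measurable_fun [set: 'rV[R]_n] (fun x => x ord0 i : measurableTypeR R).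
Proof.
move=> _ Y mY; rewrite setTI; apply: sub_sigma_algebra => /=.
rewrite -bigcup_seq/=; exists i => /=; first by rewrite mem_index_enum.
by exists Y => //; rewrite setTI.
Qed.

Lemma measurable_fun_rV d (T : measurableType d) (f : T -> 'rV[R]_n) :
  (forall i, measurable_fun [set: T] (fun x => f x ord0 i : measurableTypeR R)) ->
  measurable_fun [set: T] f.
Proof.
move=> mf; have H : g_sigma_preimage (fun i => coor i \o f) `<=` measurable.
  apply: smallest_sub; first exact: sigma_algebra_measurable.
  apply: (big_ind (fun X => X `<=` measurable)) => //.
  - by move=> X Y mX mY A [/mX|/mY].
  - by move=> i _ A [B mB <-]; exact: mf.
by move=> _ A mA; apply: H; rewrite g_sigma_preimage_comp; exists A.
Qed.

End measurable_rV.

Section rV_cons.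
Variables (R : realType) (n : nat).

Definition rV_cons (p : measurableTypeR R * 'rV[R]_n) : 'rV[R]_n.+1 :=
  \row_i (if unlift ord0 i is Some j then p.2 ord0 j else p.1).

Lemma rV_cons0 p : rV_cons p ord0 ord0 = p.1.
Proof. by rewrite mxE unlift_none. Qed.

Lemma rV_consS p i : rV_cons p ord0 (lift ord0 i) = p.2 ord0 i.
Proof. by rewrite mxE liftK. Qed.

Lemma measurable_rV_cons : measurable_fun setT rV_cons.
Proof.
apply: measurable_fun_rV => i.
case: (unliftP ord0 i) => [j|] ->.
  rewrite (_ : (fun _ => _) = (fun x : 'rV[R]_n => x ord0 j) \o snd).
    exact: (measurableT_comp (measurable_coor j) measurable_snd).
  by apply/funext => p; rewrite rV_consS.
rewrite (_ : (fun _ => _) = fst); first exact: measurable_fst.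
by apply/funext => p; rewrite rV_cons0.
Qed.

Lemma measurable_rV_behead : measurable_fun [set: 'rV[R]_n.+1]
  (fun x : 'rV[R]_n.+1 => \row_(i < n) x ord0 (lift ord0 i)).
Proof.
apply: measurable_fun_rV => i.
rewrite (_ : (fun _ => _) = (fun x : 'rV[R]_n.+1 => x ord0 (lift ord0 i))).
  exact: measurable_coor.
by apply/funext => x; rewrite mxE.
Qed.

Variable mu : {sigma_finite_measure set 'rV[R]_n -> \bar R}.

Definition lebesgue_cons : set 'rV[R]_n.+1 -> \bar R :=
  pushforward (@lebesgue_measure R \x mu)%E rV_cons.


HB.instance Definition _ := Measure.copy lebesgue_cons
  (measure_function_pushforward__canonical__measure_function_Measure
     (@lebesgue_measure R \x mu)%E measurable_rV_cons).

Lemma lebesgue_consX (A : set R) (B : set 'rV[R]_n) :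
  measurable (A : set (measurableTypeR R)) -> measurable B ->
  lebesgue_cons [set x | A (x ord0 ord0) /\
    B (\row_i x ord0 (lift ord0 i))] = (lebesgue_measure A * mu B)%E.
Proof.
move=> mA mB; rewrite -product_measure1E// /lebesgue_cons /pushforward.
congr (_ _); apply/seteqP; split=> -[a v] /=; rewrite rV_cons0;
  have -> : \row_i rV_cons (a, v) ord0 (lift ord0 i) = v
    by apply/rowP => i; rewrite mxE rV_consS.
all: by [].
Qed.

Let lebesgue_cons_sigma_finite : sigma_finite setT lebesgue_cons.
Proof.
have /sigma_finiteP[F [FT ndF Foo]] := sigma_finiteT (@lebesgue_measure R).
have /sigma_finiteP[G [GT ndG Goo]] := sigma_finiteT mu.
exists (fun k => [set x : 'rV[R]_n.+1 | F k (x ord0 ord0) /\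
    G k (\row_i x ord0 (lift ord0 i))]).
  apply/esym; rewrite -subTset => x _.
  have [k _ Fk] : (\bigcup_i F i) (x ord0 ord0) by rewrite -FT.
  have [l _ Gl] : (\bigcup_i G i) (\row_i x ord0 (lift ord0 i)) by rewrite -GT.
  exists (maxn k l) => //; split.
    by move: Fk; apply/subsetPset/ndF/leq_maxl.
  by move: Gl; apply/subsetPset/ndG/leq_maxr.
move=> k; have [mF Fk] := Foo k; have [mG Gk] := Goo k; split; last first.
  by rewrite lebesgue_consX// lte_mul_pinfty// ge0_fin_numE.
apply: measurableI.
  by rewrite -[X in measurable X]setTI; exact: measurable_coor.
by rewrite -[X in measurable X]setTI; exact: measurable_rV_behead.
Qed.

HB.instance Definition _ := Measure_isSigmaFinite.Build _ _ _ lebesgue_cons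
  lebesgue_cons_sigma_finite.

End rV_cons.

Section lebesgue_rV.
Variable R : realType.

Fixpoint lebesgue_rV n : {sigma_finite_measure set 'rV[R]_n -> \bar R} :=
  match n with
  | 0 => dirac (0 : 'rV[R]_0)
  | n'.+1 => lebesgue_cons (lebesgue_rV n')
  end.

Lemma measurable_box n (a b : 'rV[R]_n) :
  measurable [set x : 'rV[R]_n |
    forall i, (a ord0 i <= x ord0 i <= b ord0 i)%R].
Proof.
rewrite (_ : mkset _ = \bigcap_(i in [set: 'I_n])
  ((fun x : 'rV[R]_n => x ord0 i : measurableTypeR R) @^-1`
    `[a ord0 i, b ord0 i])); last first.
  apply/seteqP; split=> x /= h i; first by move=> _; rewrite /= in_itv/= h.
  by have := h i Logic.I; rewrite /= in_itv.
apply: fin_bigcap_measurable => // i _.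
by rewrite -[X in measurable X]setTI; exact: measurable_coor.
Qed.

Lemma lebesgue_rV_box n (a b : 'rV[R]_n) :
  (forall i, a ord0 i <= b ord0 i) ->
  lebesgue_rV n [set x | forall i, (a ord0 i <= x ord0 i <= b ord0 i)%R] =
  (\prod_i (b ord0 i - a ord0 i))%:E.
Proof.
elim: n => [|n ih] in a b * => ab.
  by rewrite big_ord0 /= diracE mem_set//= => -[].
rewrite big_ord_recl EFinM /=.
pose s (x : 'rV[R]_n.+1) : 'rV[R]_n := \row_i x ord0 (lift ord0 i).
have := ih (s a) (s b); under eq_bigr do rewrite !mxE.
move=> <-; last by move=> i; rewrite !mxE.
have -> : (b ord0 ord0 - a ord0 ord0)%:E =
    lebesgue_measure (`[a ord0 ord0, b ord0 ord0]%classic : set R).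
  rewrite lebesgue_measure_itv/= lte_fin; case: ltgtP (ab ord0) => //.
  by move=> ->; rewrite subrr.
rewrite -lebesgue_consX//; last exact: measurable_box.
congr (_ _); apply/seteqP; split=> x /= h.
  by split=> [|i]; rewrite ?in_itv/= ?mxE.
case: h; rewrite in_itv/= => h0 hS i.
by case: (unliftP ord0 i) => [j|] -> //; have := hS j; rewrite !mxE.
Qed.

End lebesgue_rV.

Section euclidean.
Variables (R : realType) (d : nat).
Implicit Types (x y : 'rV[R]_d) (A U : set 'rV[R]_d).

Definition dot x y : R := \sum_(j < d) x ord0 j * y ord0 j.

(* The library norm on 'rV[R]_d is the max norm. *)
Definition enorm x : R := Num.sqrt (dot x x).

Definition diam A : R :=
  sup [set r | exists x y, [/\ A x, A y & r = enorm (x - y)]].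

Definition eball x (r : R) : set 'rV[R]_d := [set y | enorm (y - x) <= r].

Definition boundary A : set 'rV[R]_d := closure A `\` interior A.

Definition domain U := [/\ open U, connected U & U !=set0].

Definition iter_partial (f : 'rV[R]_d -> R) (s : seq 'I_d) : 'rV[R]_d -> R :=
  foldr (fun i g x => 'D_(delta_mx ord0 i) g x) f s.

Definition smooth (f : 'rV[R]_d -> R) :=
  forall s, continuous (iter_partial f s) /\
    forall i x, derivable (iter_partial f s) x (delta_mx ord0 i).

(* Polygonal (polyhedral) domain: the boundary lies in finitely many
   hyperplanes. *)
Definition polygonal_domain U :=
  [/\ domain U, bounded_set U &
    exists2 H : seq ('rV[R]_d * R), all (fun p => p.1 != 0) H &
      forall x, boundary U x -> exists2 p, p \in H & dot p.1 x = p.2].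

Definition L2_inner (Omega : set 'rV[R]_d) (f g : 'rV[R]_d -> R) : R :=
  \int[lebesgue_rV R d]_(x in Omega) (f x * g x).

Definition L2_norm_vec (Omega : set 'rV[R]_d) (F : 'rV[R]_d -> 'rV[R]_d) : R :=
  Num.sqrt (\int[lebesgue_rV R d]_(x in Omega) dot (F x) (F x)).

End euclidean.

(* Near each of its points the boundary is, after relabelling and reorienting
   the coordinate axes, the graph of a C^oo function of d - 1 variables, with
   Omega on one side of it. *)
Definition smooth_boundary (R : realType) (d : nat) (Omega : set 'rV[R]_d) :=
  forall x0, boundary Omega x0 ->
    exists (r : R) (k : 'I_d) (b : bool) (gam : 'rV[R]_d.-1 -> R),
      [/\ 0 < r, smooth gam &
        forall x, ball x0 r x ->
          (Omega x <-> gam (col' k x) < (-1) ^+ b * x ord0 k)].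

(* A cell is the set of indices of its vertices; the closed simplex it stands
   for is [simplex] below. *)
Record mesh (R : realType) (d : nat) := Mesh {
  nvert : nat;
  vert : 'I_nvert -> 'rV[R]_d;
  cells : {set {set 'I_nvert}} }.

Section mesh.
Variables (R : realType) (d : nat) (m : mesh R d).
Local Notation cell := {set 'I_(nvert m)}.
Implicit Types (T : cell) (K : {set cell}).

Definition simplex T : set 'rV[R]_d :=
  [set x | exists a : 'I_(nvert m) -> R,
    [/\ forall i, 0 <= a i, \sum_(i in T) a i = 1 &
        x = \sum_(i in T) a i *: vert i]].

Definition affinely_independent T :=
  forall a : 'I_(nvert m) -> R, \sum_(i in T) a i = 0 ->
    \sum_(i in T) a i *: vert i = 0 -> forall i, i \in T -> a i = 0.

Definition triangulation (U : set 'rV[R]_d) :=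
  [/\ injective (@vert R d m),
      forall T, T \in cells m -> #|T| = d.+1 /\ affinely_independent T,
      forall T T', T \in cells m -> T' \in cells m ->
        simplex T `&` simplex T' = simplex (T :&: T') &
      \bigcup_(T in [set` cells m]) simplex T = closure U].

(* c + g . x, stored as the pair (c, g).  Since the cells are nondegenerate,
   P_1(T) and P_1(R^d) are identified by restriction, i.e. an element of P_1(T)
   is stored as its canonical extension. *)
Local Notation P1 := (R^o * 'rV[R]_d)%type.

Definition p1_eval (p : P1) (x : 'rV[R]_d) : R := p.1 + dot p.2 x.

Definition dpw := {ffun cell -> P1}.

(* Elements of the spaces over K vanish by convention on the cells outside K. *)
Definition supported_on K (w : dpw) := forall T, T \notin K -> w T = 0.

Definition restrict K (w : dpw) : dpw := [ffun T => if T \in K then w T else 0].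

(* On a face shared by several cells one of them is picked; this is immaterial
   for continuous w, and for gradients the faces form a null set. *)
Definition cell_at K (x : 'rV[R]_d) : option cell :=
  [pick T in K | `[< simplex T x >]].

Definition pw_val K (w : dpw) (x : 'rV[R]_d) : R :=
  if cell_at K x is Some T then p1_eval (w T) x else 0.

Definition pw_grad K (w : dpw) (x : 'rV[R]_d) : 'rV[R]_d :=
  if cell_at K x is Some T then (w T).2 else 0.

Definition region K : set 'rV[R]_d := \bigcup_(T in [set` K]) simplex T.

Definition vertices K : {set 'I_(nvert m)} := finset.cover K.

Definition nodal_basis K (x : 'I_(nvert m)) : dpw :=
  [ffun T => if T \in K then
     xget 0 [set p : P1 |
       forall y, y \in T -> p1_eval p (vert y) = (y == x)%:R]
   else 0].

End mesh.

Section discrete_extension.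
Variables (R : realType) (d : nat) (Omega : set 'rV[R]_d) (m : mesh R d).
Local Notation cell := {set 'I_(nvert m)}.

Definition Th : {set cell} :=
  [set T in cells m | `[< simplex T `&` Omega !=set0 >]].

Definition ThI : {set cell} := [set T in Th | `[< simplex T `<=` Omega >]].

Definition ThB : {set cell} := Th :\: ThI.

Definition Wh : set (dpw m) := [set w | supported_on Th w].

Definition Vh : set (dpw m) :=
  [set w | Wh w /\ {within region Th, continuous (pw_val Th w)}].

Definition VhI : set (dpw m) := restrict ThI @` Vh.

Variables (S : cell -> cell) (kappa : cell -> 'I_(nvert m) -> R).

Definition extension_map :=
  [/\ forall T, T \in Th -> S T \in ThI & forall T, T \in ThI -> S T = T].

Definition averaging_weights :=
  forall x, x \in vertices Th ->
    (forall T, T \in Th -> x \in T -> 0 <= kappa T x) /\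
    \sum_(T in Th | x \in T) kappa T x = 1.

Definition Fh (v : dpw m) : dpw m :=
  [ffun T => if T \in Th then v (S T) else 0].

Definition average (w : dpw m) (x : 'I_(nvert m)) : R :=
  \sum_(T in Th | x \in T) kappa T x * p1_eval (w T) (vert x).

Definition Ah (w : dpw m) : dpw m :=
  \sum_(x in vertices Th) average w x *: nodal_basis Th x.

Definition Eh (v : dpw m) : dpw m := Ah (Fh v).

Definition VhE : set (dpw m) := Eh @` VhI.

Local Notation nI := #|vertices ThI|.

Definition extended_basis (i : 'I_nI) : dpw m :=
  Eh (nodal_basis ThI (enum_val i)).

Definition expand (a : 'cV[R]_nI) : dpw m :=
  \sum_(i < nI) a i ord0 *: extended_basis i.

Definition coef (v : dpw m) : 'cV[R]_nI := xget 0 [set a | v = expand a].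

Definition fem_inner (v w : dpw m) : R :=
  L2_inner Omega (pw_val Th v) (pw_val Th w).

Definition fem_grad_norm (v : dpw m) : R := L2_norm_vec Omega (pw_grad Th v).

Definition mass_mx : 'M[R]_nI :=
  \matrix_(i, j) fem_inner (extended_basis i) (extended_basis j).

Definition lumped_mass_mx : 'M[R]_nI :=
  diag_mx (\row_i \sum_l mass_mx i l).

Definition lumped_inner (v w : dpw m) : R :=
  \sum_i (lumped_mass_mx *m coef v) i ord0 * coef w i ord0.

End discrete_extension.

Section families.
Variables (R : realType) (d : nat) (Omega : set 'rV[R]_d) (h0 : R).
Variable M : R -> mesh R d.
Variable S : forall h, {set 'I_(nvert (M h))} -> {set 'I_(nvert (M h))}.
Variable kappa : forall h, {set 'I_(nvert (M h))} -> 'I_(nvert (M h)) -> R.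

Definition quasi_uniform :=
  exists2 sigma : R, 0 < sigma &
    forall h, 0 < h <= h0 -> forall T, T \in cells (M h) ->
      [/\ diam (simplex T) <= sigma * h, h <= sigma * diam (simplex T) &
        exists x r, [/\ 0 < r, eball x r `<=` simplex T &
          diam (simplex T) <= sigma * r]].

Definition local_extension :=
  exists2 C : R, 0 < C &
    forall h, 0 < h <= h0 -> forall T, T \in ThB Omega (M h) ->
      diam (simplex T `|` simplex (S T)) <= C * h.

(* {E_h phi_i} is a basis of V_h^E, with h^d |a|^2 <~ ||sum_i a_i E_h phi_i||^2
   uniformly in h.  In particular [coef] is well defined.  This is not automatic
   for convex weights kappa: if S maps no cut cell to a cell at the vertex x of
   ThI, and kappa gives total weight e to the uncut cells at x, then
   E_h phi_x = e phi_x, with e arbitrarily small or 0.  If kappa vanishes on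
   cut cells at the vertices of ThI, then E_h v = v on ThI and the property
   follows from quasi-uniformity. *)
Definition stable_extended_basis :=
  exists2 C : R, 0 < C &
    forall h, 0 < h <= h0 ->
      forall a : 'cV[R]_#|vertices (ThI Omega (M h))|,
        let v := expand (@S h) (@kappa h) a in
        h ^+ d * \sum_i a i ord0 ^+ 2 <= C * fem_inner Omega v v.

End families.

(* Main.v *)
(* With v = sum_i a_i E phi_i, w = sum_i b_i E phi_i and the mass matrix m, the
   lumping error is

     (v, w)_L - (v, w) = 1/2 sum_ij m_ij (a_i - a_j) (b_i - b_j),

   so by Cauchy-Schwarz it suffices to bound sum_ij |m_ij| (a_i - a_j)^2 by
   C h^2 |grad v|^2.  The functions E phi_i are bounded, supported in cubes of size
   O(h) around the vertices, sum up to 1 on Omega, and overlap boundedly, because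
   shape regularity bounds the number of vertices in such a cube.  A local Poincaré
   inequality gives constants c_i with
   sum_i int |E phi_i| (v - c_i)^2 <= C h^2 |grad v|^2, and the stability of the
   basis applied to a - c turns this into the same bound with c replaced by a.

   The Poincaré inequality at scale h is proved for piecewise affine functions by
   integrating along segments.  Since Omega is locally a Lipschitz subgraph, points
   of Omega in a small cube can first be translated inwards by a common vector of
   comparable length, after which the segments joining them stay in Omega.  For h
   bounded below, the inequality on Omega itself follows by gluing finitely many
   such cubes, Omega being connected and bounded. *)

Require Import Defs.
From HB Require Import structures.
From mathcomp Require Import all_boot all_order all_algebra.
From mathcomp Require Import all_classical all_reals all_analysis.
From mathcomp Require Import measurable_realfun ring lra.
Set Implicit Arguments.
Unset Strict Implicit.
Unset Printing Implicit Defensive.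
Import Order.TTheory GRing.Theory Num.Theory.
Import numFieldNormedType.Exports.
Local Open Scope classical_set_scope.
Local Open Scope ring_scope.

(** The right-hand side contains the gradient on Omega only, while a cut cell may meet Omega in an
    arbitrarily thin piece. So nothing can be estimated cell by cell: every path has to stay in
    Omega, and each local bound uses the gradient on a larger cube intersected with Omega. The lower
    bound on the measure that a Poincaré inequality needs comes from the basis: each vertex i
    belongs to a cell contained in Omega, and shape regularity inscribes in that cell a cube of size
    comparable to h. The functions E phi_i can be negative, because affine functions are evaluated
    outside the cell on which they are given. This is why |m_ij| appears, and why sum_i |E phi_i| is
    bounded by counting overlaps although sum_i E phi_i = 1. The coefficients a_i are in general not
    nodal values of v, since the average at a vertex of an uncut cell may also use cut cells. The
    passage from v back to a therefore goes through the stability of the basis. *)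

Ltac nonneg := repeat lazymatch goal with
  | |- is_true (0 <= _ + _) => apply: addr_ge0
  | |- is_true (0 <= _ * _) => apply: mulr_ge0
  | |- is_true (0 <= _^-1) => rewrite invr_ge0
  | |- is_true (0 <= _ ^+ 2) => exact: sqr_ge0
  | |- is_true (0 <= _ ^+ _) => apply: exprn_ge0
  | |- _ => first [done | exact: ltW]
  end.

(** * Lebesgue measure on row vectors *)

Section row_vector_norm.
Variables (R : realType) (n : nat).
Implicit Types (x y z u : 'rV[R]_n) (r : R).

Lemma rV_norm_le x r : 0 <= r ->
  (`|x| <= r) <-> (forall i, `|x ord0 i| <= r).
Proof.
move=> r0; split=> [xr i|xr].
  apply: le_trans xr; rewrite [leRHS]/Num.norm /= mx_normrE.
  by apply/bigmax_geP; right => /=; exists (ord0, i).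
rewrite [leLHS]/Num.norm /= mx_normrE; apply/bigmax_leP; split=> //= -[i j] _ /=.
by rewrite ord1.
Qed.

Lemma rV_coord_le x i : `|x ord0 i| <= `|x|.
Proof. by have /(rV_norm_le x)[h _] := normr_ge0 x; exact: h. Qed.

(** The norm is the max norm, so these closed balls are boxes of explicit measure. All localisation
    is done with them. *)
Definition cube z r : set 'rV[R]_n := [set x | `|x - z| <= r].

Lemma cubeE z r : 0 <= r ->
  cube z r = [set x | forall i, z ord0 i - r <= x ord0 i <= z ord0 i + r].
Proof.
move=> r0; apply/seteqP; split=> x /=.
  by move/(rV_norm_le _ r0) => h i; have := h i; rewrite !mxE ler_distl.
by move=> h; apply/rV_norm_le => // i; rewrite !mxE ler_distl.
Qed.

Lemma measurable_cube z r : 0 <= r -> measurable (cube z r).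
Proof.
move=> r0; rewrite cubeE//.
have := measurable_box (\row_i (z ord0 i - r)) (\row_i (z ord0 i + r)).
by congr measurable; apply/seteqP; split=> x /= h i; have := h i; rewrite !mxE.
Qed.

Lemma lebesgue_cube z r : 0 <= r ->
  lebesgue_rV R n (cube z r) = ((2 * r) ^+ n)%:E.
Proof.
move=> r0; rewrite cubeE//.
have := @lebesgue_rV_box R n (\row_i (z ord0 i - r)) (\row_i (z ord0 i + r)).
under eq_bigr do rewrite !mxE.
rewrite (_ : mkset _ = [set x |
  forall i, z ord0 i - r <= x ord0 i <= z ord0 i + r]); last first.
  by apply/seteqP; split=> x /= h i; have := h i; rewrite !mxE.
move=> ->; last by move=> i; rewrite !mxE; lra.
rewrite (eq_bigr (fun=> 2 * r)) => [|i _]; last by ring.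
by rewrite big_const_ord iter_mulr_1.
Qed.

Lemma measurable_rV_add d (T : measurableType d) (f g : T -> 'rV[R]_n) :
  measurable_fun setT f -> measurable_fun setT g ->
  measurable_fun setT (fun t => f t + g t).
Proof.
move=> mf mg; apply: measurable_fun_rV => i.
rewrite (_ : (fun _ => _) = (fun t => f t ord0 i + g t ord0 i)); last first.
  by apply/funext => t; rewrite mxE.
apply: measurable_funD.
  exact: (measurableT_comp (measurable_coor i) mf).
exact: (measurableT_comp (measurable_coor i) mg).
Qed.

Lemma measurable_rV_scale d (T : measurableType d) (f : T -> measurableTypeR R) u :
  measurable_fun setT f ->
  measurable_fun setT (fun t => (f t : R) *: u).
Proof.
move=> mf; apply: measurable_fun_rV => i.
rewrite (_ : (fun _ => _) = (fun t => (f t : R) * u ord0 i)); last first.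
  by apply/funext => t; rewrite mxE.
by apply: measurable_funM.
Qed.

(** The sigma-algebra is generated by the coordinates, so an open set is exhibited as a countable
    union: of the cubes with rational centre and half-width [1 / (k + 1)] that it contains. *)
Lemma open_measurable_rV (U : set 'rV[R]_n) : open U -> measurable U.
Proof.
move=> oU.
pose c (p : 'rV[rat]_n * nat) := cube (map_mx ratr p.1) (p.2.+1%:R^-1 : R).
pose F k := if unpickle k is Some p then
  if `[< c p `<=` U >] then c p else set0 else set0.
rewrite (_ : U = \bigcup_k F k); last first.
  apply/seteqP; split=> [x Ux|x [k _]]; last first.
    by rewrite /F; case: unpickle => // p; case: asboolP => // h /h.
  have : nbhs x U by exact: open_nbhs_nbhs.
  rewrite -nbhs_ballE => -[e /= e0 xeU].
  (* With [1 / (k + 1) < e / 2], a cube of this half-width around a rational point near [x] contains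
     [x] and stays in the ball of radius [e] around [x]. *)
  pose k := Num.truncn (2 / e).
  have ke : k.+1%:R^-1 < e / 2.
    rewrite -(invf_div 2 e) ltf_pV2 ?posrE ?divr_gt0//.
    by rewrite /k; exact: truncnS_gt.
  have q (i : 'I_n) : {q : rat | `|x ord0 i - ratr q| <= k.+1%:R^-1}.
    apply: cid.
    have /rat_in_itvoo[q] : x ord0 i - k.+1%:R^-1 < x ord0 i + k.+1%:R^-1.
      by rewrite ltrD2l gt0_cp// invr_gt0.
    rewrite in_itv/= => qx; exists q.
    by move: qx => /andP[/ltW qx1 /ltW qx2]; rewrite ler_distlC qx1 qx2.
  pose p : 'rV[rat]_n * nat := (\row_i sval (q i), k).
  exists (pickle p) => //; rewrite /F pickleK.
  have cx : c p x.
    apply/rV_norm_le => [|i]; first by rewrite invr_ge0.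
    by rewrite !mxE; exact: (svalP (q i)).
  rewrite ifT//; apply/asboolP => y cy; apply: xeU.
  rewrite -ball_normE /= (le_lt_trans (ler_distD (map_mx ratr p.1) _ _))//.
  move: cx cy; rewrite /c /cube/= => cx cy.
  rewrite [X in _ + X]distrC.
  by rewrite (splitr e); apply: le_lt_trans (ltrD ke ke); exact: lerD.
apply: bigcupT_measurable => k; rewrite /F; case: unpickle => // p.
by case: asboolP => // _; apply: measurable_cube; rewrite invr_ge0.
Qed.

End row_vector_norm.

(** * Translation invariance of the product Lebesgue measure *)

Section translation_invariance.
Variable R : realType.

Lemma lebesgue_measure_shift (a : R) (A : set (measurableTypeR R)) :
  measurable A ->
  lebesgue_measure ((fun x : measurableTypeR R => x + a) @^-1` A) =
  lebesgue_measure A.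
Proof.
move=> mA; have mf : measurable_fun setT
    (fun x : measurableTypeR R => (x + a : measurableTypeR R)).
  exact: measurable_funD.
apply/esym.
pose m := measure_function_pushforward__canonical__measure_function_Measure
  (@lebesgue_measure R) mf.
apply: (@lebesgue_measure_unique R m) => // _ [[b c]] _ <-.
rewrite /= /pushforward.
rewrite (_ : _ @^-1` _ = `]b - a, c - a]%classic); last first.
  apply/seteqP; split=> x; rewrite /= !in_itv/= => /andP[? ?];
    by apply/andP; split; lra.
by rewrite !lebesgue_measure_itv/= !lte_fin ltrD2r -!EFinD; congr (if _ then _%:E else _); lra.
Qed.

Lemma measurable_rV_shift n (u : 'rV[R]_n) :
  measurable_fun setT (fun x : 'rV[R]_n => x + u).
Proof. exact: measurable_rV_add. Qed.

(** Induction on the dimension: the shift acts separately on the first coordinate and on the others,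
    so the shifted product measure agrees with the product measure on rectangles, which determine
    it. *)
Lemma lebesgue_rV_shift n (u : 'rV[R]_n) (A : set 'rV[R]_n) :
  measurable A ->
  lebesgue_rV R n ((fun x => x + u) @^-1` A) = lebesgue_rV R n A.
Proof.
elim: n u A => [|n ih] u A mA.
  rewrite (_ : _ @^-1` A = A)//; apply/seteqP; split=> x /=;
    by rewrite (_ : x + u = x)//; apply/rowP => -[].
pose u' : 'rV[R]_n := \row_i u ord0 (lift ord0 i).
pose s (p : measurableTypeR R * 'rV[R]_n) : measurableTypeR R * 'rV[R]_n :=
  (p.1 + u ord0 ord0, p.2 + u').
have ms : measurable_fun setT s.
  apply/measurable_fun_pairP; split.
    exact: measurable_funD.
  exact: measurable_rV_add.
pose m := measure_function_pushforward__canonical__measure_function_Measure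
  (@lebesgue_measure R \x lebesgue_rV R n)%E ms.
have mB : measurable (@rV_cons R n @^-1` A).
  by rewrite -[X in measurable X]setTI; exact: measurable_rV_cons.
rewrite /= /lebesgue_cons /pushforward.
rewrite [RHS](@product_measure_unique _ _ _ _ _ _ _ m)//; last first.
  move=> C D mC mD; rewrite /= /pushforward.
  rewrite (_ : s @^-1` _ = ((fun x : measurableTypeR R => x + u ord0 ord0) @^-1` C) `*`
     ((fun x => x + u') @^-1` D)); last by [].
  rewrite product_measure1E; last 2 first.
    rewrite -[X in measurable X]setTI; exact: measurable_funD.
    by rewrite -[X in measurable X]setTI; exact: measurable_rV_shift.
  by congr (_ * _)%E; [exact: lebesgue_measure_shift|exact: ih].
rewrite /= /pushforward; congr (_ _); apply/seteqP; split=> -[a y] /=;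
  set v := rV_cons _ + _; set w := rV_cons _;
  suff -> : v = w by [].
  all: by apply/rowP => i; rewrite !mxE; case: unliftP => [j ->|->] /=; rewrite ?mxE.
Qed.

Lemma ge0_integral_shift n (u : 'rV[R]_n) (f : 'rV[R]_n -> \bar R) :
  measurable_fun setT f -> (forall x, (0 <= f x)%E) ->
  (\int[lebesgue_rV R n]_x f (x + u)%R = \int[lebesgue_rV R n]_x f x)%E.
Proof.
move=> mf f0.
have := @ge0_integral_pushforward _ _ _ _ R _ (measurable_rV_shift u)
  (lebesgue_rV R n) setT f measurableT mf (fun x _ => f0 x).
rewrite preimage_setT => <-; apply: eq_measure_integral => [|mu A mA].
  exact: measurable_rV_shift.
by move=> _; exact: lebesgue_rV_shift.
Qed.

End translation_invariance.

(** * Tonelli's theorem over measurable rectangles, by extending the integrand by zero *)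

Section tonelli_in.
Context d1 d2 (T1 : measurableType d1) (T2 : measurableType d2) (R : realType).
Variables (m1 : {sigma_finite_measure set T1 -> \bar R}).
Variables (m2 : {sigma_finite_measure set T2 -> \bar R}).
Variable F : T1 * T2 -> \bar R.
Hypotheses (mF : measurable_fun setT F) (F0 : forall p, (0 <= F p)%E).

Lemma measurable_integral_in1 (B : set T2) : measurable B ->
  measurable_fun setT (fun x => \int[m2]_(y in B) F (x, y))%E.
Proof.
move=> mB; pose G := F \_ (setT `*` B).
have mG : measurable_fun setT G.
  by apply/(measurable_restrictT _ _).1; [exact: measurableX|exact: measurable_funTS].
have G0 p : (0 <= G p)%E by rewrite /G /patch; case: ifP.
rewrite (_ : (fun _ => _) = fubini_F m2 G).
  exact: measurable_fun_fubini_tonelli_F.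
apply/funext => x; rewrite /fubini_F [LHS]integral_mkcond.
by apply: eq_integral => y _; rewrite /G /patch in_setX in_setT.
Qed.

Lemma tonelli_in (A : set T1) (B : set T2) : measurable A -> measurable B ->
  (\int[m1]_(x in A) \int[m2]_(y in B) F (x, y) =
   \int[m2]_(y in B) \int[m1]_(x in A) F (x, y))%E.
Proof.
move=> mA mB; pose G := F \_ (A `*` B).
have mG : measurable_fun setT G.
  by apply/(measurable_restrictT _ _).1; [exact: measurableX|exact: measurable_funTS].
have G0 p : (0 <= G p)%E by rewrite /G /patch; case: ifP.
have := @fubini_tonelli _ _ _ _ _ m1 m2 G mG G0; rewrite /fubini_F /fubini_G => e.
transitivity (\int[m1]_x \int[m2]_y G (x, y))%E.
  rewrite [LHS]integral_mkcond; apply: eq_integral => x _; rewrite [LHS]/patch.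
  case: ifPn => [xA|xA]; last first.
    by rewrite integral0_eq// => y _; rewrite /G /patch in_setX (negbTE xA).
  rewrite [LHS]integral_mkcond; apply: eq_integral => y _.
  by rewrite /G /patch in_setX xA.
rewrite e [RHS]integral_mkcond; apply: eq_integral => y _; rewrite [in RHS]/patch.
case: ifPn => [yB|yB]; last first.
  by rewrite integral0_eq// => x _; rewrite /G /patch in_setX (negbTE yB) andbF.
rewrite [RHS]integral_mkcond; apply: eq_integral => x _.
by rewrite /G /patch in_setX yB andbT.
Qed.

Lemma tonelli_prod (A : set T1) (B : set T2) : measurable A -> measurable B ->
  (\int[m1 \x m2]_(p in A `*` B) F p =
   \int[m1]_(x in A) \int[m2]_(y in B) F (x, y))%E.
Proof.
move=> mA mB; rewrite [LHS]integral_mkcond; set G := F \_ (A `*` B).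
have mG : measurable_fun setT G.
  by apply/(measurable_restrictT _ _).1; [exact: measurableX|exact: measurable_funTS].
have G0 p : (0 <= G p)%E by rewrite /G /patch; case: ifP.
rewrite (@fubini_tonelli1 _ _ _ _ _ m1 m2 G mG G0) [RHS]integral_mkcond.
apply: eq_integral => x _; rewrite /fubini_F [RHS]/patch.
case: ifPn => [xA|xA]; last first.
  by rewrite integral0_eq// => y _; rewrite /G /patch in_setX (negbTE xA).
rewrite [RHS]integral_mkcond; apply: eq_integral => y _.
by rewrite /G /patch in_setX xA.
Qed.

End tonelli_in.

Section nonnegative_integrals.
Context d (T : measurableType d) (R : realType).
Variable m : {measure set T -> \bar R}.
Local Open Scope ereal_scope.

Lemma ge0_integral_setU_le (A B : set T) (f : T -> \bar R) :
  measurable A -> measurable B -> measurable_fun setT f ->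
  (forall x, 0 <= f x) ->
  \int[m]_(x in A `|` B) f x <= \int[m]_(x in A) f x + \int[m]_(x in B) f x.
Proof.
move=> mA mB mf f0; rewrite (_ : A `|` B = A `|` (B `\` A)); last first.
  by rewrite setUDr setDv setD0.
rewrite ge0_integral_setU//; last 3 first.
- exact: measurableD.
- exact: measurable_funTS.
- by rewrite disj_set2E setDIK.
apply: leeD => //; apply: ge0_subset_integral => //; first exact: measurableD.
exact: measurable_funTS.
Qed.

(** If [F] exceeded its mean at every point of [X], then [F] minus its mean would be positive with
    integral 0, hence zero almost everywhere, against [0 < m X]. *)
Lemma exists_le_mean (X : set T) (F : T -> \bar R) : measurable X ->
  0 < m X -> m X < +oo -> measurable_fun X F -> (forall x, X x -> 0 <= F x) ->
  exists2 y, X y & F y * m X <= \int[m]_(x in X) F x.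
Proof.
move=> mX X0 Xoo mF F0; apply: contrapT => h.
have mXfin : m X \is a fin_num by rewrite ge0_fin_numE.
have [r mXr] : exists r, m X = r%:E by exists (fine (m X)); rewrite fineK.
have r0 : (0 < r)%R by move: X0; rewrite mXr lte_fin.
have D0 : 0 <= \int[m]_(x in X) F x by exact: integral_ge0.
have Xne : X !=set0.
  by apply/set0P/eqP => X0'; move: X0; rewrite X0' measure0 ltxx.
have hlt y : X y -> \int[m]_(x in X) F x < F y * m X.
  by move=> Xy; rewrite ltNge; apply/negP => le; apply: h; exists y.
(* The integral is strictly below some value, hence finite, even where [F] is infinite. *)
have Dfin : \int[m]_(x in X) F x \is a fin_num.
  have [y0 Xy0] := Xne; rewrite ge0_fin_numE//.
  exact: (lt_le_trans (hlt _ Xy0) (leey _)).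
have [D DE] : exists D, \int[m]_(x in X) F x = D%:E.
  by exists (fine (\int[m]_(x in X) F x)); rewrite fineK.
have FD y : X y -> (D / r)%:E < F y.
  move=> Xy; have := hlt _ Xy; rewrite DE mXr; case: (F y) (F0 _ Xy) => [s| |]//.
    by rewrite -EFinM !lte_fin => _; rewrite ltr_pdivrMr.
  by move=> _ _; rewrite ltry.
have iF : m.-integrable X F.
  apply/integrableP; split=> //.
  rewrite (eq_integral F) ?DE ?ltry// => x; rewrite inE => Xx.
  by rewrite gee0_abs// F0.
have iD : m.-integrable X (cst (D / r)%:E).
  by apply/integrableP; split=> //; rewrite /= integral_cst// mXr -EFinM ltry.
have I0 : \int[m]_(x in X) `|F x - (D / r)%:E| = 0.
  rewrite (eq_integral (F \- cst (D / r)%:E)); last first.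
    move=> x; rewrite inE => Xx; rewrite gee0_abs//.
    by rewrite sube_ge0// ltW// FD.
  rewrite integralB// integral_cst// DE mXr -EFinM divfK ?gt_eqF//.
  by rewrite -EFinB subrr.
have /ae_eq_integral_abs : measurable_fun X (F \- cst (D / r)%:E).
  exact: emeasurable_funB.
move=> /(_ m mX) [/(_ I0) + _] => -[N [mN N0 XN]].
have : m X <= m N.
  rewrite le_measure ?inE// => x Xx; apply: XN => /= /(_ Xx) e.
  by have := FD _ Xx; rewrite -sube_gt0 e ltxx.
by rewrite N0 leNgt X0.
Qed.

End nonnegative_integrals.

(** * Poincaré inequality on a smooth domain *)

Section upper_gradients.
Variables (R : realType) (n : nat).
Implicit Types (Omega X A B : set 'rV[R]_n) (f g : 'rV[R]_n -> R).
Local Notation mu := (lebesgue_rV R n).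
Local Notation leb := (@lebesgue_measure R).

(* [g] plays the role of |grad f|^2: this is the defining inequality of an upper
   gradient, squared and combined with the Cauchy-Schwarz inequality. *)
Definition upper_gradient Omega f g :=
  [/\ measurable_fun setT f, measurable_fun setT g, forall x, 0 <= g x &
    forall x u, (forall t, 0 <= t <= 1 -> Omega (x + t *: u)) ->
      (((f (x + u) - f x) ^+ 2)%:E <= (dot u u)%:E *
        \int[leb]_(t in `[0%R, 1%R]) (g (x + t *: u))%:E)%E].

Lemma dot_ge0 (u : 'rV[R]_n) : 0 <= dot u u.
Proof. by apply: sumr_ge0 => i _; rewrite -expr2 sqr_ge0. Qed.

Lemma dot_le_norm (u : 'rV[R]_n) : dot u u <= n%:R * `|u| ^+ 2.
Proof.
apply: le_trans (_ : \sum_(i < n) `|u| ^+ 2 <= _); last first.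
  by rewrite sumr_const card_ord mulr_natl.
apply: ler_sum => i _; rewrite -expr2 -real_normK ?num_real//.
by rewrite lerXn2r ?nnegrE// rV_coord_le.
Qed.

(** For fixed [t] the map sending [x] to [x + w + t *: u] is a translation. So, once the order of
    integration is exchanged, the integral of [g] along it over [A] is at most the integral of [g]
    over [B], for every [t]. *)
Lemma integral_diff_translate_le Omega f g A B (w u : 'rV[R]_n) :
  upper_gradient Omega f g -> measurable A -> measurable B ->
  (forall x, A x -> forall t, 0 <= t <= 1 ->
    Omega (x + w + t *: u) /\ B (x + w + t *: u)) ->
  (\int[mu]_(x in A) ((f (x + w + u)%R - f (x + w)%R) ^+ 2)%:E <=
   (dot u u)%:E * \int[mu]_(x in B) (g x)%:E)%E.
Proof.
move=> [mf mg g0 fg] mA mB AB.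
pose I := `[0, 1]%classic : set (measurableTypeR R).
have mI : measurable I by exact: measurable_itv.
pose G := (fun x => (g x)%:E) \_ B.
have mG : measurable_fun setT G.
  have mEg : measurable_fun setT (EFin \o g) by exact/measurable_EFinP.
  by apply: (measurable_restrictT _ mB).1; exact: measurable_funTS.
have G0 x : (0 <= G x)%E by rewrite /G /patch; case: ifP; rewrite ?lee_fin.
pose F (p : 'rV[R]_n * measurableTypeR R) := G (p.1 + w + (p.2 : R) *: u).
have mF : measurable_fun setT F.
  apply: (measurableT_comp mG).
  apply: (@measurable_rV_add _ _ _ _
    (fun p : 'rV[R]_n * measurableTypeR R => p.1 + w)
    (fun p : 'rV[R]_n * measurableTypeR R => (p.2 : R) *: u)).
    by apply: measurable_rV_add.
  by apply: measurable_rV_scale.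
have F0 p : (0 <= F p)%E by exact: G0.
have mFx := measurable_integral_in1 (leb : {sigma_finite_measure set _ -> \bar R}) mF F0 mI.
apply: (@le_trans _ _ (\int[mu]_(x in A) ((dot u u)%:E * \int[leb]_(t in I) F (x, t)))%E).
  apply: ge0_le_integral => //.
  - by move=> x _; rewrite lee_fin sqr_ge0.
  - apply: measurable_funTS; apply/measurable_EFinP.
    apply: measurable_funX; apply: measurable_funB.
      apply: (measurableT_comp mf); apply: measurable_rV_add => //.
      exact: measurable_rV_shift.
    by apply: (measurableT_comp mf); exact: measurable_rV_shift.
  - by apply: measurable_funTS; exact: measurable_funeM.
  - move=> x Ax; have := @fg (x + w) u (fun t t01 => (AB x Ax t t01).1).
    congr (_ <= _ * _)%E; apply: eq_integral => t; rewrite inE/= in_itv/= => t01.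
    by rewrite /F /G /patch/= mem_set//; exact: (AB x Ax t t01).2.
rewrite ge0_integralZl//; last 3 first.
- exact: measurable_funTS.
- by move=> x _; exact: integral_ge0.
- by rewrite lee_fin dot_ge0.
apply: lee_wpmul2l; first by rewrite lee_fin dot_ge0.
apply: (@le_trans _ _ (\int[mu]_x \int[leb]_(t in I) F (x, t))%E).
  by apply: ge0_subset_integral => // x _; exact: integral_ge0.
rewrite (tonelli_in _ _ mF F0)// (eq_integral (cst (\int[mu]_x G x)%E)).
  have I1 : leb I = 1%E by rewrite lebesgue_measure_itv/= lte_fin ltr01 oppr0 adde0.
  by rewrite integral_cst// [X in (_ * X)%E]I1 mule1 /G -integral_mkcond.
move=> t _; rewrite /F /= -[RHS](@ge0_integral_shift _ _ (w + t *: u))//.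
by apply: eq_integral => x _; rewrite addrA.
Qed.

Definition oscillation X f :=
  (\int[mu]_(x in X) \int[mu]_(y in X) ((f x - f y) ^+ 2)%:E)%E.

(* Omega need not be locally convex, so [x] and [y] are joined through
   [x + w] and [y + w] instead of directly. *)
Lemma oscillation_translate_le Omega f g X B (z w : 'rV[R]_n) (r : R) :
  upper_gradient Omega f g -> measurable X -> measurable B -> 0 <= r ->
  X `<=` cube z r ->
  (forall x, X x -> forall t, 0 <= t <= 1 ->
    Omega (x + t *: w) /\ B (x + t *: w)) ->
  (forall x y, X x -> X y -> forall t, 0 <= t <= 1 ->
    Omega (x + w + t *: (y - x)) /\ B (x + w + t *: (y - x))) ->
  (oscillation X f <= (6 * (2 * r) ^+ n * dot w w +
      3 * (4 * r) ^+ n * (n%:R * (2 * r) ^+ 2))%:E *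
      \int[mu]_(x in B) (g x)%:E)%E.
Proof.
move=> ugfg mX mB r0 Xr Xw Xseg; have [mf mg g0 _] := ugfg.
set I := (\int[mu]_(x in B) (g x)%:E)%E.
have I0 : (0 <= I)%E by apply: integral_ge0 => x _; rewrite lee_fin.
(* [f x - f y] is the increment from [y] to [y + w], minus that from [x] to [x + w], minus that from
   [x + w] to [y + w]. Squaring three terms costs a factor 3; [h1] serves two of them, which makes
   the 6 in the statement, and [h2] the third. *)
pose h1 x := ((f (x + w) - f x) ^+ 2)%:E.
pose h2 (p : 'rV[R]_n * 'rV[R]_n) := ((f (p.2 + w) - f (p.1 + w)) ^+ 2)%:E.
have mfw d (T : measurableType d) (k : T -> 'rV[R]_n) : measurable_fun setT k ->
    measurable_fun setT (fun p => f (k p + w)).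
  by move=> mk; apply: (measurableT_comp mf); exact: measurable_rV_add.
have mfst : measurable_fun setT (@fst 'rV[R]_n 'rV[R]_n) by exact: measurable_fst.
have msnd : measurable_fun setT (@snd 'rV[R]_n 'rV[R]_n) by exact: measurable_snd.
have mh1 : measurable_fun setT h1.
  apply/measurable_EFinP; apply: measurable_funX; apply: measurable_funB => //.
  exact: (mfw _ _ id).
have mh2 : measurable_fun setT h2.
  by apply/measurable_EFinP; apply: measurable_funX; apply: measurable_funB; exact: mfw.
have h10 x : (0 <= h1 x)%E by rewrite lee_fin sqr_ge0.
have h20 x : (0 <= h2 x)%E by rewrite lee_fin sqr_ge0.
have muX : (mu X <= ((2 * r) ^+ n)%:E)%E.
  by rewrite -(lebesgue_cube z r0) le_measure// ?inE//; exact: measurable_cube.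
have mc2 : measurable (cube (0 : 'rV[R]_n) (2 * r)).
  by apply: measurable_cube; rewrite mulr_ge0.
have H1 : (\int[mu]_(x in X) h1 x <= (dot w w)%:E * I)%E.
  have := @integral_diff_translate_le Omega f g X B 0 w ugfg mX mB.
  rewrite (eq_integral h1); last by move=> x _; rewrite addr0.
  by apply => x Xx t t01; rewrite addr0; exact: Xw.
have H11 : (\int[mu]_(x in X) \int[mu]_(y in X) h1 x <=
    ((2 * r) ^+ n * dot w w)%:E * I)%E.
  rewrite (eq_integral (fun x => mu X * h1 x)%E); last first.
    by move=> x _; rewrite integral_cst// muleC.
  rewrite ge0_integralZl//; last exact: measurable_funTS.
  rewrite EFinM -muleA; apply: lee_pmul => //.
  exact: integral_ge0.
have H2 : (\int[mu]_(x in X) \int[mu]_(y in X) h2 (x, y) <=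
    ((4 * r) ^+ n * (n%:R * (2 * r) ^+ 2))%:E * I)%E.
  pose H := h2 \_ (setT `*` X).
  have mH : measurable_fun setT H.
    by apply/(measurable_restrictT _ _).1; [exact: measurableX|exact: measurable_funTS].
  have H0 p : (0 <= H p)%E by rewrite /H /patch; case: ifP.
  (* New variables: the point [x] and the displacement [u = y - x], which ranges over a cube of
     half-width [2 * r] and measure [(4 * r) ^+ n]. For fixed [u] the integral in [x] is of the form
     bounded by [integral_diff_translate_le]. *)
  pose K (p : 'rV[R]_n * 'rV[R]_n) := H (p.1, p.2 + p.1).
  have mK : measurable_fun setT K.
    apply: (measurableT_comp mH); apply/measurable_fun_pairP; split => //.
    exact: measurable_rV_add.
  have K0 p : (0 <= K p)%E by exact: H0.
  rewrite (eq_integral (fun x => \int[mu]_(u in cube 0 (2 * r)) K (x, u)))%E; last first.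
    move=> x; rewrite inE => Xx.
    rewrite integral_mkcond [RHS]integral_mkcond.
    rewrite -[LHS](@ge0_integral_shift _ _ x); last 2 first.
    - apply/(measurable_restrictT _ _).1 => //; apply: measurable_funTS.
      exact: (measurableT_comp mh2).
    - by move=> y; rewrite /patch; case: ifP.
    apply: eq_integral => u _; rewrite /K /H /patch/= in_setX in_setT/=.
    case: (boolP (u + x \in X)) => [/set_mem Xxu|_]; last by rewrite if_same.
    rewrite mem_set// /cube/= subr0 (_ : u = (u + x - z) - (x - z)); last first.
      by rewrite opprB addrA subrK addrK.
    rewrite (le_trans (ler_normB _ _))// mulr2n mulrDl mul1r.
    by apply: lerD; exact: Xr.
  rewrite (tonelli_in _ _ mK K0)//.
  apply: (@le_trans _ _ (\int[mu]_(u in cube 0 (2 * r))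
      cst ((n%:R * (2 * r) ^+ 2)%:E * I) u)%E).
    apply: ge0_le_integral => //.
    - by move=> u _; exact: integral_ge0.
    - apply: measurable_funTS.
      apply: (@measurable_integral_in1 _ _ _ _ _ mu (fun p => K (p.2, p.1))) => //.
      apply: (measurableT_comp mK); apply/measurable_fun_pairP; split => //.
    - move=> u; rewrite /cube/= subr0 => u2r.
      pose A := X `&` ((fun x => x + u) @^-1` X).
      have mA : measurable A.
        apply: measurableI => //; rewrite -[X in measurable X]setTI.
        exact: measurable_rV_shift.
      apply: (@le_trans _ _ ((dot u u)%:E * I)%E).
        have := @integral_diff_translate_le Omega f g A B w u ugfg mA mB.
        rewrite integral_mkcond [X in _ -> (X <= _)%E]integral_mkcond.
        rewrite (eq_integral ((fun x => K (x, u)) \_ X)); last first.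
          move=> x _; rewrite /K /H /A /patch in_setX in_setT /h2/=.
          rewrite in_setI (_ : (x \in (fun x => x + u) @^-1` X) = (x + u \in X)); last first.
            by apply/idP/idP; rewrite !inE.
          rewrite (addrC u x); case: (x \in X) => //=; case: ifP => // _.
          by rewrite addrAC.
        apply => x [Xx Xxu] t t01.
        by have := Xseg _ _ Xx Xxu t t01; rewrite (addrC x u) addrK.
      apply: lee_wpmul2r => //; rewrite lee_fin.
      apply: le_trans (dot_le_norm u) _; apply: ler_wpM2l => //.
      by rewrite lerXn2r// nnegrE// mulr_ge0.
  rewrite integral_cst//.
  have c4 : mu (cube 0 (2 * r)) = ((4 * r) ^+ n)%:E.
    by rewrite lebesgue_cube ?mulr_ge0// mulrA -natrM.
  by rewrite [X in (_ * X <= _)%E]c4 muleC muleA -EFinM.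
pose F (p : 'rV[R]_n * 'rV[R]_n) := ((f p.1 - f p.2) ^+ 2)%:E.
have mF : measurable_fun setT F.
  apply/measurable_EFinP; apply: measurable_funX; apply: measurable_funB.
    exact: (measurableT_comp mf).
  exact: (measurableT_comp mf).
have F0 p : (0 <= F p)%E by rewrite lee_fin sqr_ge0.
have mh11 : measurable_fun setT (fun p : 'rV[R]_n * 'rV[R]_n => h1 p.1).
  exact: (measurableT_comp mh1).
have mh12 : measurable_fun setT (fun p : 'rV[R]_n * 'rV[R]_n => h1 p.2).
  exact: (measurableT_comp mh1).
have mXX : measurable (X `*` X) by exact: measurableX.
rewrite /oscillation -(@tonelli_prod _ _ _ _ _ mu mu F)//.
apply: (@le_trans _ _ (\int[(mu \x mu)%E]_(p in X `*` X)
    (3%:E * (h1 p.1 + (h2 p + h1 p.2))))%E).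
  apply: ge0_le_integral => //.
  - exact: measurable_funTS.
  - by apply: measurable_funTS; apply: measurable_funeM; do 2! apply: emeasurable_funD => //.
  - move=> p _; rewrite /F /h1 /h2 -!EFinD -EFinM lee_fin.
    set a := f (_ + _) - f p.1; set b := f (p.2 + w) - f p.2.
    set c := f (p.2 + w) - f (p.1 + w).
    rewrite (_ : f p.1 - f p.2 = b - a - c); last by rewrite /a /b /c; ring.
    have := sqr_ge0 (a + b); have := sqr_ge0 (a - c); have := sqr_ge0 (b + c).
    by nra.
rewrite ge0_integralZl//; last 2 first.
- by apply: measurable_funTS; do 2! apply: emeasurable_funD => //.
- by move=> p _; rewrite !adde_ge0.
rewrite ge0_integralD//; last 3 first.
- exact: measurable_funTS.
- by move=> p _; rewrite adde_ge0.
- by apply: measurable_funTS; apply: emeasurable_funD.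
rewrite ge0_integralD//; last 2 first.
- exact: measurable_funTS.
- exact: measurable_funTS.
rewrite (@tonelli_prod _ _ _ _ _ mu mu (fun p => h1 p.1))//.
rewrite (@tonelli_prod _ _ _ _ _ mu mu h2)//.
rewrite (@tonelli_prod _ _ _ _ _ mu mu (fun p => h1 p.2))//.
rewrite (@tonelli_in _ _ _ _ _ mu mu (fun p => h1 p.2))//=.
apply: (@le_trans _ _ (3%:E * (((2 * r) ^+ n * dot w w)%:E * I +
   (((4 * r) ^+ n * (n%:R * (2 * r) ^+ 2))%:E * I + ((2 * r) ^+ n * dot w w)%:E * I)))%E).
  by apply: lee_wpmul2l => //; do 2? apply: leeD.
have := dot_ge0 w => w0.
rewrite -!ge0_muleDl ?lee_fin ?addr_ge0 ?mulr_ge0 ?exprn_ge0//; try by rewrite mulr_ge0.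
rewrite -!EFinD muleA -EFinM; apply: lee_wpmul2r => //; rewrite lee_fin.
by rewrite le_eqVlt; apply/orP; left; apply/eqP; ring.
Qed.

End upper_gradients.

(** * Smooth functions are locally Lipschitz *)

Section local_lipschitz.
Variables (R : realType) (n : nat).
Implicit Types (f : 'rV[R]_n -> R) (x y z v : 'rV[R]_n).

Lemma derivable_line f x v t : derivable f (x + t *: v) v ->
  is_derive t 1 (fun s => f (x + s *: v)) ('D_v f (x + t *: v)).
Proof.
move=> df.
have e : (fun h : R => h^-1 *: (((fun s => f (x + s *: v)) \o shift t) (h *: 1) -
      f (x + t *: v))) =
    (fun h => h^-1 *: ((f \o shift (x + t *: v)) (h *: v) - f (x + t *: v))).
  apply/funext => h /=; congr (_ *: (f _ - _)).
  by rewrite [h%:A]mulr1 scalerDl addrCA.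
by apply: DeriveDef; rewrite /derivable /derive e.
Qed.

Lemma mean_value_line f x v (b M : R) :
  (forall t, `|t| <= `|b| -> derivable f (x + t *: v) v /\
     `|'D_v f (x + t *: v)| <= M) ->
  `|f (x + b *: v) - f x| <= M * `|b|.
Proof.
pose phi (s : R) : R := f (x + s *: v).
pose dphi (s : R) : R := 'D_v f (x + s *: v).
move=> dM; have fx : f x = phi 0 by rewrite /phi scale0r addr0.
have h a c : a <= c -> (forall t, a <= t <= c -> `|t| <= `|b|) ->
    `|phi c - phi a| <= M * `|c - a|.
  move=> ac abc.
  have d t : t \in `[a, c] -> is_derive t 1 phi (dphi t).
    by rewrite in_itv/= => /abc/dM[? _]; exact: derivable_line.
  have doo t : t \in `]a, c[ -> is_derive t 1 phi (dphi t).
    by move=> tac; apply: d; exact: subset_itv_oo_cc tac.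
  have cphi : {within `[a, c], continuous phi}.
    by apply: derivable_within_continuous => t /d [].
  have [t tac e] := @MVT_segment R phi dphi a c ac doo cphi.
  rewrite e normrM ler_wpM2r//.
  by move: tac; rewrite in_itv/= => /abc/dM[].
rewrite fx -/(phi b); have [b0|b0] := leP 0 b.
  rewrite -[X in _ <= _ * `|X|]subr0; apply: h => // t /andP[t0 tb].
  by rewrite !ger0_norm// (le_trans t0 tb).
rewrite distrC -[X in _ <= _ * X]normrN -[- b]sub0r; apply: h; first exact: ltW.
by move=> t /andP[bt t0]; rewrite (ler0_norm t0) (ltr0_norm b0) lerN2.
Qed.

(** Smoothness speaks of derivatives along the axes only, so [x] is reached from [y] by changing one
    coordinate at a time: [p k] below has the first [k] coordinates of [x] and the others of [y]. *)
Lemma smooth_locally_lipschitz f z : smooth f ->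
  exists r L, [/\ 0 < r, 0 <= L & forall x y, cube z r x -> cube z r y ->
    `|f x - f y| <= L * `|x - y|].
Proof.
move=> sf.
pose D i x := 'D_(delta_mx ord0 i) f x.
have cD i : continuous (D i) by exact: (sf [:: i]).1.
pose M := \sum_(i < n) (`|D i z| + 1).
have [r r0 rM] : exists2 r : R, 0 < r & forall i x, cube z r x -> `|D i x| <= M.
  have : \forall r \near (0 : R)^'+, forall i x, cube z r x -> `|D i x| <= M.
    apply: filter_forall => i.
    have : \forall x \near z, `|D i x| <= M.
      have /cvgr_dist_lt /(_ 1 ltr01) := cD i z; apply: filterS => x Dx.
      apply: (@le_trans _ _ (`|D i z| + 1)).
        rewrite -lerBlDl (le_trans (lerB_dist _ _))// distrC; exact: ltW.
      rewrite /M (bigD1 i)//= lerDl; apply: sumr_ge0 => j _; exact: addr_ge0.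
    move=> /nbhs_ballP[e /= e0 ze]; near=> r => x; rewrite /cube/= => xr.
    apply: ze; rewrite -ball_normE/= distrC; apply: le_lt_trans xr _.
    by near: r; exact: nbhs_right_lt.
  have : \forall r \near (0 : R)^'+, 0 < r by exact: nbhs_right_gt.
  by move=> h1 h2; have [r [r0 hr]] := filter_ex (filterI h1 h2); exists r.
have M0 : 0 <= M by apply: sumr_ge0 => j _; exact: addr_ge0.
(* [mean_value_line] asks for control at increments of both signs up to [|x_i - y_i| <= 2 * r / 3].
   Starting within [r / 3] of [z], they stay within [r]. *)
exists (r / 3), (M *+ n); split => // [||x y xr yr].
- by rewrite divr_gt0.
- exact: mulrn_wge0.
have r30 : 0 <= r / 3 by rewrite divr_ge0// ltW.
pose p k : 'rV[R]_n := \row_i (if (i < k)%N then x ord0 i else y ord0 i).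
have p0 : p 0%N = y by apply/rowP => i; rewrite mxE.
have pn : p n = x by apply/rowP => i; rewrite mxE ltn_ord.
have -> : f x - f y = \sum_(0 <= k < n) (f (p k.+1) - f (p k)).
  by rewrite telescope_sumr// p0 pn.
rewrite (le_trans (ler_norm_sum _ _ _))// big_mkord.
rewrite (_ : M *+ n * _ = \sum_(i < n) M * `|x - y|); last first.
  by rewrite sumr_const card_ord mulrnAl.
apply: ler_sum => i _.
have -> : p i.+1 = p i + (x ord0 i - y ord0 i) *: delta_mx ord0 i.
  apply/rowP => j; rewrite !mxE eqxx/= ltnS leq_eqVlt.
  have [->|ji] := eqVneq j i; first by rewrite eqxx ltnn mulr1 addrC subrK.
  by rewrite mulr0 addr0 val_eqE (negbTE ji).
apply: (@le_trans _ _ (M * `|x ord0 i - y ord0 i|)); last first.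
  by rewrite ler_wpM2l//; have := rV_coord_le (x - y) i; rewrite !mxE.
have xz j := (rV_norm_le _ r30).1 xr j.
have yz j := (rV_norm_le _ r30).1 yr j.
apply: mean_value_line => t tb; split; first exact: ((sf [::]).2 i).
apply: rM; apply/rV_norm_le => [|j]; first exact: ltW.
have := xz j; have := yz j; rewrite !mxE eqxx/= => yzj xzj.
have [ji|ji] := eqVneq j i; last first.
  rewrite mulr0 addr0 (@le_trans _ _ (r / 3))//; first by case: ifP.
  by rewrite ler_pdivrMr// ler_peMr ?ltW// ltr1n.
rewrite ji in xzj yzj *; rewrite ltnn mulr1.
move: xzj yzj tb; rewrite !ler_norml.
set a := x ord0 i; set c := y ord0 i; set d := z ord0 i.
have [h|h] := leP 0 (a - c).
  by rewrite ger0_norm//; move=> /andP[? ?] /andP[? ?] /andP[? ?]; apply/andP; split; lra.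
by rewrite ltr0_norm//; move=> /andP[? ?] /andP[? ?] /andP[? ?]; apply/andP; split; lra.
Unshelve. all: by end_near.
Qed.

End local_lipschitz.

(** * Inward translation near the boundary, and the Poincaré inequalities that follow from it *)

Section inward_translation.
Variables (R : realType) (n : nat) (Omega : set 'rV[R]_n).
Hypotheses (oOmega : open Omega) (bOmega : bounded_set Omega).
Hypothesis sOmega : smooth_boundary Omega.
Implicit Types x y z w : 'rV[R]_n.

Let mu := lebesgue_rV R n.

Lemma cube_convex u v z (t r : R) : 0 <= t <= 1 -> cube z r u -> cube z r v ->
  cube z r (u + t *: (v - u)).
Proof.
rewrite /cube/= => /andP[t0 t1] ur vr.
have -> : u + t *: (v - u) - z = (1 - t) *: (u - z) + t *: (v - z).
  by apply/rowP => i; rewrite !mxE; ring.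
rewrite (le_trans (ler_normD _ _))// !normrZ (ger0_norm t0) ger0_norm ?subr_ge0//.
have -> : r = (1 - t) * r + t * r by ring.
by apply: lerD; apply: ler_wpM2l => //; rewrite subr_ge0.
Qed.

(** At an interior point a convex neighbourhood suffices and [e] is 0. At a boundary point Omega
    lies above the graph of [gam], with local Lipschitz constant [L], and [e] points along the graph
    axis with length [L]. A point of the segment from [x] to [y] is within [eps] of both ends, so
    the graph there is higher by at most [L * eps], which is the height gained by adding
    [eps *: e]. *)
Lemma local_inward_translation x0 : closure Omega x0 ->
  exists r e, 0 < r /\ forall x y eps, Omega x -> Omega y ->
    cube x0 r x -> cube x0 r y -> `|x - y| <= eps -> eps <= r ->
    forall t, 0 <= t <= 1 -> Omega (x + t *: (eps *: e)) /\
      Omega (x + eps *: e + t *: (y - x)).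
Proof.
move=> clx0; have [Ox0|nOx0] := pselect (Omega x0).
  have /nbhs_ballP[s /= s0 sO] : nbhs x0 Omega by exact: open_nbhs_nbhs.
  exists (s / 2), 0; split=> [|x y eps Ox Oy xr yr _ _ t t01].
    by rewrite divr_gt0.
  rewrite !scaler0 !addr0; split=> //; apply: sO.
  rewrite -ball_normE/= distrC; apply: (@le_lt_trans _ _ (s / 2)); last lra.
  exact: cube_convex.
have bx0 : boundary Omega x0 by split=> // /interior_subset.
have [r1 [k [b [gam [r10 sg Ogam]]]]] := sOmega bx0.
have [r2 [L [r20 L0 Lip]]] := smooth_locally_lipschitz (col' k x0) sg.
pose sg1 : R := (-1) ^+ b.
have sg2 : sg1 * sg1 = 1 by rewrite -expr2 /sg1 sqrr_sign.
(* Translated points of the cube are within [r + r * L < r1] of [x0], hence still in the chart;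
   below [r2] the Lipschitz bound is available. *)
pose r := Num.min (r1 / (L + 2)) r2.
have r0 : 0 < r by rewrite lt_min r20 andbT divr_gt0// ltr_wpDl.
have rL : r * (L + 2) <= r1.
  by rewrite -ler_pdivlMr ?ltr_wpDl// /r ge_min lexx.
have rr2 : r <= r2 by rewrite /r ge_min lexx orbT.
pose e : 'rV[R]_n := (L * sg1) *: delta_mx ord0 k.
have e1 : `|e| <= L.
  apply/rV_norm_le => // i; rewrite !mxE eqxx/=.
  case: eqVneq => _; last by rewrite mulr0 normr0.
  by rewrite mulr1 normrM normr_sign mulr1 ger0_norm.
have cole : col' k e = 0.
  by apply/rowP => i; rewrite !mxE eqxx/= eq_sym (negbTE (neq_lift _ _)) mulr0.
have ek : e ord0 k = L * sg1 by rewrite !mxE !eqxx mulr1.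
clearbody e.
have nonneg_eps x y eps : `|x - y| <= eps -> 0 <= eps by exact: le_trans.
have inball x eps t : cube x0 r x -> 0 <= eps <= r -> 0 <= t <= 1 ->
    ball x0 r1 (x + t *: (eps *: e)).
  move=> xr /andP[eps0 epsr] /andP[t0 t1]; rewrite -ball_normE/= distrC addrAC.
  rewrite (le_lt_trans (ler_normD _ _))// !normrZ (ger0_norm t0) (ger0_norm eps0).
  apply: (@le_lt_trans _ _ (r + r * L)); last by nra.
  apply: lerD => //; rewrite -[leRHS]mul1r.
  by rewrite ler_pM ?mulr_ge0// ler_pM.
have colcube x : cube x0 r x -> cube (col' k x0) r2 (col' k x).
  move=> xr; apply/rV_norm_le => [|i]; first exact: ltW.
  rewrite !mxE; have /(rV_norm_le _ (ltW r0)) /(_ (lift k i)) := xr.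
  by rewrite !mxE => /le_trans; apply.
have ballx x : cube x0 r x -> ball x0 r1 x.
  move=> xr; have := inball x 0 0 xr; rewrite scale0r addr0 !lexx ler01 (ltW r0).
  exact.
exists r, e; split=> // x y eps Ox Oy xr yr xy epsr t t01.
have eps0 := nonneg_eps _ _ _ xy.
have /andP[t0 t1] := t01.
have /Ogam := ballx _ xr => /iffLR /(_ Ox) gx.
have /Ogam := ballx _ yr => /iffLR /(_ Oy) gy.
split.
  apply/Ogam; first by apply: inball; rewrite ?eps0.
  have -> : col' k (x + t *: (eps *: e)) = col' k x.
    by rewrite linearD 2!linearZ/= cole !scaler0 addr0.
  apply: lt_le_trans gx _; rewrite 3!mxE ek mulrDr lerDl -/sg1.
  rewrite (_ : sg1 * _ = t * eps * L * (sg1 * sg1)); last by ring.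
  by rewrite sg2 mulr1 !mulr_ge0.
set p := x + t *: (y - x).
have pE : x + eps *: e + t *: (y - x) = p + 1 *: (eps *: e).
  by rewrite scale1r /p addrAC.
have pr : cube x0 r p by exact: cube_convex.
rewrite pE; apply/Ogam.
  by apply: inball => //; rewrite ?eps0// ler01 lexx.
have -> : col' k (p + 1 *: (eps *: e)) = col' k p.
  by rewrite linearD 2!linearZ/= cole !scaler0 addr0.
have px : `|p - x| <= eps.
  rewrite /p addrAC subrr add0r normrZ (ger0_norm t0) distrC.
  by rewrite -[leRHS]mul1r ler_pM.
have py : `|p - y| <= eps.
  rewrite (_ : p - y = (1 - t) *: (x - y)); last first.
    by apply/rowP => i; rewrite !mxE; ring.
  rewrite normrZ ger0_norm ?subr_ge0// -[leRHS]mul1r ler_pM ?subr_ge0//.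
  by rewrite gerBl.
have col_le (u v : 'rV[R]_n) : `|col' k (u - v)| <= `|u - v|.
  by apply/rV_norm_le => // i; rewrite mxE rV_coord_le.
have gpx : gam (col' k p) - gam (col' k x) <= L * eps.
  rewrite (le_trans (ler_norm _))// (le_trans (Lip _ _ (colcube _ pr) (colcube _ xr)))//.
  by rewrite ler_wpM2l// -linearB (le_trans (col_le _ _)).
have gpy : gam (col' k p) - gam (col' k y) <= L * eps.
  rewrite (le_trans (ler_norm _))// (le_trans (Lip _ _ (colcube _ pr) (colcube _ yr)))//.
  by rewrite ler_wpM2l// -linearB (le_trans (col_le _ _)).
have pk : p ord0 k = x ord0 k + t * (y ord0 k - x ord0 k) by rewrite !mxE.
have -> : (p + 1 *: (eps *: e)) ord0 k = p ord0 k + eps * (L * sg1).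
  by rewrite scale1r [LHS]mxE; congr (_ + _); rewrite mxE ek.
rewrite -/sg1; set q := sg1 * _.
have -> : q = (1 - t) * (sg1 * x ord0 k) + t * (sg1 * y ord0 k) + L * eps * (sg1 * sg1).
  by rewrite /q pk; ring.
rewrite sg2 mulr1; move: gx gy gpx gpy; rewrite -/sg1.
set X := sg1 * x ord0 k; set Y := sg1 * y ord0 k; move=> gx gy gpx gpy.
(* The strict inequality at [x] enters with the factor [1 - t], so at [t = 1] the strictness has to
   come from [y]. *)
have [tt|tt] := ltP t 1.
  have : (1 - t) * gam (col' k x) < (1 - t) * X by rewrite ltr_pM2l// subr_gt0.
  have : t * gam (col' k y) <= t * Y by rewrite ler_wpM2l// ltW.
  have : (1 - t) * gam (col' k p) <= (1 - t) * (gam (col' k x) + L * eps).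
    by rewrite ler_wpM2l ?subr_ge0// -lerBlDl.
  have : t * gam (col' k p) <= t * (gam (col' k y) + L * eps).
    by rewrite ler_wpM2l// -lerBlDl.
  lra.
have -> : t = 1 by apply/eqP; rewrite eq_le t1.
lra.
Qed.

Lemma bounded_ex : exists2 D : R, 0 < D & Omega `<=` cube 0 D.
Proof.
have [D [_ OD]] := bOmega; exists (`|D| + 1) => [|x Ox]; first exact: ltr_wpDl.
rewrite /cube/= subr0; apply: OD => //.
by rewrite (le_lt_trans (ler_norm _))// ltrDl.
Qed.

Lemma compact_closure_Omega : compact (closure Omega).
Proof.
apply: bounded_closed_compact; last exact: closed_closure.
have [D D0 OD] := bounded_ex.
have : closure Omega `<=` cube 0 (D + 1).
  move=> x /(_ (ball x 1)) []; first exact: nbhsx_ballx.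
  move=> y [/OD]; rewrite /cube/= !subr0 => yD; rewrite -ball_normE/= => xy.
  rewrite -(subrK y x) (le_trans (ler_normD _ _))// addrC lerD// ltW//.
move=> cD; exists (D + 1); split=> [|M DM x /cD]; first exact: num_real.
by rewrite /cube/= subr0 => /le_trans; apply; exact: ltW.
Qed.

(* One vector [w] of length O(r) pushes all points of Omega near [z] so far inside
   that the segments between the translated points stay in Omega. *)
Definition inward_at (M : R) z (r : R) := exists w, `|w| <= M * r /\
  forall x y, Omega x -> Omega y -> cube z r x -> cube z r y ->
  forall t, 0 <= t <= 1 ->
  Omega (x + t *: w) /\ Omega (x + w + t *: (y - x)).

(** The local statement holds around each point of the compact closure for all large [M], so one [M]
    serves everywhere. In [P] the cube is centred at a point [x'] of the closure and has half-width
    [2 * r]: a cube of half-width [r] around any [z] is contained in such a cube as soon as it meets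
    Omega, and otherwise there is nothing to prove. Two points of the larger cube are at distance at
    most [4 * r], which is the [eps] used. *)
Lemma uniform_inward_translation : exists2 M, 0 < M &
  forall z r, 0 < r -> M * r <= 1 -> inward_at M z r.
Proof.
pose P (M : R) x' := forall r, 0 < r -> M * r <= 1 -> exists w, `|w| <= M * r /\
  forall x y, Omega x -> Omega y -> cube x' (2 * r) x -> cube x' (2 * r) y ->
  forall t, 0 <= t <= 1 ->
  Omega (x + t *: w) /\ Omega (x + w + t *: (y - x)).
have /compact_near_coveringP nc := compact_closure_Omega.
have h : \forall M \near +oo, closure Omega `<=` P M.
  apply: nc => x0 /local_inward_translation [r0 [e [r00 er]]].
  near=> x' M => r r0' /= Mr.
  have M0 : 0 < M by near: M; exact: nbhs_pinfty_gt.
  have Mr0 : 4 / r0 <= M by near: M; apply: nbhs_pinfty_ge; rewrite num_real.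
  have Me : 4 * `|e| <= M by near: M; apply: nbhs_pinfty_ge; rewrite num_real.
  have r4 : 4 * r <= r0.
    move: Mr0; rewrite ler_pdivrMr// => Mr0; rewrite -(ler_pM2l M0).
    by nra.
  exists ((4 * r) *: e); split.
    have r40 : 0 <= 4 * r by nonneg.
    by rewrite normrZ (ger0_norm r40) mulrAC ler_wpM2r// ltW.
  have x0x' : `|x' - x0| <= r0 / 2.
    have : ball x0 (r0 / 2) x' by near: x'; apply: nbhsx_ballx; rewrite divr_gt0.
    by rewrite -ball_normE/= distrC => /ltW.
  have sub x : cube x' (2 * r) x -> cube x0 r0 x.
    rewrite /cube/= => xr; rewrite (le_trans (ler_distD x' _ _))//; lra.
  move=> x y Ox Oy xr yr t t01; apply: er => //; try exact: sub.
  rewrite (le_trans (ler_distD x' _ _))//; move: xr yr; rewrite /cube/= (distrC x').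
  lra.
have h0 : \forall M \near +oo, (0 : R) < M by exact: nbhs_pinfty_gt.
have [M [hM M0]] := filter_ex (filterI h h0).
exists M => // z r r0 Mr; have [[x' [Ox' zx']]|nx'] :=
    pselect (exists x', Omega x' /\ cube z r x').
  have [w [wM hw]] := hM _ (@subset_closure _ _ _ Ox') _ r0 Mr.
  have sub x : cube z r x -> cube x' (2 * r) x.
    move: zx'; rewrite /cube/= => zx' xr; rewrite (le_trans (ler_distD z _ _))//.
    by rewrite (distrC z); lra.
  by exists w; split=> // x y Ox Oy /sub xr /sub yr; exact: hw.
exists 0; split=> [|x y Ox _ zx]; first by rewrite normr0 mulr_ge0 ?ltW.
by exfalso; apply: nx'; exists x.
Unshelve. all: by end_near.
Qed.

Lemma measurable_Omega : measurable Omega.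
Proof. exact: open_measurable_rV. Qed.

(** The factor in [oscillation_translate_le] for [|w| <= M * r], after [r ^+ n.+2] has been taken
    out. *)
Definition oscillation_cst (M : R) : R :=
  6 * 2 ^+ n * (n%:R * M ^+ 2) + 12 * 4 ^+ n * n%:R.

Lemma oscillation_cst_ge0 M : 0 <= oscillation_cst M.
Proof. rewrite /oscillation_cst; nonneg. Qed.

(** The constant is [f y] for a point [y] whose mean square deviation from the rest of [X] does not
    exceed the average one; this is where the division by [m] comes from. The cube on the right is
    larger because the translated segments leave the original one by up to [M * r]. *)
Lemma poincare_cube M z r (X : set 'rV[R]_n) m f g : 0 <= M -> 0 < r ->
  inward_at M z r -> measurable X -> X `<=` Omega `&` cube z r ->
  0 < m -> (m%:E <= mu X)%E -> upper_gradient Omega f g ->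
  exists c, (\int[mu]_(x in X) ((f x - c) ^+ 2)%:E <=
    (oscillation_cst M * r ^+ n.+2 / m)%:E *
    \int[mu]_(x in Omega `&` cube z ((1 + M) * r)) (g x)%:E)%E.
Proof.
move=> M0 r0 [w [wM hw]] mX XO m0 mX' ugfg; have [mf mg g0 _] := ugfg.
set B := Omega `&` _.
have r1 : 0 <= (1 + M) * r by rewrite mulr_ge0 ?addr_ge0// ltW.
have mB : measurable B.
  by apply: measurableI; [exact: measurable_Omega|exact: measurable_cube].
have XOm x : X x -> Omega x by move=> /XO[].
have Xr x : X x -> cube z r x by move=> /XO[].
have muX : (mu X <= ((2 * r) ^+ n)%:E)%E.
  rewrite -(lebesgue_cube z (ltW r0)) le_measure// ?inE//.
  by apply: measurable_cube; exact: ltW.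
have osc := @oscillation_translate_le R n Omega f g X B z w r ugfg mX mB (ltW r0) Xr.
have far p u : cube z r p -> `|u| <= M * r -> cube z ((1 + M) * r) (p + u).
  rewrite /cube/= addrAC => pr ur; rewrite (le_trans (ler_normD _ _))//.
  by rewrite mulrDl mul1r lerD.
have osc1 : forall x, X x -> forall t, 0 <= t <= 1 ->
    Omega (x + t *: w) /\ B (x + t *: w).
  move=> x Xx t t01.
  have [? _] := hw x x (XOm _ Xx) (XOm _ Xx) (Xr _ Xx) (Xr _ Xx) t t01.
  split=> //; split=> //; apply: far; first exact: Xr.
  have /andP[t0 t1] := t01.
  by rewrite normrZ ger0_norm// -[leRHS]mul1r ler_pM.
have osc2 : forall x y, X x -> X y -> forall t, 0 <= t <= 1 ->
    Omega (x + w + t *: (y - x)) /\ B (x + w + t *: (y - x)).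
  move=> x y Xx Xy t t01.
  have [_ ?] := hw x y (XOm _ Xx) (XOm _ Xy) (Xr _ Xx) (Xr _ Xy) t t01.
  split=> //; split=> //; rewrite addrAC; apply: far => //.
  by apply: cube_convex => //; exact: Xr.
have {osc osc1 osc2} osc := osc osc1 osc2.
set I := (\int[mu]_(x in B) (g x)%:E)%E in osc *.
have I0 : (0 <= I)%E by apply: integral_ge0 => x _; rewrite lee_fin.
pose F (p : 'rV[R]_n * 'rV[R]_n) := ((f p.1 - f p.2) ^+ 2)%:E.
have mF : measurable_fun setT F.
  apply/measurable_EFinP; apply: measurable_funX; apply: measurable_funB.
    by apply: (measurableT_comp mf); exact: measurable_fst.
  by apply: (measurableT_comp mf); exact: measurable_snd.
have F0 p : (0 <= F p)%E by rewrite lee_fin sqr_ge0.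
have [|||||y Xy yosc] := @exists_le_mean _ _ R mu X
    (fun x => \int[mu]_(y in X) F (x, y))%E.
- exact: mX.
- by apply: lt_le_trans mX'; rewrite lte_fin.
- exact: le_lt_trans muX (ltry _).
- by apply: measurable_funTS; exact: measurable_integral_in1.
- by move=> x _; exact: integral_ge0.
exists (f y).
have -> : (\int[mu]_(x in X) ((f x - f y) ^+ 2)%:E = \int[mu]_(x in X) F (y, x))%E.
  by apply: eq_integral => x _; rewrite /F/= -sqrrN opprB.
set J := (\int[mu]_(x in X) F (y, x))%E in yosc *.
have J0 : (0 <= J)%E by exact: integral_ge0.
have mJ : (m%:E * J <= (oscillation_cst M * r ^+ n.+2)%:E * I)%E.
  apply: (@le_trans _ _ (J * mu X)%E); first by rewrite muleC lee_wpmul2l.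
  apply: le_trans yosc _; apply: le_trans osc _.
  apply: lee_wpmul2r => //; rewrite lee_fin /oscillation_cst !exprMn.
  have w2 : dot w w <= n%:R * (M * r) ^+ 2.
    apply: le_trans (dot_le_norm w) _; apply: ler_wpM2l => //.
    by rewrite lerXn2r// nnegrE// mulr_ge0// ltW.
  have rn : 0 <= 6 * (2 ^+ n * r ^+ n) by rewrite !mulr_ge0 ?exprn_ge0// ltW.
  have := ler_wpM2l rn w2; rewrite !exprS exprMn; lra.
have -> : J = ((m^-1)%:E * (m%:E * J))%E.
  by rewrite muleA -EFinM mulVf ?gt_eqF// mul1e.
rewrite [_ / m]mulrC [in leRHS]EFinM -muleA; apply: lee_wpmul2l => //.
by rewrite lee_fin invr_ge0 ltW.
Qed.

Lemma open_measure_gt0 (U : set 'rV[R]_n) : open U -> U !=set0 ->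
  exists2 m, 0 < m & (m%:E <= mu U)%E.
Proof.
move=> oU [x Ux]; have /nbhs_ballP[s /= s0 sU] : nbhs x U by exact: open_nbhs_nbhs.
have s20 : 0 <= s / 2 by rewrite divr_ge0// ltW.
exists ((2 * (s / 2)) ^+ n); first by rewrite exprn_gt0// mulr_gt0// divr_gt0.
rewrite -(lebesgue_cube x s20) le_measure ?inE//.
- exact: measurable_cube.
- exact: open_measurable_rV.
move=> y; rewrite /cube/= => xy; apply: sU; rewrite -ball_normE/= distrC.
by rewrite (le_lt_trans xy)//; lra.
Qed.

Definition poincare_set (A : set 'rV[R]_n) := [/\ open A, A `<=` Omega &
  exists2 C, 0 <= C & forall f g, upper_gradient Omega f g ->
  exists c, (\int[mu]_(x in A) ((f x - c) ^+ 2)%:E <=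
    C%:E * \int[mu]_(x in Omega) (g x)%:E)%E].

(** On the overlap, of measure at least [m], [f] is close to both constants, so their difference is
    controlled by the gradient. Hence the constant of [A] can also be used on [B], at a cost
    proportional to the measure of [B], bounded by [b]. *)
Lemma poincare_setU A B : poincare_set A -> poincare_set B -> A `&` B !=set0 ->
  poincare_set (A `|` B).
Proof.
move=> [oA AO [CA CA0 hA]] [oB BO [CB CB0 hB]] AB.
split; [exact: openU|by rewrite subUset|].
have mA := open_measurable_rV oA; have mB := open_measurable_rV oB.
have [m m0 mW] := open_measure_gt0 (openI oA oB) AB.
have [D D0 OD] := bounded_ex.
pose b := (2 * D) ^+ n.
have b0 : 0 <= b by rewrite exprn_ge0// mulr_ge0// ltW.
have muB : (mu B <= b%:E)%E.
  rewrite -(lebesgue_cube 0 (ltW D0)) le_measure ?inE//.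
    by apply: measurable_cube; exact: ltW.
  by apply: subset_trans OD.
have bm0 : 0 <= b / m by rewrite divr_ge0// ltW.
exists (CA + 2 * CB + 4 * (b / m) * (CA + CB)).
  nonneg.
move=> f g ugfg; have [mf mg g0 _] := ugfg.
have [cA hcA] := hA _ _ ugfg; have [cB hcB] := hB _ _ ugfg.
exists cA; set I := (\int[mu]_(x in Omega) (g x)%:E)%E in hcA hcB *.
have I0 : (0 <= I)%E by apply: integral_ge0 => x _; rewrite lee_fin.
have msq c : measurable_fun setT (fun x => ((f x - c) ^+ 2)%:E).
  by apply/measurable_EFinP; apply: measurable_funX; exact: measurable_funB.
have sq0 c x : (0 <= ((f x - c) ^+ 2)%:E)%E by rewrite lee_fin sqr_ge0.
have split_sq (E : set 'rV[R]_n) c c' : measurable E ->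
    (\int[mu]_(x in E) (((f x - c) ^+ 2)%:E + ((f x - c') ^+ 2)%:E) =
     \int[mu]_(x in E) ((f x - c) ^+ 2)%:E +
     \int[mu]_(x in E) ((f x - c') ^+ 2)%:E)%E.
  by move=> mE; rewrite ge0_integralD//; exact: measurable_funTS.
have hq : (m%:E * ((cA - cB) ^+ 2)%:E <= (2 * (CA + CB))%:E * I)%E.
  have mAB : measurable (A `&` B) by exact: measurableI.
  apply: (@le_trans _ _ (\int[mu]_(x in A `&` B) cst ((cA - cB) ^+ 2)%:E x)%E).
    by rewrite integral_cst// muleC lee_wpmul2l// lee_fin sqr_ge0.
  apply: (@le_trans _ _ (\int[mu]_(x in A `&` B)
      (2%:E * (((f x - cA) ^+ 2)%:E + ((f x - cB) ^+ 2)%:E)))%E).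
    apply: ge0_le_integral => //.
    - by move=> x _; rewrite lee_fin sqr_ge0.
    - by apply: measurable_funTS; apply: measurable_funeM; exact: emeasurable_funD.
    - move=> x _; rewrite -EFinD -EFinM lee_fin.
      by have := sqr_ge0 ((f x - cA) + (f x - cB)); nra.
  rewrite ge0_integralZl//; last 2 first.
  - by apply: measurable_funTS; exact: emeasurable_funD.
  - by move=> x _; rewrite adde_ge0.
  rewrite EFinM -muleA; apply: lee_wpmul2l => //.
  rewrite split_sq// EFinD ge0_muleDl ?lee_fin//; apply: leeD.
    apply: le_trans hcA; apply: ge0_subset_integral => //.
    exact: measurable_funTS.
  apply: le_trans hcB; apply: ge0_subset_integral => //.
  exact: measurable_funTS.
have hq' : (b%:E * ((cA - cB) ^+ 2)%:E <= (b / m * (2 * (CA + CB)))%:E * I)%E.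
  have bm : (0%:E <= (b / m)%:E)%E by rewrite lee_fin.
  have := lee_wpmul2l bm hq; rewrite !muleA -!EFinM.
  by rewrite [b / m * m]divfK// gt_eqF.
have hB' : (\int[mu]_(x in B) ((f x - cA) ^+ 2)%:E <=
    (2 * CB + b / m * (4 * (CA + CB)))%:E * I)%E.
  apply: (@le_trans _ _ (\int[mu]_(x in B)
      (2%:E * (((f x - cB) ^+ 2)%:E + cst ((cA - cB) ^+ 2)%:E x)))%E).
    apply: ge0_le_integral => //.
    - exact: measurable_funTS.
    - by apply: measurable_funTS; apply: measurable_funeM; exact: emeasurable_funD.
    - move=> x _; rewrite -EFinD -EFinM lee_fin.
      by have := sqr_ge0 ((f x - cB) + (cA - cB)); nra.
  rewrite ge0_integralZl//; last 2 first.
  - by apply: measurable_funTS; exact: emeasurable_funD.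
  - by move=> x _; rewrite adde_ge0// lee_fin sqr_ge0.
  rewrite ge0_integralD//; last 2 first.
  - exact: measurable_funTS.
  - by move=> x _; rewrite lee_fin sqr_ge0.
  rewrite integral_cst//.
  apply: (@le_trans _ _ (2%:E * (CB%:E * I + (b / m * (2 * (CA + CB)))%:E * I))%E).
    apply: lee_wpmul2l => //; apply: leeD => //.
    apply: le_trans hq'; rewrite muleC; apply: lee_wpmul2r => //.
    by rewrite lee_fin sqr_ge0.
  have bm : 0 <= b / m * (2 * (CA + CB)) by rewrite mulr_ge0// mulr_ge0// addr_ge0.
  rewrite -ge0_muleDl ?lee_fin// -EFinD muleA -EFinM.
  by rewrite le_eqVlt; apply/orP; left; apply/eqP; congr (_%:E * _)%E; ring.
apply: le_trans (ge0_integral_setU_le mu mA mB (msq cA) (sq0 cA)) _.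
apply: le_trans (leeD hcA hB') _.
rewrite -ge0_muleDl ?lee_fin//; last first.
  by apply: addr_ge0; apply: mulr_ge0 => //; nonneg.
by rewrite -EFinD le_eqVlt; apply/orP; left; apply/eqP; congr (_%:E * _)%E; ring.
Qed.

Lemma poincare_set_ball M z r : 0 < M -> 0 < r -> inward_at M z r ->
  Omega `&` ball z r !=set0 -> poincare_set (Omega `&` ball z r).
Proof.
move=> M0 r0 iM ne; have oX : open (Omega `&` ball z r).
  by apply: openI => //; exact: ball_open.
have [m m0 mX] := open_measure_gt0 oX ne.
split=> //.
exists (oscillation_cst M * r ^+ n.+2 / m) => [|f g ugfg].
  have ? := oscillation_cst_ge0 M; nonneg.
have [||c hc] := @poincare_cube M z r _ m f g (ltW M0) r0 iM _ _ m0 mX ugfg.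
- exact: open_measurable_rV.
- by move=> x [Ox]; rewrite -ball_normE/= => /ltW xr; split=> //; rewrite /cube/= distrC.
have [mf mg g0 _] := ugfg; exists c; apply: le_trans hc _.
apply: lee_wpmul2l.
  have ? := oscillation_cst_ge0 M; rewrite lee_fin; nonneg.
apply: ge0_subset_integral => //.
- apply: measurableI; first exact: measurable_Omega.
  by apply: measurable_cube; rewrite mulr_ge0 ?addr_ge0// ltW.
- exact: measurable_Omega.
- by apply: measurable_funTS; exact/measurable_EFinP.
- by move=> x _; rewrite lee_fin.
Qed.

(** Connectedness shows that each point of Omega lies in a Poincaré set containing [x0], but with no
    common constant. Compactness then leaves finitely many balls to be joined, and these unions keep
    overlapping because all contain [x0]. *)
Lemma poincare_set_Omega : connected Omega -> Omega !=set0 -> poincare_set Omega.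
Proof.
move=> cO [x0 Ox0]; have [M M0 hM] := uniform_inward_translation.
pose r := M^-1; have r0 : 0 < r by rewrite invr_gt0.
have Mr : M * r <= 1 by rewrite divff// gt_eqF.
have pball z : Omega `&` ball z r !=set0 -> poincare_set (Omega `&` ball z r).
  by apply: (@poincare_set_ball M) => //; exact: hM.
pose U := \bigcup_(A in [set A | poincare_set A /\ A x0]) A.
have UO : U `<=` Omega by move=> x [A [[_ AO _] _] /AO].
have oU : open U by apply: bigcup_open => A [[]].
(* The balls have a fixed radius, so a point adherent to [U] has its whole ball, within Omega, glued
   to a set of the family. This makes [U] closed in Omega, and it is used again to add the balls of
   the finite cover. *)
have ext x : Omega x -> closure U x -> exists A, [/\ poincare_set A, A x0 &
    Omega `&` ball x r `<=` A].
  move=> Ox /(_ (ball x r)) [|y [[A [pA Ax0] Ay] xy]]; first exact: nbhsx_ballx.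
  exists (A `|` (Omega `&` ball x r)); split; [|by left|by right].
  have [oA AO _] := pA.
  apply: poincare_setU => //; last by exists y; split=> //; split=> //; exact: AO.
  by apply: pball; exists x; split=> //; exact: ballxx.
have UOmega : U = Omega.
  apply: cO.
  - exists x0, (Omega `&` ball x0 r); last by split=> //; exact: ballxx.
    by split; [apply: pball; exists x0; split=> //; exact: ballxx|split=> //; exact: ballxx].
  - by exists U => //; rewrite setIidr.
  - exists (closure U); first exact: closed_closure.
    apply/seteqP; split=> [x Ux|x [Ox clUx]].
      by split; [exact: UO|exact: subset_closure].
    have [A [pA Ax0 hA]] := ext _ Ox clUx.
    by exists A => //; apply: hA; split=> //; exact: ballxx.
have := compact_closure_Omega; rewrite compact_cover => /(_ _ Omega (fun x => ball x r)).
case=> [x _|x clx|D DO cD]; first exact: ball_open.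
  have [y [Oy xy]] := clx _ (nbhsx_ballx x r r0).
  by exists y => //; exact: ball_sym.
have fin (s : seq 'rV[R]_n) : (forall x, x \in s -> Omega x) ->
    exists2 A, poincare_set A /\ A x0 &
    forall x, x \in s -> Omega `&` ball x r `<=` A.
  elim: s => [|x s ih] sD.
    exists (Omega `&` ball x0 r) => //.
    by split; [apply: pball; exists x0; split=> //; exact: ballxx|split=> //; exact: ballxx].
  have [|A [pA Ax0] hA] := ih; first by move=> y ys; apply: sD; rewrite inE ys orbT.
  have Ox : Omega x by apply: sD; rewrite mem_head.
  have [|B [pB Bx0 hB]] := ext _ Ox; first by apply: subset_closure; rewrite UOmega.
  exists (A `|` B); first by split; [apply: poincare_setU => //; exists x0|left].
  by move=> y; rewrite inE => /orP[/eqP -> z /hB|/hA yA z /yA]; [right|left].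
have [|A [pA Ax0] hA] := fin (finmap.enum_fset D).
  by move=> x xD; have := DO x xD; rewrite inE.
suff <- : A = Omega by [].
have [_ AO _] := pA; apply/seteqP; split=> // x Ox.
have [y yD xy] := cD x (@subset_closure _ _ _ Ox).
exact: hA yD _ _.
Qed.

(** The cube around [z'] bounds the measure of the local set from below by a multiple of [h ^+ n];
    the powers of [h] in [poincare_cube] then reduce to [h ^+ 2]. *)
Lemma poincare_scaled (K kap h0 : R) : connected Omega -> Omega !=set0 ->
  0 < K -> 0 < kap -> exists C K', [/\ 0 <= C, 0 <= K' &
  forall h, 0 < h <= h0 -> forall z z',
    cube z' (kap * h) `<=` Omega `&` cube z (K * h) ->
  forall f g, upper_gradient Omega f g ->
  exists c, (\int[mu]_(x in Omega `&` cube z (K * h)) ((f x - c) ^+ 2)%:E <=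
    (C * h ^+ 2)%:E *
    \int[mu]_(x in Omega `&` cube z (K' * h)) (g x)%:E)%E].
Proof.
move=> cO O0 K0 kap0; have [M M0 hM] := uniform_inward_translation.
have [_ _ [CO CO0 hO]] := poincare_set_Omega cO O0.
have [D D0 OD] := bounded_ex.
(* Up to this [h] the condition [M * (K * h) <= 1] for inward translation holds. *)
pose h1 := (M * K)^-1.
have h10 : 0 < h1 by rewrite invr_gt0 mulr_gt0.
pose C1 := oscillation_cst M * K ^+ n.+2 / (2 * kap) ^+ n.
pose C2 := CO / h1 ^+ 2.
(* The first term is the enlargement in [poincare_cube]. The others serve [h > h1], where any two
   points of Omega are at distance at most [2 * D <= 2 * D / h1 * h]. *)
pose K' := (1 + M) * K + (2 * D / h1 + K).
have C10 : 0 <= C1.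
  rewrite /C1; have ? := oscillation_cst_ge0 M; nonneg.
have C20 : 0 <= C2 by rewrite /C2; nonneg.
have K'0 : 0 <= K' by rewrite /K'; nonneg.
exists (C1 + C2), K'; split=> [||h /andP[hgt0 hh0] z z' kapO f g ugfg] //.
  exact: addr_ge0.
have [mf mg g0 _] := ugfg.
have Kh0 : 0 < K * h by rewrite mulr_gt0.
have mcap r : 0 <= r -> measurable (Omega `&` cube z r).
  by move=> r0; apply: measurableI; [exact: measurable_Omega|exact: measurable_cube].
have mX := mcap _ (ltW Kh0).
have mB : measurable (Omega `&` cube z (K' * h)) by apply: mcap; rewrite mulr_ge0// ltW.
have mgE E : measurable_fun E (EFin \o g).
  by apply: measurable_funTS; exact/measurable_EFinP.
have I0 : (0 <= \int[mu]_(x in Omega `&` cube z (K' * h)) (g x)%:E)%E.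
  by apply: integral_ge0 => x _; rewrite lee_fin.
(* For [h > h1] the cube of half-width [K' * h] contains Omega, and the global
   inequality is used. *)
have [hle|hlt] := leP h h1.
  have MKh : M * (K * h) <= 1.
    by move: hle; rewrite /h1 -[(M * K)^-1]div1r ler_pdivlMr ?mulr_gt0// mulrC mulrA.
  have m0 : 0 < (2 * (kap * h)) ^+ n by rewrite exprn_gt0// !mulr_gt0.
  have mX' : (((2 * (kap * h)) ^+ n)%:E <= mu (Omega `&` cube z (K * h)))%E.
    have kh0 : 0 <= kap * h by rewrite mulr_ge0// ltW.
    by rewrite -(lebesgue_cube z' kh0) le_measure ?inE//; exact: measurable_cube.
  have [c hc] := @poincare_cube M z _ _ _ f g (ltW M0) Kh0 (hM _ _ Kh0 MKh) mX
    (fun x Xx => Xx) m0 mX' ugfg.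
  exists c; apply: le_trans hc _; apply: lee_pmul.
  - have ? := oscillation_cst_ge0 M; rewrite lee_fin; nonneg.
  - by apply: integral_ge0 => x _; rewrite lee_fin.
  - rewrite lee_fin [leRHS]mulrDl.
    have -> : oscillation_cst M * (K * h) ^+ n.+2 / (2 * (kap * h)) ^+ n = C1 * h ^+ 2.
      rewrite /C1 !exprMn -[n.+2]addn2 exprD !invfM.
      have hn : h ^+ n != 0 by rewrite expf_neq0// gt_eqF.
      rewrite [h ^+ (n + 2)]exprD; move: hn.
      move: (oscillation_cst M) (2 ^- n) (kap ^- n) (h ^+ n) (K ^+ n).
      by move=> oc a2 ak hn Kn hn0; field.
    by rewrite lerDl mulr_ge0// sqr_ge0.
  - apply: ge0_subset_integral => //.
    + by apply: mcap; rewrite mulr_ge0 ?addr_ge0// ltW.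
    + by move=> x _; rewrite lee_fin.
    + apply: setIS => x; rewrite /cube/= => /le_trans; apply.
      rewrite mulrA ler_pM2r// /K' lerDl; nonneg.
have [c hc] := hO _ _ ugfg; exists c.
apply: (@le_trans _ _ (\int[mu]_(x in Omega) ((f x - c) ^+ 2)%:E)%E).
  apply: ge0_subset_integral => //; first exact: measurable_Omega.
  - apply: measurable_funTS; apply/measurable_EFinP.
    by apply: measurable_funX; exact: measurable_funB.
  - by move=> x _; rewrite lee_fin sqr_ge0.
have kz' : cube z' (kap * h) z' by rewrite /cube/= subrr normr0 mulr_ge0// ltW.
have [Oz' zz'] := kapO _ kz'.
have -> : Omega `&` cube z (K' * h) = Omega.
  apply/seteqP; split=> x; first by case.
  move=> Ox; split=> //; rewrite /cube/=.
  have := OD _ Ox; have := OD _ Oz'; rewrite /cube/= !subr0 => z'D xD.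
  have : `|x - z'| <= 2 * D.
    by rewrite (le_trans (ler_normB _ _))// mulr2n mulrDl mul1r lerD.
  have : 2 * D <= 2 * D / h1 * h.
    by rewrite -mulrA ler_peMr// ?mulr_ge0 ?ltW// mulrC ltr_pdivlMr// mul1r.
  have := ler_distD z' x z; move: zz'; rewrite /cube/= => zz'.
  have : 0 <= (1 + M) * K * h by rewrite !mulr_ge0 ?addr_ge0// ltW.
  rewrite /K' !mulrDl; lra.
apply: le_trans hc _; apply: lee_wpmul2r.
  by apply: integral_ge0 => x _; rewrite lee_fin.
rewrite lee_fin mulrDl; apply: (@le_trans _ _ (C2 * h ^+ 2)); last first.
  by rewrite lerDr mulr_ge0// sqr_ge0.
rewrite /C2 -mulrA ler_peMr// mulrC ler_pdivlMr ?exprn_gt0// mul1r.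
by rewrite lerXn2r ?nnegrE// ltW.
Qed.

End inward_translation.

(** * Piecewise affine functions *)

Section affine_functions.
Variables (R : realType) (d : nat).
Local Notation P1 := (R^o * 'rV[R]_d)%type.
Implicit Types (p q : P1) (x y u : 'rV[R]_d).

Lemma dotDl x y u : dot (x + y) u = dot x u + dot y u.
Proof. by rewrite -big_split; apply: eq_bigr => i _; rewrite !mxE mulrDl. Qed.

Lemma dotZl (a : R) x y : dot (a *: x) y = a * dot x y.
Proof. by rewrite [RHS]mulr_sumr; apply: eq_bigr => i _; rewrite !mxE mulrA. Qed.

Lemma dotC x y : dot x y = dot y x.
Proof. by apply: eq_bigr => i _; rewrite mulrC. Qed.

Lemma dotDr x y u : dot u (x + y) = dot u x + dot u y.
Proof. by rewrite !(dotC u) dotDl. Qed.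

Lemma dotZr (a : R) x y : dot x (a *: y) = a * dot x y.
Proof. by rewrite dotC dotZl dotC. Qed.

Lemma dotNr x y : dot x (- y) = - dot x y.
Proof. by rewrite -(scaleN1r y) dotZr mulN1r. Qed.

Lemma dot0l x : dot 0 x = 0.
Proof. by rewrite -(scale0r 0) dotZl mul0r. Qed.

Lemma dot0r x : dot x 0 = 0.
Proof. by rewrite dotC dot0l. Qed.

Lemma dot_sumr I (s : seq I) (P : pred I) (F : I -> 'rV[R]_d) u :
  dot u (\sum_(i <- s | P i) F i) = \sum_(i <- s | P i) dot u (F i).
Proof. by apply: (big_morph (dot u)) => [x y|]; rewrite ?dotDr ?dot0r. Qed.

Lemma dot_delta x i : dot x (delta_mx ord0 i) = x ord0 i.
Proof.
rewrite /dot (bigD1 i)//= mxE !eqxx mulr1 big1 ?addr0// => j ji.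
by rewrite mxE (negbTE ji) andbF mulr0.
Qed.

Lemma norm_dot_le x y : `|dot x y| <= d%:R * `|x| * `|y|.
Proof.
rewrite (le_trans (ler_norm_sum _ _ _))//.
apply: le_trans (_ : \sum_(i < d) `|x| * `|y| <= _).
  by apply: ler_sum => i _; rewrite normrM ler_pM// rV_coord_le.
by rewrite sumr_const card_ord mulr_natl mulrnAl.
Qed.

(** Lagrange's identity: the double sum is twice the difference of the two sides. *)
Lemma cauchy_schwarz_sum (I : finType) (m a b : I -> R) : (forall i, 0 <= m i) ->
  (\sum_i m i * (a i * b i)) ^+ 2 <=
  (\sum_i m i * a i ^+ 2) * (\sum_i m i * b i ^+ 2).
Proof.
move=> m0; have : 0 <= \sum_i \sum_j m i * m j * (a i * b j - a j * b i) ^+ 2.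
  by apply: sumr_ge0 => i _; apply: sumr_ge0 => j _; nonneg.
set A := \sum_i m i * a i ^+ 2; set B := \sum_i m i * b i ^+ 2.
set C := \sum_i m i * (a i * b i).
have -> : \sum_i \sum_j m i * m j * (a i * b j - a j * b i) ^+ 2 =
    A * B + B * A - 2 * (C * C).
  rewrite 3!big_distrlr/= mulr_sumr -big_split -sumrB/=.
  apply: eq_bigr => i _; rewrite mulr_sumr -big_split -sumrB/=.
  by apply: eq_bigr => j _; ring.
by rewrite expr2; lra.
Qed.

Lemma cauchy_schwarz_dot x y : dot x y ^+ 2 <= dot x x * dot y y.
Proof.
have := @cauchy_schwarz_sum 'I_d (fun=> 1) (x ord0) (y ord0) (fun=> ler01).
have e (u v : 'rV[R]_d) : \sum_i 1 * (u ord0 i * v ord0 i) = dot u v.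
  by apply: eq_bigr => i _; rewrite mul1r.
by rewrite e; under eq_bigr do rewrite expr2; under [X in _ <= _ * X]eq_bigr do rewrite expr2; rewrite !e.
Qed.

Lemma p1_evalD p q x : p1_eval (p + q) x = p1_eval p x + p1_eval q x.
Proof. by rewrite /p1_eval dotDl/=; ring. Qed.

Lemma p1_evalZ (a : R) p x : p1_eval (a *: p) x = a * p1_eval p x.
Proof. by rewrite /p1_eval dotZl/= mulrDr. Qed.

Lemma p1_eval0 x : p1_eval (0 : P1) x = 0.
Proof. by rewrite /p1_eval dot0l addr0. Qed.

Lemma p1_eval_sum I (s : seq I) (P : pred I) (F : I -> P1) x :
  p1_eval (\sum_(i <- s | P i) F i) x = \sum_(i <- s | P i) p1_eval (F i) x.
Proof. by apply: (big_morph (fun p => p1_eval p x)) => [p q|]; rewrite ?p1_evalD ?p1_eval0. Qed.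

Lemma p1_eval_line p x u (t : R) : p1_eval p (x + t *: u) = p1_eval p x + t * dot p.2 u.
Proof. by rewrite /p1_eval dotDr dotZr addrA. Qed.

Lemma p1_evalB p x y : p1_eval p x - p1_eval p y = dot p.2 (x - y).
Proof. by rewrite /p1_eval dotDr -(scaleN1r y) dotZr; ring. Qed.

Lemma p1_eval_convex I (s : seq I) (P : pred I) (a : I -> R) (F : I -> 'rV[R]_d) p :
  \sum_(i <- s | P i) a i = 1 ->
  p1_eval p (\sum_(i <- s | P i) a i *: F i) = \sum_(i <- s | P i) a i * p1_eval p (F i).
Proof.
move=> a1; rewrite /p1_eval -{1}[p.1]mul1r -a1 mulr_suml dot_sumr -big_split/=.
by apply: eq_bigr => i _; rewrite dotZr mulrDr.
Qed.

Lemma measurable_p1_eval p : measurable_fun setT (fun x : 'rV[R]_d => p1_eval p x).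
Proof.
apply: measurable_funD => //; apply: measurable_sum => i.
by apply: measurable_funM => //; exact: measurable_coor.
Qed.

End affine_functions.

(** * Barycentric coordinates and continuous piecewise affine functions *)

Section hat_functions.
Variables (R : realType) (d : nat) (m : mesh R d) (U : set 'rV[R]_d).
Hypothesis tri : triangulation m U.
Local Notation cell := {set 'I_(nvert m)}.
Local Notation P1 := (R^o * 'rV[R]_d)%type.
Implicit Types (T : cell) (K : {set cell}) (p : P1) (x : 'rV[R]_d).
Implicit Types (y : 'I_(nvert m)).

(** Row [i] is 1 followed by the coordinates of vertex [i], so multiplying by the coefficients of an
    affine function evaluates it at the vertices. Affine independence makes the rows free, which
    gives interpolation; since there are [d + 1] of them the rank is full, which gives
    uniqueness. *)
Let vertex_matrix T : 'M[R]_(#|T|, d.+1) := \matrix_(i < #|T|, j < d.+1)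
  (if unlift ord0 j is Some k then vert (enum_val i) ord0 k else 1).

Let affine_of (X : 'cV[R]_d.+1) : P1 :=
  (X ord0 ord0, \row_k X (lift ord0 k) ord0).

Let vertex_matrixE T X (i : 'I_#|T|) :
  (vertex_matrix T *m X) i ord0 = p1_eval (affine_of X) (vert (enum_val i)).
Proof.
rewrite mxE big_ord_recl mxE unlift_none mul1r /p1_eval/=; congr (_ + _).
by apply: eq_bigr => k _; rewrite !mxE liftK mulrC.
Qed.

Let vertex_matrix_free T : T \in cells m -> row_free (vertex_matrix T).
Proof.
move=> Tm; have [_ /(_ T Tm)[cT affT] _ _] := tri.
apply: inj_row_free => v vA; apply/rowP => i; rewrite [RHS]mxE.
have iT : enum_val i \in T by exact: enum_valP.
pose a y := v ord0 (enum_rank_in iT y).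
have aE j : a (enum_val j) = v ord0 j by rewrite /a enum_valK_in.
rewrite -aE; apply: affT => //.
  rewrite big_enum_val/=; under eq_bigr do rewrite aE.
  move/rowP/(_ ord0): vA; rewrite !mxE => vA0; rewrite -[RHS]vA0.
  by apply: eq_bigr => j _; rewrite mxE unlift_none mulr1.
rewrite big_enum_val/=; apply/rowP => k; rewrite summxE [RHS]mxE.
move/rowP/(_ (lift ord0 k)): vA; rewrite !mxE => vA0; rewrite -[RHS]vA0.
by apply: eq_bigr => j _; rewrite !mxE liftK aE.
Qed.

Lemma affine_interpolation T (c : 'I_(nvert m) -> R) : T \in cells m ->
  exists p : P1, forall y, y \in T -> p1_eval p (vert y) = c y.
Proof.
move=> Tm; have fT := vertex_matrix_free Tm.
pose X := pinvmx (vertex_matrix T) *m \col_i c (enum_val i).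
exists (affine_of X) => y yT.
rewrite -[y](enum_rankK_in yT yT) -vertex_matrixE /X mulmxA mulmxVp// mul1mx mxE.
by [].
Qed.

Lemma affine_eq0 T (p : P1) : T \in cells m ->
  (forall y, y \in T -> p1_eval p (vert y) = 0) -> p = 0.
Proof.
move=> Tm p0; have fT := vertex_matrix_free Tm.
have [_ /(_ T Tm)[cT _] _ _] := tri.
pose X : 'cV[R]_d.+1 := \col_j (if unlift ord0 j is Some k then p.2 ord0 k else p.1).
have pX : p = affine_of X.
  rewrite /affine_of mxE unlift_none [p in LHS]surjective_pairing; congr pair.
  by apply/rowP => k; rewrite !mxE liftK.
have AX : vertex_matrix T *m X = 0.
  apply/matrixP => i j; rewrite ord1 vertex_matrixE -pX [RHS]mxE.
  by apply: p0; exact: enum_valP.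
have full : row_full (vertex_matrix T).
  by rewrite /row_full (eqP fT) cT.
have X0 : X = 0 by rewrite -[X]mul1mx -(mulVpmx full) -mulmxA AX mulmx0.
rewrite pX X0 /affine_of mxE; congr pair.
by apply/rowP => k; rewrite !mxE.
Qed.

Lemma affine_eq T (p q : P1) : T \in cells m ->
  (forall y, y \in T -> p1_eval p (vert y) = p1_eval q (vert y)) -> p = q.
Proof.
move=> Tm pq; apply/eqP; rewrite -subr_eq0; apply/eqP; apply: (affine_eq0 Tm).
by move=> y yT; rewrite p1_evalD -scaleN1r p1_evalZ pq//; ring.
Qed.

(** The barycentric coordinate of [y] on [T], written as in [nodal_basis] so that the two agree by
    unfolding. For a cell [T] the default 0 of [xget] is chosen only if 0 itself satisfies the
    conditions, as it does for [y] outside [T]. *)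
Definition hat T y : P1 :=
  xget 0 [set p : P1 | forall z, z \in T -> p1_eval p (vert z) = (z == y)%:R].

Lemma hatP T y z : T \in cells m -> z \in T ->
  p1_eval (hat T y) (vert z) = (z == y)%:R.
Proof.
move=> Tm zT; have [p hp] := affine_interpolation (fun z => (z == y)%:R) Tm.
by rewrite /hat; case: xgetP => [q _|/(_ p)//]; exact.
Qed.

Lemma hat_notin T y : T \in cells m -> y \notin T -> hat T y = 0.
Proof.
move=> Tm yT; apply: (affine_eq0 Tm) => z zT; rewrite hatP//.
by case: eqVneq => // zy; rewrite zy (negbTE yT) in zT.
Qed.

Lemma hat_expansion T p : T \in cells m ->
  p = \sum_(y in T) p1_eval p (vert y) *: hat T y.
Proof.
move=> Tm; apply: (affine_eq Tm) => z zT; rewrite p1_eval_sum (bigD1 z)//=.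
rewrite p1_evalZ hatP// eqxx mulr1 big1 ?addr0// => y /andP[yT yz].
by rewrite p1_evalZ hatP// eq_sym (negbTE yz) mulr0.
Qed.

Lemma p1_eval_hat T p x : T \in cells m ->
  p1_eval p x = \sum_(y in T) p1_eval p (vert y) * p1_eval (hat T y) x.
Proof.
move=> Tm; rewrite {1}(hat_expansion p Tm) p1_eval_sum.
by apply: eq_bigr => y _; rewrite p1_evalZ.
Qed.

Lemma sum_hat T x : T \in cells m -> \sum_(y in T) p1_eval (hat T y) x = 1.
Proof.
move=> Tm; have := p1_eval_hat (1, 0) x Tm; rewrite {1}/p1_eval dot0l addr0/=.
move=> ->; apply: eq_bigr => y _.
by rewrite /p1_eval/= dot0l addr0 mul1r.
Qed.

Lemma hat_convex T (a : 'I_(nvert m) -> R) y : T \in cells m ->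
  \sum_(z in T) a z = 1 -> y \in T ->
  p1_eval (hat T y) (\sum_(z in T) a z *: vert z) = a y.
Proof.
move=> Tm a1 yT; rewrite p1_eval_convex// (bigD1 y)//= hatP// eqxx mulr1.
rewrite big1 ?addr0// => z /andP[zT zy].
by rewrite hatP// (negbTE zy) mulr0.
Qed.

Lemma simplexP T x : T \in cells m ->
  simplex T x <-> (forall y, y \in T -> 0 <= p1_eval (hat T y) x).
Proof.
move=> Tm; split=> [[a [a0 a1 ->]] y yT|h]; first by rewrite hat_convex.
(* [simplex] asks for nonnegative weights at all vertices of the mesh, also outside [T]. *)
exists (fun y => if y \in T then p1_eval (hat T y) x else 0); split.
- by move=> y; case: ifP => // /h.
- by rewrite -[RHS](sum_hat x Tm); apply: eq_bigr => y ->.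
apply/rowP => k; rewrite summxE.
have := p1_eval_hat (0, delta_mx ord0 k) x Tm.
rewrite {1}/p1_eval/= add0r dotC dot_delta => ->.
apply: eq_bigr => y yT; rewrite yT mxE /p1_eval/= add0r (dotC _ (vert y)) dot_delta.
by rewrite mulrC.
Qed.

Lemma hat_le1 T x y : T \in cells m -> simplex T x -> p1_eval (hat T y) x <= 1.
Proof.
move=> Tm xT; have [yT|yT] := boolP (y \in T); last by rewrite hat_notin// p1_eval0.
rewrite -(sum_hat x Tm) (bigD1 y)//= lerDl; apply: sumr_ge0 => z /andP[zT _].
by move/(simplexP x Tm): xT; apply.
Qed.

Lemma hat_ge0 T x y : T \in cells m -> simplex T x -> 0 <= p1_eval (hat T y) x.
Proof.
move=> Tm xT; have [yT|yT] := boolP (y \in T); last by rewrite hat_notin// p1_eval0.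
by move/(simplexP x Tm): xT; apply.
Qed.

Lemma simplex_vert T y : y \in T -> simplex T (vert y).
Proof.
move=> yT; exists (fun z => (z == y)%:R); split=> [z||].
- by rewrite ler0n.
- by rewrite (bigD1 y)//= eqxx big1 ?addr0// => z /andP[_ /negbTE ->].
- rewrite (bigD1 y)//= eqxx scale1r big1 ?addr0// => z /andP[_ /negbTE ->].
  by rewrite scale0r.
Qed.

Lemma simplex_capP T T' x : T \in cells m -> T' \in cells m ->
  simplex T x -> simplex T' x -> simplex (T :&: T') x.
Proof.
move=> Tm Tm' xT xT'; have [_ _ cap _] := tri.
by rewrite -(cap _ _ Tm Tm').
Qed.

Lemma hat_cap0 T T' x y : T \in cells m -> simplex (T :&: T') x -> y \in T ->
  y \notin T' -> p1_eval (hat T y) x = 0.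
Proof.
move=> Tm [a [a0 a1 ->]] yT yT'; rewrite p1_eval_convex// big1// => z.
rewrite inE => /andP[zT zT']; rewrite hatP//; case: eqVneq => [zy|]; last by rewrite mulr0.
by rewrite zy (negbTE yT') in zT'.
Qed.

Definition vertex_consistent K (w : dpw m) := forall T T' y, T \in K -> T' \in K ->
  y \in T -> y \in T' -> p1_eval (w T) (vert y) = p1_eval (w T') (vert y).

(** Under this condition the value of [pw_val] does not depend on the cell that [cell_at] picks. *)
Definition consistent K (w : dpw m) := forall T T' x, T \in K -> T' \in K ->
  simplex T x -> simplex T' x -> p1_eval (w T) x = p1_eval (w T') x.

(** Two cells meet in the simplex of their common vertices, on which an affine function is
    determined by its values at these. *)
Lemma vertex_consistentW K w : K \subset cells m ->
  vertex_consistent K w -> consistent K w.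
Proof.
move=> Km cw T T' x TK TK' xT xT'.
have [a [_ a1 ->]] := simplex_capP (fintype.subsetP Km _ TK) (fintype.subsetP Km _ TK') xT xT'.
rewrite !p1_eval_convex//; apply: eq_bigr => y; rewrite inE => /andP[yT yT'].
by rewrite (cw T T').
Qed.

Lemma cell_atP K x : region K x ->
  exists T, [/\ T \in K, simplex T x & cell_at K x = Some T].
Proof.
rewrite /cell_at => -[T TK xT]; case: pickP => [T' /andP[TK' /asboolP xT']|/(_ T)].
  by exists T'.
by move: TK => /= ->; rewrite /= asboolT.
Qed.

Lemma pw_valE K w T x : consistent K w -> T \in K -> simplex T x ->
  pw_val K w x = p1_eval (w T) x.
Proof.
move=> cw TK xT; have [|T' [TK' xT' e]] := @cell_atP K x; first by exists T.
by rewrite /pw_val e; exact: cw.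
Qed.

Lemma measurable_simplex T : T \in cells m -> measurable (simplex T).
Proof.
move=> Tm; rewrite (_ : simplex T = \bigcap_(y in [set` T])
    ((fun x : 'rV[R]_d => p1_eval (hat T y) x) @^-1` [set r | 0 <= r])).
  apply: fin_bigcap_measurable => // y _; rewrite -[X in measurable X]setTI.
  apply: measurable_p1_eval => //.
  rewrite (_ : mkset _ = `[0, +oo[%classic) //.
  by apply/seteqP; split=> r; rewrite /= in_itv/= andbT.
apply/seteqP; split=> x; first by move=> /(simplexP x Tm) h y /= yT; exact: h.
by move=> h; apply/(simplexP x Tm) => y yT; exact: h.
Qed.

Lemma barycentric_path T y : T \in cells m -> y \in T -> exists v, forall t : R,
  0 < t <= 1 -> forall z, z \in T -> 0 < p1_eval (hat T z) (vert y + t *: v).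
Proof.
move=> Tm yT; have [_ /(_ T Tm)[cT _] _ _] := tri.
pose b := \sum_(z in T) (d.+1%:R^-1 : R) *: @vert _ _ m z.
have b1 : \sum_(z in T) (d.+1%:R^-1 : R) = 1.
  by rewrite sumr_const cT -[LHS]mulr_natl divff// pnatr_eq0.
exists (b - vert y) => t /andP[t0 t1] z zT.
rewrite p1_eval_line -p1_evalB hat_convex// hatP//.
have d0 : 0 < d.+1%:R^-1 :> R by rewrite invr_gt0.
by move: (d.+1%:R^-1) d0 => q d0; case: (y == z) => /=; nra.
Qed.

(** At a vertex [cell_at] may pick another cell than [T]. Along a path into the interior of [T],
    however, [T] is the only cell, and continuity allows passing to the limit at the vertex. *)
Lemma continuous_vertex_value K w T y : K \subset cells m ->
  {within region K, continuous (pw_val K w)} -> T \in K -> y \in T ->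
  pw_val K w (vert y) = p1_eval (w T) (vert y).
Proof.
move=> Km cw TK yT; have Tm := fintype.subsetP Km _ TK.
have [v hv] := barycentric_path Tm yT.
have xT t : 0 < t <= 1 -> simplex T (vert y + t *: v).
  by move=> t01; apply/(simplexP _ Tm) => z zT; exact/ltW/hv.
have val t : 0 < t <= 1 -> pw_val K w (vert y + t *: v) =
    p1_eval (w T) (vert y + t *: v).
  move=> t01; have [|T' [TK' xT' e]] := @cell_atP K (vert y + t *: v).
    by exists T => //; exact: xT.
  have Tm' := fintype.subsetP Km _ TK'.
  (* All barycentric coordinates of [T] are positive at this point, while that of a vertex missing
     from [T'] would vanish on the common face. *)
  have TT' : T \subset T'.
    apply/fintype.subsetP => z zT; apply: contraT => zT'.
    have xTT' := simplex_capP Tm Tm' (xT _ t01) xT'.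
    by have := hv _ t01 _ zT; rewrite (hat_cap0 Tm xTT')// ltxx.
  have [_ cardT _ _] := tri.
  have TE : T = T'.
    by apply/eqP; rewrite eqEcard TT' (cardT _ Tm).1 (cardT _ Tm').1 leqnn.
  by rewrite /pw_val e TE.
have yK : region K (vert y) by exists T => //; exact: simplex_vert.
move/subspace_continuousP: cw => /(_ _ yK) cw.
apply/eqP; rewrite -subr_eq0 -normr_le0; apply/ler_addgt0Pl => e e0; rewrite addr0.
have e20 : 0 < e / 2 by rewrite divr_gt0.
have near1 : \forall t \near (0 : R)^'+, `|pw_val K w (vert y) -
    pw_val K w (vert y + t *: v)| < e / 2.
  have /cvgr_dist_lt /(_ _ e20) /nbhs_ballP[r /= r0 hr] := cw.
  near=> t; apply: hr; last first.
    exists T => //; apply: xT; apply/andP; split; first by near: t; exact: nbhs_right_gt.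
    by near: t; apply: nbhs_right_le.
  rewrite -ball_normE/= opprD addrA subrr add0r normrN normrZ gtr0_norm; last first.
    by near: t; exact: nbhs_right_gt.
  have : t < r / (`|v| + 1) by near: t; apply: nbhs_right_lt; rewrite divr_gt0// ltr_wpDl.
  rewrite ltr_pdivlMr ?ltr_wpDl// => /le_lt_trans; apply.
  have : 0 < t by near: t; exact: nbhs_right_gt.
  by move=> ?; rewrite ler_wpM2l ?ltW// ltrDl.
have near2 : \forall t \near (0 : R)^'+, `|t * dot (w T).2 v| < e / 2.
  near=> t; rewrite normrM gtr0_norm; last by near: t; exact: nbhs_right_gt.
  have : t < e / 2 / (`|dot (w T).2 v| + 1).
    by near: t; apply: nbhs_right_lt; rewrite divr_gt0// ltr_wpDl.
  rewrite ltr_pdivlMr ?ltr_wpDl// => /le_lt_trans; apply.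
  have : 0 < t by near: t; exact: nbhs_right_gt.
  by move=> ?; rewrite ler_wpM2l ?ltW// ltrDl.
have near3 : \forall t \near (0 : R)^'+, 0 < t <= 1.
  near=> t; apply/andP; split; first by near: t; exact: nbhs_right_gt.
  by near: t; apply: nbhs_right_le.
have [t [[h1 h2] /val h3]] := filter_ex (filterI (filterI near1 near2) near3).
rewrite h3 p1_eval_line in h1.
rewrite (_ : _ - _ = (pw_val K w (vert y) - (p1_eval (w T) (vert y) +
  t * dot (w T).2 v)) + t * dot (w T).2 v); last by ring.
by rewrite (le_trans (ler_normD _ _))// [e]splitr lerD// ltW.
Unshelve. all: by end_near.
Qed.

(** [cell_at K x] depends on [x] only through this set of cells, which takes finitely many values,
    each on a finite intersection of simplices and complements of simplices. All measurability
    statements for piecewise functions rest on this. *)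
Definition cells_through K x : {set cell} := [set T in K | `[< simplex T x >]].

Lemma measurable_cells_through K (B : {set cell}) : K \subset cells m ->
  measurable (cells_through K @^-1` [set B]).
Proof.
move=> Km; pose F T : set 'rV[R]_d := if T \in K then
  (if T \in B then simplex T else ~` simplex T) else
  (if T \in B then set0 else setT).
rewrite (_ : _ @^-1` _ = \bigcap_(T in [set: cell]) F T).
  apply: fin_bigcap_measurable => // T _; rewrite /F.
  case: ifPn => [/(fintype.subsetP Km) Tm|_]; last by case: ifP.
  by case: ifP => _; last apply: measurableC; exact: measurable_simplex.
apply/seteqP; split=> x.
  move=> tr T _; rewrite /F -(tr : cells_through K x = B) /cells_through inE.
  by case: (T \in K) => //=; case: asboolP.
move=> h; apply/setP => T; rewrite inE.
have := h T Logic.I; rewrite /F; case: ifP => /= TK; last by case: ifP.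
by case: ifP => _ hx; case: asboolP.
Qed.

Lemma measurable_finite_choice (I : finType) (F : 'rV[R]_d -> I)
    (G : I -> 'rV[R]_d -> R) :
  (forall i, measurable (F @^-1` [set i])) ->
  (forall i, measurable_fun setT (G i)) -> measurable_fun setT (fun x => G (F x) x).
Proof.
move=> mF mG; rewrite (_ : (fun x => _) =
    (fun x => \sum_i (\1_(F @^-1` [set i]) x * G i x))); last first.
  apply/funext => x; rewrite (bigD1 (F x))//= indicE mem_set// mul1r.
  rewrite big1 ?addr0// => i iF; rewrite indicE memNset ?mul0r//=.
  by apply/eqP; rewrite eq_sym.
by apply: measurable_sum => i; apply: measurable_funM.
Qed.

Lemma measurable_cell_at K (G : option cell -> 'rV[R]_d -> R) : K \subset cells m ->
  (forall o, measurable_fun setT (G o)) ->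
  measurable_fun setT (fun x => G (cell_at K x) x).
Proof.
move=> Km mG; rewrite (_ : (fun x => _) =
    (fun x => G [pick T in cells_through K x] x)); last first.
  apply/funext => x; congr (G _ x); apply: eq_pick => T.
  by rewrite !inE.
apply: (@measurable_finite_choice _ (cells_through K) (fun B => G [pick T in B])) => //.
by move=> B; exact: measurable_cells_through.
Qed.

Lemma measurable_pw_val K w : K \subset cells m ->
  measurable_fun setT (pw_val K w).
Proof.
move=> Km; apply: (@measurable_cell_at K
  (fun o x => if o is Some T then p1_eval (w T) x else 0)) => // -[T|] //.
exact: measurable_p1_eval.
Qed.

Lemma measurable_pw_grad K w (F : 'rV[R]_d -> R) : K \subset cells m ->
  measurable_fun setT (fun x => F (pw_grad K w x)).
Proof.
move=> Km; apply: (@measurable_cell_at K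
  (fun o x => F (if o is Some T then (w T).2 else 0))) => // -[T|] //.
Qed.

(** * Piecewise affine functions along segments *)

Lemma affine_sign_germ (a b : R) : (\forall t \near 0^'+, 0 <= a + t * b) /\ 0 <= a \/
  \forall t \near 0^'+, a + t * b < 0.
Proof.
have [a0|a0|<-] := ltgtP 0 a.
- left; split=> //.
  near=> t; have : 0 < t by near: t; exact: nbhs_right_gt.
  have : t < a / (`|b| + 1) by near: t; apply: nbhs_right_lt; rewrite divr_gt0// ltr_wpDl.
  rewrite ltr_pdivlMr ?ltr_wpDl// => ta t0.
  by have := ler_normlW (lexx `|- b|); rewrite normrN => bb; nra.
- right; near=> t; have : 0 < t by near: t; exact: nbhs_right_gt.
  have : t < - a / (`|b| + 1).
    by near: t; apply: nbhs_right_lt; rewrite divr_gt0 ?oppr_gt0// ltr_wpDl.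
  rewrite ltr_pdivlMr ?ltr_wpDl// => ta t0.
  by have := ler_norm b; nra.
- have [b0|b0] := leP 0 b.
    by left; split=> //; near=> t; rewrite add0r mulr_ge0.
  by right; near=> t; rewrite add0r pmulr_rlt0.
Unshelve. all: by end_near.
Qed.

(** A simplex is cut out by finitely many affine inequalities, and each of them has a constant truth
    value on a short initial piece of the half-line. *)
Lemma simplex_germ T x v : T \in cells m ->
  (\forall t \near (0 : R)^'+, simplex T (x + t *: v)) /\ simplex T x \/
  \forall t \near (0 : R)^'+, ~ simplex T (x + t *: v).
Proof.
move=> Tm; pose G y := \forall t \near (0 : R)^'+, p1_eval (hat T y) (x + t *: v) < 0.
have [[y [yT Gy]]|nG] := pselect (exists y, y \in T /\ G y).
  right; apply: filterS Gy => t xt /(simplexP _ Tm) /(_ y yT).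
  by rewrite leNgt xt.
have pos y : y \in T -> (\forall t \near (0 : R)^'+,
    0 <= p1_eval (hat T y) (x + t *: v)) /\ 0 <= p1_eval (hat T y) x.
  move=> yT; have [[h1 h2]|h] := affine_sign_germ (p1_eval (hat T y) x) (dot (hat T y).2 v).
    by split=> //; apply: filterS h1 => t; rewrite p1_eval_line.
  by case: nG; exists y; split=> //; apply: filterS h => t; rewrite p1_eval_line.
left; split; last by apply/(simplexP _ Tm) => y /pos[].
have : \forall t \near (0 : R)^'+, forall y : 'I_(nvert m),
    y \in T -> 0 <= p1_eval (hat T y) (x + t *: v).
  apply: filter_forall => y; case: (boolP (y \in T)) => [/pos[h _]|yT].
    by apply: filterS h.
  by apply: nearW => t.
by apply: filterS => t h; exact/(simplexP _ Tm).
Qed.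

(** On a short initial piece the set of cells containing the point no longer changes, so one affine
    function gives all values. The second claim holds even when the segment runs inside a face: the
    gradient then depends on the picked cell, but its component along [v] does not. *)
Lemma affine_germ K w x v e : K \subset cells m -> consistent K w -> 0 < e ->
  (forall t, 0 < t < e -> region K (x + t *: v)) ->
  exists del c, 0 < del <= e /\ forall t, 0 < t < del ->
    pw_val K w (x + t *: v) = pw_val K w x + t * c /\
    dot (pw_grad K w (x + t *: v)) v = c.
Proof.
move=> Km cw e0 reg.
pose E T := T \in K /\ (\forall t \near (0 : R)^'+, simplex T (x + t *: v)) /\ simplex T x.
have : \forall t \near (0 : R)^'+, forall T : cell, T \in K ->
    (E T -> simplex T (x + t *: v)) /\ (simplex T (x + t *: v) -> E T).
  apply: filter_forall => T; case: (boolP (T \in K)) => TK; last exact: nearW.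
  have [[h hx]|h] := simplex_germ x v (fintype.subsetP Km _ TK).
    by apply: filterS (h) => t xt _; split=> // _; split.
  apply: filterS (h) => t xt _; split=> // -[_ [h' _]].
  by have [s [ns ys]] := filter_ex (filterI h h'); case: (ns ys).
move=> near1.
have /nbhs_ballP[r /= r0 rW] : nbhs (0 : R) (fun t => 0 < t -> forall T : cell,
  T \in K -> (E T -> simplex T (x + t *: v)) /\ (simplex T (x + t *: v) -> E T)).
  exact: near1.
have hr t : 0 < t < Num.min r e -> forall T : cell, T \in K ->
    (E T -> simplex T (x + t *: v)) /\ (simplex T (x + t *: v) -> E T).
  rewrite lt_min => /and3P[t0 tr te].
  have tr0 : ball (0 : R) r t by rewrite -ball_normE/= sub0r normrN gtr0_norm.
  exact: rW t tr0 t0.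
pose del := Num.min r e; have del0 : 0 < del by rewrite lt_min r0.
have d2 : 0 < del / 2 < del by apply/andP; split; lra.
have del_e t : 0 < t < del -> 0 < t < e.
  by rewrite {1}/del lt_min => /and3P[-> _ ->].
have [T0 [TK0 xT0 _]] := cell_atP (reg _ (del_e _ d2)).
have ET0 : E T0 by apply: (hr _ d2 _ TK0).2.
have [_ [_ xT00]] := ET0.
exists del, (dot (w T0).2 v); split; first by rewrite del0 ge_min lexx orbT.
move=> t td; have xtT0 := (hr _ td _ TK0).1 ET0.
split.
  rewrite (pw_valE cw TK0 xtT0) (pw_valE cw TK0 xT00).
  by rewrite p1_eval_line.
have [T1 [TK1 xT1 eT1]] := cell_atP (reg _ (del_e _ td)).
rewrite /pw_grad eT1.
have ET1 := (hr _ td _ TK1).2 xT1.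
(* The two affine functions agree at [t] and at [t / 2], hence have the same slope along [v]. *)
have td2 : 0 < t / 2 < del by move: td => /andP[? ?]; apply/andP; split; lra.
have := cw _ _ _ TK1 TK0 xT1 xtT0.
have := cw _ _ _ TK1 TK0 ((hr _ td2 _ TK1).1 ET1) ((hr _ td2 _ TK0).1 ET0).
rewrite !p1_eval_line => e1 e2.
have t0 : t != 0 by move: td => /andP[t0 _]; rewrite gt_eqF.
apply: (mulfI t0); lra.
Qed.

(* Induction step along a segment.  With [lam] the total increment of [phi],
   [s^2 >= 2 lam s - lam^2] makes the Cauchy-Schwarz bound additive. *)
Lemma integral_slope_step (phi s : R -> R) (lam a b c : R) :
  measurable_fun setT (fun t : measurableTypeR R => s t : measurableTypeR R) ->
  0 <= a -> a < b -> phi b = phi a + (b - a) * c ->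
  (forall t, a < t < b -> s t = c) ->
  ((2 * lam * (phi a - phi 0) - lam ^+ 2 * a)%:E <=
    \int[lebesgue_measure]_(t in `[0%R, a]) (s t ^+ 2)%:E)%E ->
  ((2 * lam * (phi b - phi 0) - lam ^+ 2 * b)%:E <=
    \int[lebesgue_measure]_(t in `[0%R, b]) (s t ^+ 2)%:E)%E.
Proof.
move=> ms a0 ab phib sc ha.
have ms2 D : measurable_fun D (fun t : measurableTypeR R => (s t ^+ 2)%:E).
  by apply: measurable_funTS; apply/measurable_EFinP; exact: measurable_funX.
have c1 : (\int[lebesgue_measure]_(t in `]a, b[) (s t ^+ 2)%:E =
    (c ^+ 2 * (b - a))%:E)%E.
  rewrite (eq_integral (cst (c ^+ 2)%:E)).
    rewrite integral_cst//.
    by rewrite [X in (_ * X)%E]lebesgue_measure_itv/= lte_fin ab -EFinD -EFinM.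
  by move=> t; rewrite inE/= in_itv/= => /sc ->.
apply: (@le_trans _ _ (\int[lebesgue_measure]_(t in `[0%R, a] `|` `]a, b[) (s t ^+ 2)%:E)%E).
  rewrite ge0_integral_setU//; last 2 first.
  - by move=> t _; rewrite lee_fin sqr_ge0.
  - rewrite disj_set2E; apply/eqP/seteqP; split=> t //=; rewrite !in_itv/=.
    by move=> [/andP[_ ta] /andP[/lt_le_trans /(_ ta)]]; rewrite ltxx.
  rewrite c1; apply: le_trans (leeD ha (lexx _)).
  rewrite -EFinD lee_fin phib.
  have : 0 <= (lam - c) ^+ 2 * (b - a) by rewrite mulr_ge0 ?sqr_ge0// subr_ge0 ltW.
  by rewrite !expr2; lra.
apply: ge0_subset_integral => //.
- by apply: measurableU; exact: measurable_itv.
- by move=> t _; rewrite lee_fin sqr_ge0.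
- move=> t /= [|]; rewrite !in_itv/= => /andP[? ?]; apply/andP; split=> //; lra.
Qed.

(** Continuous induction: the supremum of the times up to which the inequality [Q] holds is reached
    through the affine germ on its left, and could be exceeded through the germ on its right if it
    were below 1. No subdivision of the segment by cells has to be constructed. *)
Lemma segment_increment_le K w x u : K \subset cells m -> consistent K w ->
  (forall t, 0 <= t <= 1 -> region K (x + t *: u)) ->
  (((pw_val K w (x + u) - pw_val K w x) ^+ 2)%:E <=
   \int[@lebesgue_measure R]_(t in `[0%R, 1%R])
     ((dot (pw_grad K w (x + t *: u)) u) ^+ 2)%:E)%E.
Proof.
move=> Km cw reg.
pose phi (t : R) : R := pw_val K w (x + t *: u).
pose s (t : R) : R := dot (pw_grad K w (x + t *: u)) u.
have ms : measurable_fun setT (fun t : measurableTypeR R => s t : measurableTypeR R).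
  apply: (measurableT_comp (@measurable_pw_grad K w (fun g => dot g u) Km)).
  by apply: measurable_rV_add => //; exact: measurable_rV_scale.
pose lam := phi 1 - phi 0.
pose Q t := ((2 * lam * (phi t - phi 0) - lam ^+ 2 * t)%:E <=
    \int[@lebesgue_measure R]_(t in `[0%R, t]) (s t ^+ 2)%:E)%E.
have right_germ t : 0 <= t < 1 -> exists del c, 0 < del <= 1 - t /\
    forall r, 0 < r < del -> phi (t + r) = phi t + r * c /\ s (t + r) = c.
  move=> /andP[t0 t1]; have [|r /andP[r0 r1]|del [c [del0 h]]] :=
      @affine_germ K w (x + t *: u) u (1 - t) Km cw.
  - by rewrite subr_gt0.
  - by rewrite -addrA -scalerDl; apply: reg; apply/andP; split; lra.
  - exists del, c; split=> // r /h; rewrite -!addrA -!scalerDl.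
    exact.
have left_germ t : 0 < t <= 1 -> exists del c, 0 < del <= t /\
    forall r, 0 < r < del -> phi (t - r) = phi t - r * c /\ s (t - r) = c.
  move=> /andP[t0 t1]; have [//|r /andP[r0 r1]|del [c [del0 h]]] :=
      @affine_germ K w (x + t *: u) (- u) t Km cw.
    by rewrite scalerN -scaleNr -addrA -scalerDl; apply: reg; apply/andP; split; lra.
  exists del, (- c); split=> // r /h; rewrite scalerN -scaleNr -!addrA -!scalerDl.
  move=> [e1 e2]; split; first by rewrite mulrN opprK.
  by rewrite /s -e2 dotNr opprK.
have Q0 : Q 0.
  rewrite /Q subrr !mulr0 subrr; apply: integral_ge0 => t _.
  by rewrite lee_fin sqr_ge0.
pose S := [set t | 0 <= t <= 1 /\ Q t].
have S0 : S 0 by split; rewrite ?lexx ?ler01.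
have Sub : has_ubound S by exists 1 => t [/andP[]].
have supS : has_sup S by split=> //; exists 0.
pose t1 := sup S.
have t101 : 0 <= t1 <= 1.
  by rewrite (ub_le_sup Sub S0)/=; apply: ge_sup; [exists 0|move=> t [/andP[]]].
have Qt1 : Q t1.
  have [t1_0|t10] := eqVneq t1 0; first by rewrite t1_0.
  have t1gt0 : 0 < t1 by rewrite lt_def t10; case/andP: t101.
  have [|del [c [/andP[del0 delt] h]]] := left_germ t1.
    by rewrite t1gt0; case/andP: t101.
  have [a [/andP[a0 a1] Qa] ta] := sup_adherent del0 supS.
  have := ub_le_sup Sub (conj (introT andP (conj a0 a1)) Qa : S a).
  rewrite -/t1 le_eqVlt => /predU1P[<-//|at1].
  apply: (@integral_slope_step phi s lam a t1 c) => //.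
    have [|e _] := h (t1 - a); first by rewrite -/t1 in ta; apply/andP; split; lra.
    by move: e; rewrite opprB addrC subrK => ->; ring.
  move=> t /andP[at' tt1]; have [|_] := h (t1 - t).
    by rewrite -/t1 in ta; apply/andP; split; lra.
  by rewrite opprB addrC subrK.
have t11 : t1 = 1.
  apply/eqP; rewrite eq_le; case/andP: (t101) => t10 -> /=; rewrite leNgt.
  apply/negP => t1lt.
  have [|del [c [/andP[del0 delt] h]]] := right_germ t1; first by rewrite t10.
  have d2 : 0 < del / 2 < del by apply/andP; split; lra.
  have : S (t1 + del / 2).
    split; first by apply/andP; split; lra.
    apply: (@integral_slope_step phi s lam t1 _ c) => //.
    - by lra.
    - by have [-> _] := h _ d2; rewrite (addrC t1) addrK.
    - move=> t /andP[tt tt']; have [|_] := h (t - t1); last by rewrite addrC subrK.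
      by apply/andP; split; lra.
  by move=> /(ub_le_sup Sub); rewrite -/t1; lra.
have phi0 : phi 0 = pw_val K w x by rewrite /phi scale0r addr0.
have phi1 : phi 1 = pw_val K w (x + u) by rewrite /phi scale1r.
(* At time 1 the increment is [lam] itself, so the left side of [Q] becomes [lam ^+ 2]. *)
move: Qt1; rewrite /Q t11 -phi0 -phi1 -/lam.
by rewrite (_ : 2 * lam * lam - _ = lam ^+ 2)//; ring.
Qed.

Lemma upper_gradient_pw K w (Omega : set 'rV[R]_d) : K \subset cells m ->
  consistent K w -> Omega `<=` region K ->
  upper_gradient Omega (pw_val K w)
    (fun x => dot (pw_grad K w x) (pw_grad K w x)).
Proof.
move=> Km cw OK; have mg := @measurable_pw_grad K w (fun g => dot g g) Km.
split=> //; first exact: measurable_pw_val.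
  by move=> x; exact: dot_ge0.
move=> x u seg; apply: le_trans (segment_increment_le Km cw (fun t t01 => OK _ (seg t t01))) _.
have ml : measurable_fun setT (fun t : measurableTypeR R => x + (t : R) *: u).
  by apply: measurable_rV_add => //; exact: measurable_rV_scale.
rewrite -ge0_integralZl//; last 3 first.
- by apply: measurable_funTS; apply/measurable_EFinP; exact: (measurableT_comp mg ml).
- by move=> t _; rewrite lee_fin dot_ge0.
- by rewrite lee_fin dot_ge0.
apply: ge0_le_integral => //.
- by move=> t _; rewrite lee_fin sqr_ge0.
- apply: measurable_funTS; apply/measurable_EFinP; apply: measurable_funX.
  exact: (measurableT_comp (@measurable_pw_grad K w (fun g => dot g u) Km) ml).
- apply: measurable_funTS; apply: measurable_funeM; apply/measurable_EFinP.
  exact: (measurableT_comp mg ml).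
- by move=> t _; rewrite -EFinM lee_fin mulrC cauchy_schwarz_dot.
Qed.

End hat_functions.

Section diameter.
Variables (R : realType) (d : nat).
Implicit Types (x y : 'rV[R]_d) (A : set 'rV[R]_d).

Lemma norm_le_enorm x : `|x| <= enorm x.
Proof.
apply/rV_norm_le => [|i]; first exact: sqrtr_ge0.
rewrite -sqrtr_sqr ler_sqrt ?dot_ge0// /dot (bigD1 i)//= -expr2 lerDl.
by apply: sumr_ge0 => j _; rewrite -expr2 sqr_ge0.
Qed.

Lemma enorm_le_norm x : enorm x <= d.+1%:R * `|x|.
Proof.
rewrite -[leRHS]ger0_norm ?mulr_ge0// -sqrtr_sqr ler_sqrt ?sqr_ge0//.
apply: le_trans (dot_le_norm x) _; rewrite exprMn ler_wpM2r ?sqr_ge0//.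
rewrite -natrX ler_nat (leq_trans (leqnSn d))//.
by rewrite -[leqLHS]expn1 leq_pexp2l.
Qed.

(** [diam] is a real supremum, so the distances have to be shown bounded before it can be compared
    with any of them. *)
Lemma norm_le_diam A B x y : A `<=` cube 0 B -> A x -> A y -> `|x - y| <= diam A.
Proof.
move=> AB Ax Ay; apply: le_trans (norm_le_enorm _) _.
apply: ub_le_sup; last by exists x, y.
exists (d.+1%:R * (B + B)) => _ [u [v [/AB + /AB + ->]]].
rewrite /cube/= !subr0 => uB vB; apply: le_trans (enorm_le_norm _) _.
by rewrite ler_wpM2l// (le_trans (ler_normB _ _))// lerD.
Qed.

Lemma simplex_bounded (m : mesh R d) (T : {set 'I_(nvert m)}) :
  simplex T `<=` cube 0 (\sum_i `|@vert _ _ m i|).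
Proof.
move=> _ [a [a0 a1 ->]]; rewrite /cube/= subr0.
rewrite (le_trans (ler_norm_sum _ _ _))// [leRHS](bigID (mem T))/=.
apply: ler_wpDr; first exact: sumr_ge0.
apply: ler_sum => i iT; rewrite normrZ ger0_norm// ler_piMl//.
by rewrite -a1 (bigD1 i)//= lerDl sumr_ge0.
Qed.

Lemma simplex_diam (m : mesh R d) (T : {set 'I_(nvert m)}) x y :
  simplex T x -> simplex T y -> `|x - y| <= diam (simplex T).
Proof. by apply: norm_le_diam; exact: simplex_bounded. Qed.

Lemma simplexU_diam (m : mesh R d) (T T' : {set 'I_(nvert m)}) x y :
  simplex T x -> simplex T' y -> `|x - y| <= diam (simplex T `|` simplex T').
Proof.
move=> xT yT'; apply: (@norm_le_diam _ (\sum_i `|@vert _ _ m i|)); [|by left|by right].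
by rewrite subUset; split; exact: simplex_bounded.
Qed.

End diameter.

(** * Inscribed cubes, bounds for hat functions, and the number of nearby vertices *)

Section shape_regular_mesh.
Variables (R : realType) (d : nat) (m : mesh R d) (U : set 'rV[R]_d).
Hypothesis tri : triangulation m U.
Variables (sigma h : R).
Hypotheses (sigma0 : 0 < sigma) (h0 : 0 < h).
Local Notation cell := {set 'I_(nvert m)}.
Hypothesis regular : forall T : cell, T \in cells m ->
  [/\ diam (simplex T) <= sigma * h, h <= sigma * diam (simplex T) &
    exists x r, [/\ 0 < r, eball x r `<=` simplex T &
      diam (simplex T) <= sigma * r]].
Implicit Types (T : cell) (x : 'rV[R]_d) (y : 'I_(nvert m)).

(* [kappa_in * h] is the half-width of a cube inscribed in every cell. *)
Definition kappa_in : R := (d.+1%:R * sigma ^+ 2)^-1.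

Lemma kappa_in_gt0 : 0 < kappa_in.
Proof. by rewrite invr_gt0 mulr_gt0// exprn_gt0. Qed.

(** The inscribed Euclidean ball has radius [r] with [h <= sigma * diam <= sigma ^+ 2 * r], and the
    Euclidean norm is at most [d + 1] times the max norm. *)
Lemma cell_contains_cube T : T \in cells m ->
  exists z, cube z (kappa_in * h) `<=` simplex T.
Proof.
move=> /regular[_ hd [x [r [r0 xr dr]]]]; exists x => z xz; apply: xr.
apply: le_trans (enorm_le_norm _) _; apply: le_trans (ler_wpM2l (ler0n _ _) xz) _.
rewrite /kappa_in invfM mulrA mulrA divff ?pnatr_eq0// mul1r mulrC.
rewrite ler_pdivrMr ?exprn_gt0//.
apply: le_trans hd _; rewrite mulrC expr2 mulrA; apply: ler_wpM2r; first exact: ltW.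
by rewrite mulrC.
Qed.

(** Between the points [z - r e_j] and [z + r e_j] of the cell, the hat function changes by [2 * r]
    times its [j]-th derivative, and both values are in [0, 1]. *)
Lemma norm_hat_grad T z r y : T \in cells m -> 0 < r -> cube z r `<=` simplex T ->
  `|(hat T y).2| <= (2 * r)^-1.
Proof.
move=> Tm r0 zT; have r20 : 0 < 2 * r by rewrite mulr_gt0.
apply/rV_norm_le => [|j]; first by rewrite invr_ge0 ltW.
pose e : 'rV[R]_d := delta_mx ord0 j.
have e1 : `|e| <= 1.
  apply/rV_norm_le => // i; rewrite !mxE; case: (_ && _); by rewrite ?normr1 ?normr0.
have xT (s : R) : `|s| <= r -> simplex T (z + s *: e).
  move=> sr; apply: zT; rewrite /cube/= addrAC subrr add0r normrZ.
  by rewrite -[leRHS]mulr1 ler_pM.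
have x1 := xT r; have x2 := xT (- r).
rewrite normrN gtr0_norm// lexx in x1 x2.
have {}x1 := x1 isT; have {}x2 := x2 isT.
have := hat_ge0 tri y Tm x1; have := hat_le1 tri y Tm x1.
have := hat_ge0 tri y Tm x2; have := hat_le1 tri y Tm x2.
rewrite !p1_eval_line dot_delta; set g := (hat T y).2 ord0 j => h1 h2 h3 h4.
have : `|2 * r * g| <= 1 by rewrite ler_norml; apply/andP; split; lra.
rewrite normrM (gtr0_norm r20) => hg.
by rewrite -[leRHS]mul1r ler_pdivlMr// mulrC.
Qed.

(** The point [x] may lie outside [T]: the extension evaluates hat functions of [S T] at vertices of
    [T]. *)
Lemma norm_hat_le T y x x' : T \in cells m -> simplex T x' ->
  `|p1_eval (hat T y) x| <= 1 + d%:R * (2 * (kappa_in * h))^-1 * `|x - x'|.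
Proof.
move=> Tm x'T; have [z zT] := cell_contains_cube Tm.
rewrite -(subrK (p1_eval (hat T y) x') (p1_eval _ x)) p1_evalB addrC.
apply: le_trans (ler_normD _ _) _; apply: lerD.
  by rewrite ger0_norm ?(hat_ge0 tri)// (hat_le1 tri).
apply: le_trans (norm_dot_le _ _) _; apply: ler_wpM2r => //; apply: ler_wpM2l => //.
by apply: norm_hat_grad zT => //; rewrite mulr_gt0// kappa_in_gt0.
Qed.

Let center T : 'rV[R]_d := xget 0 [set z | cube z (kappa_in * h) `<=` simplex T].

Let centerP T : T \in cells m -> cube (center T) (kappa_in * h) `<=` simplex T.
Proof.
by move=> /cell_contains_cube[z hz]; rewrite /center; case: xgetP => [? _|/(_ z)].
Qed.

Let kh0 : 0 < kappa_in * h.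
Proof. by rewrite mulr_gt0// kappa_in_gt0. Qed.

(* If the centers are close, the inscribed cubes overlap in a cube, on which the
   hat function of a vertex of [T] not shared with [T'] would vanish. *)
Let centers_separated T T' : T \in cells m -> T' \in cells m ->
  `|center T - center T'| <= kappa_in * h -> T = T'.
Proof.
move=> Tm Tm' cc; have [_ card_cell _ _] := tri.
apply/eqP; rewrite eqEcard (card_cell _ Tm).1 (card_cell _ Tm').1 leqnn andbT.
apply/fintype.subsetP => y yT; apply: contraT => yT'.
pose p := 2^-1 *: (center T + center T').
have sub q : cube p (kappa_in * h / 2) q -> p1_eval (hat T y) q = 0.
  rewrite /cube/= => pq.
  have near1 : `|p - center T| <= kappa_in * h / 2.
    rewrite (_ : _ - _ = 2^-1 *: (center T' - center T)); last first.
      by apply/rowP => i; rewrite !mxE; field.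
    by rewrite normrZ gtr0_norm ?invr_gt0// mulrC ler_wpM2r ?invr_ge0// distrC.
  have near2 : `|p - center T'| <= kappa_in * h / 2.
    rewrite (_ : _ - _ = 2^-1 *: (center T - center T')); last first.
      by apply/rowP => i; rewrite !mxE; field.
    by rewrite normrZ gtr0_norm ?invr_gt0// mulrC ler_wpM2r ?invr_ge0.
  apply: (@hat_cap0 _ _ _ _ tri T T' q y) => //.
  apply: (simplex_capP tri) => //; apply: centerP => //.
    by rewrite /cube/= (le_trans (ler_distD p _ _))// [leRHS]splitr lerD.
  by rewrite /cube/= (le_trans (ler_distD p _ _))// [leRHS]splitr lerD.
have p0 : p1_eval (hat T y) p = 0.
  by apply: sub; rewrite /cube/= subrr normr0 divr_ge0// ltW.
have g0 : (hat T y).2 = 0.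
  apply/rowP => j; rewrite [RHS]mxE.
  have : p1_eval (hat T y) (p + (kappa_in * h / 2) *: delta_mx ord0 j) = 0.
    have e1 : `|delta_mx ord0 j : 'rV[R]_d| <= 1.
      apply/rV_norm_le => // i; rewrite !mxE.
      by case: (_ && _); rewrite ?normr1 ?normr0.
    apply: sub; rewrite /cube/= addrAC subrr add0r normrZ gtr0_norm ?divr_gt0//.
    by apply: ler_piMr => //; rewrite divr_ge0// ltW.
  rewrite p1_eval_line p0 add0r dot_delta => /eqP; rewrite mulf_eq0.
  by rewrite gt_eqF ?divr_gt0//= => /eqP.
have : p1_eval (hat T y) (vert y) = p1_eval (hat T y) p by rewrite /p1_eval g0 !dot0l.
by rewrite p0 (hatP tri)// eqxx => /eqP; rewrite oner_eq0.
Qed.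

(** The number of grid boxes of side [kappa_in * h] used to cover a cube of half-width
    [(K + sigma) * h], times the [d + 1] vertices of a cell. *)
Definition packing_number (K : R) : nat :=
  ((Num.truncn (2 * (K + sigma) / kappa_in)).+1 ^ d * d.+1)%N.

(** A cell with a vertex within [K * h] of [x] has its center within [(K + sigma) * h]. By
    [centers_separated] a grid box contains at most one center, so rounding the centers to the grid
    counts the cells. *)
Lemma card_near_vertices (K : R) x : 0 <= K ->
  (#|[set i in finset.cover (cells m) | (`|vert i - x| <= K * h)%R]%SET| <= packing_number K)%N.
Proof.
move=> K0; have [_ card_cell _ _] := tri.
pose K' := K + sigma.
have K'0 : 0 <= K' by rewrite addr_ge0// ltW.
pose B := [set T in cells m | `|center T - x| <= K' * h]%SET.
have AB : [set i in finset.cover (cells m) | `|vert i - x| <= K * h]%SET \subset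
    finset.cover B.
  apply/fintype.subsetP => i; rewrite inE => /andP[/bigcupP[T Tm iT] ix].
  apply/bigcupP; exists T => //; rewrite inE Tm/=.
  rewrite (le_trans (ler_distD (vert i) _ _))// addrC mulrDl lerD//.
  have [dT _ _] := regular Tm; apply: le_trans dT.
  apply: simplex_diam; last exact: simplex_vert.
  by apply: (centerP Tm); rewrite /cube/= subrr normr0 ltW.
apply: leq_trans (subset_leq_card AB) _; apply: leq_trans (leq_card_cover _) _.
rewrite (eq_bigr (fun=> d.+1)); last by move=> T; rewrite inE => /andP[/card_cell[]].
rewrite sum_nat_const leq_mul2r /=.
pose n0 := Num.truncn (2 * K' / kappa_in).
(* Coordinate of the center in units of the grid, measured from the corner of the cube. Equal
   integer parts mean a difference of at most one unit. *)
pose q T j := (center T ord0 j - x ord0 j + K' * h) / (kappa_in * h).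
have q_ge0 T j : T \in B -> 0 <= q T j <= 2 * K' / kappa_in.
  rewrite inE => /andP[_ /rV_norm_le].
  move=> /(_ (mulr_ge0 K'0 (ltW h0))) /(_ j); rewrite !mxE ler_norml => /andP[l1 l2].
  apply/andP; split; first by apply: divr_ge0; [lra|exact: ltW].
  rewrite /q ler_pdivrMr//.
  rewrite (_ : 2 * K' / kappa_in * _ = 2 * K' * h); first lra.
  by rewrite mulrA divfK// gt_eqF// kappa_in_gt0.
have qn T j : T \in B -> (Num.truncn (q T j) < n0.+1)%N.
  by move=> /(q_ge0 _ j)/andP[q0 q1]; rewrite ltnS; exact: le_truncn.
pose G T : {ffun 'I_d -> 'I_n0.+1} := [ffun j => inord (Num.truncn (q T j))].
suff Ginj : {in B &, injective G}.
  rewrite -(card_in_imset Ginj) (leq_trans (max_card _))//.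
  by rewrite card_ffun !card_ord.
move=> T T' TB TB' /ffunP GTT'; apply: centers_separated.
- by move: TB; rewrite inE => /andP[].
- by move: TB'; rewrite inE => /andP[].
apply/rV_norm_le => [|j]; first exact: ltW.
have /(congr1 val) := GTT' j; rewrite !ffunE /= !inordK ?qn// => qq.
have /andP[q0 _] := q_ge0 T j TB; have /andP[q0' _] := q_ge0 T' j TB'.
have := truncn_itv q0; have := truncn_itv q0'; rewrite -qq.
set k := Num.truncn _ => /andP[a1 a2] /andP[b1 b2].
rewrite -natr1 in a2 b2.
have -> : (center T - center T') ord0 j = (q T j - q T' j) * (kappa_in * h).
  by rewrite !mxE -mulrBl divfK ?gt_eqF//; ring.
rewrite normrM (gtr0_norm kh0); apply: ler_piMl; first exact: ltW.
rewrite ler_norml.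
by apply/andP; split; lra.
Qed.

End shape_regular_mesh.

(** * The extended basis *)

Section extension_operator.
Variables (R : realType) (d : nat) (Omega : set 'rV[R]_d) (m : mesh R d).
Variable U : set 'rV[R]_d.
Hypothesis tri : triangulation m U.
Local Notation cell := {set 'I_(nvert m)}.
Local Notation P1 := (R^o * 'rV[R]_d)%type.
Variables (S : cell -> cell) (kappa : cell -> 'I_(nvert m) -> R).
Hypotheses (ext : extension_map Omega S) (wt : averaging_weights Omega kappa).
Local Notation Th := (Th Omega m).
Local Notation ThI := (ThI Omega m).
Local Notation nI := #|vertices ThI|.
Local Notation expand := (@Defs.expand R d Omega m S kappa).
Implicit Types (T : cell) (K : {set cell}) (x : 'rV[R]_d) (v w : dpw m).
Implicit Types (y : 'I_(nvert m)) (i : 'I_nI).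

Lemma Th_cells : Th \subset cells m.
Proof. by apply/fintype.subsetP => T; rewrite inE => /andP[]. Qed.

Lemma ThI_Th : ThI \subset Th.
Proof. by apply/fintype.subsetP => T; rewrite inE => /andP[]. Qed.

Lemma ThI_cells : ThI \subset cells m.
Proof. exact: fintype.subset_trans ThI_Th Th_cells. Qed.

Lemma nodal_basisE K y T : T \in K -> nodal_basis K y T = hat T y.
Proof. by move=> TK; rewrite ffunE TK. Qed.

Lemma sum_vertices_hat K T (F : 'I_(nvert m) -> P1 -> R) :
  K \subset cells m -> T \in K -> (forall y, F y 0 = 0) ->
  \sum_(y in vertices K) F y (hat T y) = \sum_(y in T) F y (hat T y).
Proof.
move=> Km TK F0; rewrite [LHS](bigID (mem T))/= [X in _ + X]big1 ?addr0; last first.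
  move=> y /andP[_ yT]; rewrite (hat_notin tri) ?F0//.
  exact: (fintype.subsetP Km).
apply: eq_bigl => y; rewrite andbC; apply: andb_idr => yT.
by apply/finset.bigcupP; exists T.
Qed.

Lemma pw_val_lin K (a : R) v w x :
  pw_val K (a *: v + w) x = a * pw_val K v x + pw_val K w x.
Proof.
rewrite /pw_val; case: cell_at => [T|]; last by rewrite mulr0 addr0.
by rewrite !ffunE p1_evalD p1_evalZ.
Qed.

Lemma pw_val0 K x : pw_val K (0 : dpw m) x = 0.
Proof. by rewrite /pw_val; case: cell_at => // T; rewrite ffunE p1_eval0. Qed.

Lemma pw_val_sum K (I : Type) (s : seq I) (P : pred I) (a : I -> R) (F : I -> dpw m) x :
  pw_val K (\sum_(i <- s | P i) a i *: F i) x =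
  \sum_(i <- s | P i) a i * pw_val K (F i) x.
Proof.
elim: s => [|i s ih]; first by rewrite !big_nil pw_val0.
by rewrite !big_cons; case: ifP => // _; rewrite pw_val_lin ih.
Qed.

Lemma average_lin (a : R) v w y :
  average Omega kappa (a *: v + w) y =
  a * average Omega kappa v y + average Omega kappa w y.
Proof.
rewrite /average mulr_sumr -big_split; apply: eq_bigr => T _.
by rewrite !ffunE p1_evalD p1_evalZ /=; ring.
Qed.

Lemma Eh_lin (a : R) v w :
  Eh Omega S kappa (a *: v + w) = a *: Eh Omega S kappa v + Eh Omega S kappa w.
Proof.
have FhE : Fh Omega S (a *: v + w) = a *: Fh Omega S v + Fh Omega S w.
  apply/ffunP => T; rewrite !ffunE; case: ifP => // _.
  by rewrite scaler0 addr0.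
rewrite /Eh /Ah FhE scaler_sumr -big_split; apply: eq_bigr => y _ /=.
by rewrite average_lin scalerDl scalerA.
Qed.

Lemma Eh0 : Eh Omega S kappa 0 = 0.
Proof.
have := Eh_lin (-1) 0 0.
by rewrite scaler0 addr0 scaleN1r addNr.
Qed.

Lemma Eh_sum (I : Type) (s : seq I) (P : pred I) (a : I -> R) (F : I -> dpw m) :
  Eh Omega S kappa (\sum_(i <- s | P i) a i *: F i) =
  \sum_(i <- s | P i) a i *: Eh Omega S kappa (F i).
Proof.
elim: s => [|i s ih]; first by rewrite !big_nil Eh0.
by rewrite !big_cons; case: ifP => // _; rewrite Eh_lin ih.
Qed.

(** The coefficients are the nodal values, taken in whichever cell [cell_at] picks in the whole
    active mesh; [continuous_vertex_value] identifies them with the values in each uncut cell. *)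
Lemma VhI_expansion v : VhI Omega v ->
  exists a : 'cV[R]_nI, v = \sum_(i < nI) a i ord0 *: nodal_basis ThI (enum_val i).
Proof.
move=> [v0 [_ cv0] <-]; exists (\col_i pw_val Th v0 (vert (enum_val i))).
under eq_bigr do rewrite mxE.
rewrite -(big_enum_val (fun y => pw_val Th v0 (vert y) *: nodal_basis ThI y)).
apply/ffunP => T; rewrite ffunE sum_ffunE; case: ifPn => TI; last first.
  by rewrite big1// => y _; rewrite !ffunE (negbTE TI) scaler0.
have Tm := fintype.subsetP ThI_cells _ TI.
apply: (affine_eq tri Tm) => z zT.
rewrite p1_eval_sum (eq_bigr (fun y => pw_val Th v0 (vert y) * p1_eval (hat T y) (vert z))).
  rewrite (@sum_vertices_hat ThI T (fun y p => pw_val Th v0 (vert y) * p1_eval p (vert z)))//.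
  - rewrite (bigD1 z)//= big1 ?addr0 => [|y /andP[yT yz]]; last first.
      by rewrite (hatP tri)// eq_sym (negbTE yz) mulr0.
    rewrite (hatP tri)// eqxx mulr1.
    by rewrite (continuous_vertex_value tri Th_cells cv0 (fintype.subsetP ThI_Th _ TI)).
  - exact: ThI_cells.
  - by move=> y; rewrite p1_eval0 mulr0.
by move=> y _; rewrite ffunE nodal_basisE// p1_evalZ.
Qed.

(** [coef] is a choice, so the point is that some expansion exists: apply the linear operator E to
    the nodal expansion of the preimage. *)
Lemma VhE_coef v : VhE Omega S kappa v -> v = expand (coef Omega S kappa v).
Proof.
move=> [vI /VhI_expansion[a ->] <-].
rewrite /coef; set u := Eh _ _ _ _.
have /(xgetPex 0) : exists a, [set a | u = expand a] a.
  by exists a; rewrite /= /u Eh_sum.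
by [].
Qed.

Definition ebasis i x : R := pw_val Th (extended_basis S kappa i) x.

Lemma pw_val_expand (a : 'cV[R]_nI) x :
  pw_val Th (expand a) x = \sum_i a i ord0 * ebasis i x.
Proof. exact: pw_val_sum. Qed.

Lemma pw_val_Ah w x T : cell_at Th x = Some T -> T \in Th ->
  pw_val Th (Ah Omega kappa w) x =
  \sum_(y in T) average Omega kappa w y * p1_eval (hat T y) x.
Proof.
move=> cx TTh; rewrite pw_val_sum.
rewrite -(@sum_vertices_hat Th T (fun y p => average Omega kappa w y * p1_eval p x))//.
- by apply: eq_bigr => y _; rewrite /pw_val cx nodal_basisE.
- exact: Th_cells.
- by move=> y; rewrite p1_eval0 mulr0.
Qed.

Lemma Ah_vertex w T y : T \in Th -> y \in T ->
  p1_eval (Ah Omega kappa w T) (vert y) = average Omega kappa w y.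
Proof.
move=> TTh yT; rewrite sum_ffunE p1_eval_sum.
rewrite (eq_bigr (fun z => average Omega kappa w z * p1_eval (hat T z) (vert y))).
  rewrite (@sum_vertices_hat Th T (fun z p => average Omega kappa w z * p1_eval p (vert y)))//.
  - have Tm := fintype.subsetP Th_cells _ TTh.
    rewrite (bigD1 y)//= big1 ?addr0 => [|z /andP[zT zy]]; last first.
      by rewrite (hatP tri)// eq_sym (negbTE zy) mulr0.
    by rewrite (hatP tri)// eqxx mulr1.
  - exact: Th_cells.
  - by move=> z; rewrite p1_eval0 mulr0.
by move=> z _; rewrite ffunE nodal_basisE// p1_evalZ.
Qed.

Lemma consistent_Ah w : consistent Th (Ah Omega kappa w).
Proof.
apply: (vertex_consistentW tri Th_cells) => T T' y TTh TTh' yT yT'.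
by rewrite !Ah_vertex.
Qed.

Lemma consistent_VhE v : VhE Omega S kappa v -> consistent Th v.
Proof. by move=> [vI _ <-]; exact: consistent_Ah. Qed.

Lemma average_nodal i y : average Omega kappa (Fh Omega S (nodal_basis ThI (enum_val i))) y =
  \sum_(T in Th | y \in T) kappa T y * p1_eval (hat (S T) (enum_val i)) (vert y).
Proof.
apply: eq_bigr => T /andP[TTh _]; rewrite ffunE TTh nodal_basisE//.
by have [h _] := ext; exact: h.
Qed.

(** The extension reproduces the constant 1: the hat functions of [S T] sum to 1 everywhere, also
    outside [S T], and the weights at [y] sum to 1. *)
Lemma sum_average_nodal y : y \in vertices Th ->
  \sum_(i < nI) average Omega kappa (Fh Omega S (nodal_basis ThI (enum_val i))) y = 1.
Proof.
move=> yTh; have [_ w1] := wt yTh.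
under eq_bigr do rewrite average_nodal.
rewrite exchange_big/= -[RHS]w1; apply: eq_bigr => T /andP[TTh yT].
rewrite -mulr_sumr -(big_enum_val (fun z => p1_eval (hat (S T) z) (vert y)))/=.
have STI : S T \in ThI by have [h _] := ext; exact: h.
rewrite (@sum_vertices_hat ThI (S T) (fun z p => p1_eval p (vert y)))//.
- by rewrite (sum_hat tri) ?mulr1//; exact: (fintype.subsetP ThI_cells).
- exact: ThI_cells.
- by move=> z; rewrite p1_eval0.
Qed.

Lemma ebasisE i x T : cell_at Th x = Some T -> T \in Th -> ebasis i x =
  \sum_(y in T) average Omega kappa (Fh Omega S (nodal_basis ThI (enum_val i))) y *
    p1_eval (hat T y) x.
Proof. exact: pw_val_Ah. Qed.

Lemma sum_ebasis x : region Th x -> \sum_i ebasis i x = 1.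
Proof.
move=> /cell_atP[T [TTh xT cx]].
under eq_bigr do rewrite (ebasisE _ cx TTh).
rewrite exchange_big/= -[RHS](sum_hat tri x (fintype.subsetP Th_cells _ TTh)).
apply: eq_bigr => y yT; rewrite -mulr_suml sum_average_nodal ?mul1r//.
by apply/finset.bigcupP; exists T.
Qed.

Variables (sigma h C' Lam : R).
Hypothesis diam_cell : forall T x x', T \in Th -> simplex T x -> simplex T x' ->
  `|x - x'| <= sigma * h.
Hypothesis diam_ext : forall T x x', T \in Th -> simplex T x -> simplex (S T) x' ->
  `|x - x'| <= C' * h.
Hypothesis hat_bound : forall T z y, T \in Th -> y \in T ->
  `|p1_eval (hat (S T) z) (vert y)| <= Lam.

Lemma average_nodal_bound i y : y \in vertices Th ->
  `|average Omega kappa (Fh Omega S (nodal_basis ThI (enum_val i))) y| <= Lam.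
Proof.
move=> yTh; have [w0 w1] := wt yTh.
rewrite average_nodal (le_trans (ler_norm_sum _ _ _))//.
apply: le_trans (_ : \sum_(T in Th | y \in T) kappa T y * Lam <= _).
  apply: ler_sum => T /andP[TTh yT]; rewrite normrM (ger0_norm (w0 T TTh yT)).
  by apply: ler_wpM2l; [exact: w0|exact: hat_bound].
by rewrite -mulr_suml w1 mul1r.
Qed.

(** On a cell the function is a convex combination of its nodal averages. *)
Lemma ebasis_bound i x : region Th x -> `|ebasis i x| <= Lam.
Proof.
move=> /cell_atP[T [TTh xT cx]]; have Tm := fintype.subsetP Th_cells _ TTh.
rewrite (ebasisE _ cx TTh) (le_trans (ler_norm_sum _ _ _))//.
rewrite -[leRHS]mulr1 -(sum_hat tri x Tm) mulr_sumr; apply: ler_sum => y yT.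
rewrite normrM (ger0_norm (hat_ge0 tri y Tm xT)).
apply: ler_wpM2r; first exact: (hat_ge0 tri).
by apply: average_nodal_bound; apply/finset.bigcupP; exists T.
Qed.

(** If the value at a point of [T] is nonzero, some vertex [y] of [T] lies in a cell [T'] such that
    [i] is a vertex of [S T']. The distance is measured through [y]. *)
Lemma ebasis_support i x : region Th x -> ebasis i x != 0 ->
  `|x - vert (enum_val i)| <= (sigma + C') * h.
Proof.
move=> /cell_atP[T [TTh xT cx]]; apply: contraNT; rewrite -ltNge => far.
rewrite (ebasisE _ cx TTh); apply/eqP; apply: big1 => y yT.
rewrite average_nodal big1 ?mul0r// => T' /andP[TTh' yT'].
have ST'm : S T' \in cells m.
  by apply: (fintype.subsetP ThI_cells); have [hS _] := ext; exact: hS.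
rewrite (hat_notin tri) ?p1_eval0 ?mulr0//; apply: contraTN far => iT'.
rewrite -leNgt (le_trans (ler_distD (vert y) _ _))// mulrDl lerD//.
  by apply: (diam_cell TTh xT); exact: simplex_vert.
by apply: (diam_ext TTh'); exact: simplex_vert.
Qed.

End extension_operator.

(** * Lumping error *)

Section bounded_measurable.
Context d (T : measurableType d) (R : realType).
Variables (mu : {measure set T -> \bar R}) (D : set T).
Hypotheses (mD : measurable D) (muD : (mu D < +oo)%E).
Implicit Types f g : T -> R.

(** A class closed under sums and products and, on a set of finite measure, contained in the
    integrable functions; with it the estimates can be carried out on real-valued integrals. *)
Definition bmf f := measurable_fun D f /\ exists B, forall x, D x -> `|f x| <= B.

Lemma bmf_cst (c : R) : bmf (fun=> c).
Proof. by split => //; exists `|c|. Qed.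

Lemma bmfD f g : bmf f -> bmf g -> bmf (fun x => f x + g x).
Proof.
move=> [mf [B fB]] [mg [B' gB]]; split; first exact: measurable_funD.
exists (B + B') => x Dx; rewrite (le_trans (ler_normD _ _))// lerD//.
  exact: fB.
exact: gB.
Qed.

Lemma bmfM f g : bmf f -> bmf g -> bmf (fun x => f x * g x).
Proof.
move=> [mf [B fB]] [mg [B' gB]]; split; first exact: measurable_funM.
exists (B * B') => x Dx; rewrite normrM ler_pM//; [exact: fB|exact: gB].
Qed.

Lemma bmf_norm f : bmf f -> bmf (fun x => `|f x|).
Proof.
move=> [mf [B fB]]; split; first exact: measurableT_comp.
by exists B => x Dx; rewrite normr_id; exact: fB.
Qed.

Lemma bmf_sqr f : bmf f -> bmf (fun x => f x ^+ 2).
Proof. by move=> bf; under eq_fun do rewrite expr2; exact: bmfM. Qed.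

Lemma bmf_sum (I : Type) (s : seq I) (F : I -> T -> R) : (forall i, bmf (F i)) ->
  bmf (fun x => \sum_(i <- s) F i x).
Proof.
move=> bF; elim: s => [|i s ih].
  by under eq_fun do rewrite big_nil; exact: bmf_cst.
by under eq_fun do rewrite big_cons; exact: bmfD.
Qed.

Lemma bmf_integrable f : bmf f -> mu.-integrable D (EFin \o f).
Proof.
move=> [mf [B fB]]; apply: measurable_bounded_integrable => //.
exists B; split; first exact: num_real.
by move=> M BM x Dx /=; apply: le_trans (fB _ Dx) _; exact: ltW.
Qed.

Local Notation Int f := (\int[mu]_(x in D) f x).

Lemma bmf_IntE f : bmf f -> (Int f)%:E = (\int[mu]_(x in D) (f x)%:E)%E.
Proof.
by move=> /bmf_integrable fi; rewrite /Rintegral fineK//; exact: integrable_fin_num.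
Qed.

Lemma bmf_Int_sum (I : Type) (s : seq I) (F : I -> T -> R) : (forall i, bmf (F i)) ->
  Int (fun x => \sum_(i <- s) F i x) = \sum_(i <- s) Int (F i).
Proof.
move=> bF; elim: s => [|i s ih].
  rewrite big_nil; under eq_Rintegral do rewrite big_nil.
  by rewrite Rintegral_cst// mul0r.
rewrite big_cons -ih -RintegralD//; last 2 first.
- exact: bmf_integrable.
- by apply: bmf_integrable; exact: bmf_sum.
by apply: eq_Rintegral => x _; rewrite big_cons.
Qed.

Lemma bmf_IntZ (c : R) f : bmf f -> Int (fun x => c * f x) = c * Int f.
Proof. by move=> bf; rewrite RintegralZl//; exact: bmf_integrable. Qed.

Lemma bmf_le_Int f g : bmf f -> bmf g -> (forall x, D x -> f x <= g x) ->
  Int f <= Int g.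
Proof. by move=> bf bg fg; apply: le_Rintegral => //; exact: bmf_integrable. Qed.

Lemma bmf_norm_Int f : bmf f -> `|Int f| <= Int (fun x => `|f x|).
Proof. by move=> bf; apply: le_normr_Rintegral => //; exact: bmf_integrable. Qed.

(* The deviation of the coefficients of [v] from their neighbours is controlled
   by the deviation of [v] from local constants [b i]: the stability of the basis
   is applied to the coefficients [a - b], where
   [v - sum_i b_i e_i = sum_i (v - b_i) e_i] because the [e_i] sum up to 1. *)
Lemma mass_weighted_differences N (e : 'I_N -> T -> R) (a b : 'I_N -> R)
    (P H Cs cm Q : R) :
  (forall i, bmf (e i)) -> (forall x, D x -> \sum_i `|e i x| <= P) ->
  (forall x, D x -> \sum_i e i x = 1) -> 0 <= P -> 0 <= Cs -> 0 <= cm ->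
  (forall c : 'I_N -> R, H * \sum_i c i ^+ 2 <=
     Cs * Int (fun x => (\sum_i c i * e i x) ^+ 2)) ->
  (forall i, Int (fun x => `|e i x|) <= cm * H) ->
  \sum_i Int (fun x => `|e i x| * (\sum_j a j * e j x - b i) ^+ 2) <= Q ->
  \sum_i \sum_j `|Int (fun x => e i x * e j x)| * (a i - a j) ^+ 2 <=
    8 * P * (cm * Cs * P + 1) * Q.
Proof.
move=> be eP e1 P0 Cs0 cm0 stable mass hQ.
pose v x := \sum_j a j * e j x.
have bv : bmf v by apply: bmf_sum => j; apply: bmfM => //; exact: bmf_cst.
have bvc c : bmf (fun x => v x - c) by apply: bmfD => //; exact: bmf_cst.
have bne i : bmf (fun x => `|e i x|) by exact: bmf_norm.
have bdev i c : bmf (fun x => `|e i x| * (v x - c) ^+ 2).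
  by apply: bmfM => //; exact: bmf_sqr.
(* Stability bounds [a - b] by a square integral, which is compared with [Q] by Cauchy-Schwarz with
   weights [|e i x|], whose sum is at most [P]. *)
have step1 : H * \sum_i (a i - b i) ^+ 2 <= Cs * (P * Q).
  apply: le_trans (stable _) _; apply: ler_wpM2l => //.
  apply: (@le_trans _ _ (Int (fun x => P * \sum_i `|e i x| * (v x - b i) ^+ 2))).
    apply: bmf_le_Int.
    - apply: bmf_sqr; apply: bmf_sum => i; apply: bmfM => //; exact: bmf_cst.
    - by apply: bmfM; [exact: bmf_cst|exact: bmf_sum].
    - move=> x Dx.
      have -> : \sum_i (a i - b i) * e i x = \sum_i e i x * (v x - b i).
        under eq_bigr do rewrite mulrBl; rewrite sumrB.
        under [RHS]eq_bigr do rewrite mulrBr; rewrite sumrB -mulr_suml e1// mul1r.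
        by congr (_ - _); apply: eq_bigr => i _; rewrite mulrC.
      rewrite -real_normK ?num_real//.
      (* The factor 1 is the second sequence in the weighted Cauchy-Schwarz inequality. *)
      apply: (@le_trans _ _ ((\sum_i `|e i x| * (1 * `|v x - b i|)) ^+ 2)).
        rewrite lerXn2r ?nnegrE//; first by apply: sumr_ge0 => i _; rewrite mul1r mulr_ge0.
        rewrite (le_trans (ler_norm_sum _ _ _))//; apply: ler_sum => i _.
        by rewrite mul1r normrM.
      apply: le_trans (cauchy_schwarz_sum _ _ _) _ => //.
      apply: ler_pM.
      + by apply: sumr_ge0 => i _; rewrite mulr_ge0// sqr_ge0.
      + by apply: sumr_ge0 => i _; rewrite mulr_ge0// sqr_ge0.
      + by under eq_bigr do rewrite expr1n mulr1; exact: eP.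
      + by apply: ler_sum => i _; rewrite real_normK ?num_real.
  rewrite bmf_IntZ; last exact: bmf_sum.
  by rewrite bmf_Int_sum//; exact: ler_wpM2l.
(* Replace [b] by [a] in the deviation: the cost [(a i - b i) ^+ 2] is multiplied by the mass of
   [e i], of order [H], and [step1] absorbs it. *)
have step2 : \sum_i Int (fun x => `|e i x| * (v x - a i) ^+ 2) <=
    2 * (cm * Cs * P + 1) * Q.
  apply: (@le_trans _ _ (\sum_i (2 * (a i - b i) ^+ 2 * Int (fun x => `|e i x|) +
      2 * Int (fun x => `|e i x| * (v x - b i) ^+ 2)))).
    apply: ler_sum => i _; rewrite -!bmf_IntZ//.
    rewrite -RintegralD//; last 2 first.
    - by apply: bmf_integrable; apply: bmfM => //; exact: bmf_cst.
    - by apply: bmf_integrable; apply: bmfM => //; exact: bmf_cst.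
    apply: bmf_le_Int => //.
      by apply: bmfD; apply: bmfM => //; exact: bmf_cst.
    move=> x Dx.
    have -> : 2 * (a i - b i) ^+ 2 * `|e i x| + 2 * (`|e i x| * (v x - b i) ^+ 2) =
      `|e i x| * (2 * (a i - b i) ^+ 2 + 2 * (v x - b i) ^+ 2) by ring.
    apply: ler_wpM2l => //.
    by have := sqr_ge0 ((a i - b i) + (v x - b i)); nra.
  rewrite big_split/= -[X in _ + X]mulr_sumr.
  have : \sum_i 2 * (a i - b i) ^+ 2 * Int (fun x => `|e i x|) <=
      2 * cm * (H * \sum_i (a i - b i) ^+ 2).
    rewrite !mulr_sumr; apply: ler_sum => i _.
    rewrite (_ : 2 * cm * _ = 2 * (a i - b i) ^+ 2 * (cm * H)); last by ring.
    by apply: ler_wpM2l => //; rewrite mulr_ge0// sqr_ge0.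
  have cm2 : 0 <= 2 * cm by rewrite mulr_ge0.
  by have := ler_wpM2l cm2 step1; move: hQ; rewrite -/v; lra.
(* Pointwise, [(a i - a j) ^+ 2] is at most twice the sum of the squared distances of [v x] to [a i]
   and [a j]; the free index is then summed with the bound [P]. *)
apply: (@le_trans _ _ (Int (fun x => 4 * P * \sum_i `|e i x| * (v x - a i) ^+ 2))).
  apply: (@le_trans _ _ (Int (fun x => \sum_i \sum_j
      (a i - a j) ^+ 2 * (`|e i x| * `|e j x|)))).
    have bij i j : bmf (fun x => (a i - a j) ^+ 2 * (`|e i x| * `|e j x|)).
      by apply: bmfM; [exact: bmf_cst|exact: bmfM].
    rewrite bmf_Int_sum; last by move=> i; exact: bmf_sum.
    apply: ler_sum => i _; rewrite bmf_Int_sum//; apply: ler_sum => j _.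
    rewrite bmf_IntZ; last exact: bmfM.
    rewrite mulrC; apply: ler_wpM2l; first exact: sqr_ge0.
    apply: le_trans (bmf_norm_Int _) _; first exact: bmfM.
    by under eq_Rintegral do rewrite normrM.
  apply: bmf_le_Int.
  - apply: bmf_sum => i; apply: bmf_sum => j; apply: bmfM; first exact: bmf_cst.
    exact: bmfM.
  - by apply: bmfM; [exact: bmf_cst|exact: bmf_sum].
  - move=> x Dx.
    have sum0 : 0 <= \sum_i `|e i x| * (v x - a i) ^+ 2.
      by apply: sumr_ge0 => i _; rewrite mulr_ge0// sqr_ge0.
    apply: (@le_trans _ _ (2 * (\sum_i `|e i x| * (v x - a i) ^+ 2) * \sum_j `|e j x| +
        2 * (\sum_i `|e i x|) * (\sum_j `|e j x| * (v x - a j) ^+ 2))).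
      rewrite -!mulrA !big_distrlr/= !mulr_sumr -big_split/=; apply: ler_sum => i _.
      rewrite !mulr_sumr -big_split/=; apply: ler_sum => j _.
      have -> : 2 * (`|e i x| * (v x - a i) ^+ 2 * `|e j x|) +
         2 * (`|e i x| * (`|e j x| * (v x - a j) ^+ 2)) =
         (2 * (v x - a i) ^+ 2 + 2 * (v x - a j) ^+ 2) * (`|e i x| * `|e j x|) by ring.
      apply: ler_wpM2r; first by rewrite mulr_ge0.
      by have := sqr_ge0 ((v x - a i) + (v x - a j)); nra.
    have := ler_wpM2l sum0 (eP x Dx); lra.
rewrite bmf_IntZ; last exact: bmf_sum.
rewrite bmf_Int_sum//.
have P4 : 0 <= 4 * P by rewrite mulr_ge0.
by have := ler_wpM2l P4 step2; lra.
Qed.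

End bounded_measurable.

(** By symmetry of [m], averaging each of the two sums with its copy under exchange of the indices
    produces the differences. Cauchy-Schwarz is applied over pairs of indices with weights
    [|m i j|], as entries may be negative. *)
Lemma lumping_error_le (R : realType) N (m : 'M[R]_N) (a b : 'I_N -> R) (A B : R) :
  (forall i j, m i j = m j i) -> 0 <= A -> 0 <= B ->
  \sum_i \sum_j `|m i j| * (a i - a j) ^+ 2 <= A ^+ 2 ->
  \sum_i \sum_j `|m i j| * (b i - b j) ^+ 2 <= B ^+ 2 ->
  `|\sum_i \sum_j a i * b j * m i j - \sum_i (\sum_l m i l) * a i * b i| <= A * B / 2.
Proof.
move=> msym A0 B0 hA hB.
pose D := \sum_i \sum_j m i j * ((a i - a j) * (b i - b j)).
have -> : \sum_i \sum_j a i * b j * m i j - \sum_i (\sum_l m i l) * a i * b i = - D / 2.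
  pose X := \sum_i \sum_j a i * b j * m i j; pose Y := \sum_i \sum_j m i j * a i * b i.
  have X' : X = \sum_i \sum_j a j * b i * m i j.
    rewrite /X exchange_big/=; apply: eq_bigr => i _; apply: eq_bigr => j _.
    by rewrite msym.
  have Y' : Y = \sum_i \sum_j m i j * a j * b j.
    rewrite /Y exchange_big/=; apply: eq_bigr => i _; apply: eq_bigr => j _.
    by rewrite msym.
  have YE : \sum_i (\sum_l m i l) * a i * b i = Y.
    by apply: eq_bigr => i _; rewrite -mulrA mulr_suml; apply: eq_bigr => j _; rewrite mulrA.
  have DE : D = (Y + Y) - (X + X).
    rewrite {2}X' {2}Y' /X /Y -!big_split -sumrB /=; apply: eq_bigr => i _.
    rewrite -!big_split -sumrB /=; apply: eq_bigr => j _; ring.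
  by rewrite YE -/X DE; field.
rewrite normrM normrN (@gtr0_norm _ 2^-1) ?invr_gt0// ler_wpM2r ?invr_ge0//.
have D1 : `|D| <= \sum_p `|m p.1 p.2| * (`|a p.1 - a p.2| * `|b p.1 - b p.2|).
  rewrite /D pair_big/= (le_trans (ler_norm_sum _ _ _))//; apply: ler_sum => p _.
  by rewrite !normrM.
rewrite -(@ler_pXn2r _ 2) ?nnegrE ?mulr_ge0//.
apply: (@le_trans _ _ ((\sum_p `|m p.1 p.2| * (`|a p.1 - a p.2| * `|b p.1 - b p.2|)) ^+ 2)).
  by rewrite lerXn2r ?nnegrE//; exact: le_trans D1.
apply: le_trans (cauchy_schwarz_sum _ _ _) _ => //; rewrite exprMn.
have sq (c : 'I_N -> R) : \sum_(p : 'I_N * 'I_N) `|m p.1 p.2| * `|c p.1 - c p.2| ^+ 2 =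
    \sum_i \sum_j `|m i j| * (c i - c j) ^+ 2.
  by rewrite pair_big/=; apply: eq_bigr => p _; rewrite real_normK ?num_real.
rewrite !sq; apply: ler_pM => //;
  by apply: sumr_ge0 => i _; apply: sumr_ge0 => j _; rewrite mulr_ge0// sqr_ge0.
Qed.

(** * Estimates on one mesh, with constants in which [h] does not occur *)

Section fixed_mesh.
Variables (R : realType) (d : nat) (Omega : set 'rV[R]_d) (m : mesh R d).
Variable U : set 'rV[R]_d.
Hypothesis tri : triangulation m U.
Local Notation cell := {set 'I_(nvert m)}.
Variables (S : cell -> cell) (kappa : cell -> 'I_(nvert m) -> R).
Hypotheses (ext : extension_map Omega S) (wt : averaging_weights Omega kappa).
Hypotheses (oOmega : open Omega) (bOmega : bounded_set Omega).
Local Notation Th := (Th Omega m).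
Local Notation ThI := (ThI Omega m).
Local Notation nI := #|vertices ThI|.
Hypothesis OmegaTh : Omega `<=` region Th.
Variables (sigma h C' : R).
Hypotheses (sigma0 : 0 < sigma) (h0 : 0 < h) (C'0 : 0 <= C').
Hypothesis regular : forall T : cell, T \in cells m ->
  [/\ diam (simplex T) <= sigma * h, h <= sigma * diam (simplex T) &
    exists x r, [/\ 0 < r, eball x r `<=` simplex T &
      diam (simplex T) <= sigma * r]].
Hypothesis diam_ext : forall (T : cell) x x', T \in Th -> simplex T x ->
  simplex (S T) x' -> `|x - x'| <= C' * h.
Local Notation mu := (lebesgue_rV R d).
Local Notation Int f := (\int[mu]_(x in Omega) f x).
Local Notation kap := (kappa_in d sigma).
Local Notation e := (@ebasis R d Omega m S kappa).
Local Notation xv i := (@vert _ _ m (enum_val (i : 'I_nI))).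
Implicit Types (T : cell) (x : 'rV[R]_d) (v w : dpw m).

Let mO : measurable Omega.
Proof. exact: open_measurable_rV. Qed.

Let muO : (mu Omega < +oo)%E.
Proof.
have [D D0 OD] := bounded_ex bOmega.
apply: (@le_lt_trans _ _ (mu (cube 0 D))); last by rewrite lebesgue_cube ?ltry// ltW.
by rewrite le_measure ?inE//; apply: measurable_cube; exact: ltW.
Qed.

(** The bound of [norm_hat_le] at distance [C' * h], in which [h] cancels. *)
Definition ebasis_cst : R := 1 + d%:R * (2 * kap)^-1 * C'.
Local Notation Lam := ebasis_cst.

Let Lam0 : 0 <= Lam.
Proof. by rewrite /ebasis_cst; have := kappa_in_gt0 d sigma0 => ?; nonneg. Qed.

Let diam_cell T x x' : T \in Th -> simplex T x -> simplex T x' ->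
  `|x - x'| <= sigma * h.
Proof.
move=> TTh xT x'T; have Tm := fintype.subsetP (Th_cells Omega m) _ TTh.
by have [dT _ _] := regular Tm; apply: le_trans dT; exact: simplex_diam.
Qed.

Let hat_bound T z y : T \in Th -> y \in T ->
  `|p1_eval (hat (S T) z) (vert y)| <= Lam.
Proof.
move=> TTh yT; have STI : S T \in ThI by have [hS _] := ext; exact: hS.
have STm := fintype.subsetP (ThI_cells Omega m) _ STI.
have [_ /(_ _ STm)[cST _] _ _] := tri.
have [z0 z0S] : exists z0, z0 \in S T by apply/card_gt0P; rewrite cST.
apply: le_trans (norm_hat_le tri sigma0 h0 regular z (vert y) STm (simplex_vert z0S)) _.
rewrite lerD2l -mulrA -[leRHS]mulrA; apply: ler_wpM2l => //.
have k0 := kappa_in_gt0 d sigma0.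
apply: (@le_trans _ _ ((2 * (kap * h))^-1 * (C' * h))).
  apply: ler_wpM2l; first by nonneg.
  by apply: (diam_ext TTh); exact: simplex_vert.
rewrite le_eqVlt; apply/orP; left; apply/eqP; field.
by rewrite !gt_eqF.
Qed.

Let e_bound i x : Omega x -> `|e i x| <= Lam.
Proof. by move=> /OmegaTh; exact: (ebasis_bound tri ext wt hat_bound). Qed.

Let e_support i x : Omega x -> e i x != 0 -> `|x - xv i| <= (sigma + C') * h.
Proof. by move=> /OmegaTh; exact: (ebasis_support tri ext diam_cell diam_ext). Qed.

Let sum_e x : Omega x -> \sum_i e i x = 1.
Proof. by move=> /OmegaTh; exact: (sum_ebasis tri ext wt). Qed.

Let me i : measurable_fun setT (e i).
Proof. exact: (measurable_pw_val tri _ (Th_cells Omega m)). Qed.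

Let be i : bmf Omega (e i).
Proof. by split; [exact: measurable_funTS|exists Lam => x; exact: e_bound]. Qed.

Let card_near (K : R) x : 0 <= K ->
  (#|[set i : 'I_nI | (`|xv i - x| <= K * h)%R]%SET| <= packing_number d sigma K)%N.
Proof.
move=> K0; apply: leq_trans (card_near_vertices tri sigma0 h0 regular x K0).
rewrite -(card_imset _ enum_val_inj); apply: subset_leq_card.
apply/fintype.subsetP => y /imsetP[i]; rewrite inE => ix ->; rewrite inE ix andbT.
have := enum_valP i => /bigcupP[T TI yT]; apply/bigcupP; exists T => //.
exact: (fintype.subsetP (ThI_cells Omega m)).
Qed.

(** The number of basis functions that can be nonzero at a point, times their bound. *)
Let P : R := (packing_number d sigma (sigma + C'))%:R * Lam.

Let P0 : 0 <= P.
Proof. exact: mulr_ge0. Qed.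

Let sum_norm_e x : Omega x -> \sum_i `|e i x| <= P.
Proof.
move=> Ox; pose A := [set i : 'I_nI | `|xv i - x| <= (sigma + C') * h]%SET.
rewrite (bigID (mem A))/= [X in _ + X]big1 ?addr0; last first.
  move=> i; rewrite inE; apply: contraNeq; rewrite normr_eq0 distrC.
  exact: e_support.
apply: (@le_trans _ _ (\sum_(i in A) Lam)); first by apply: ler_sum => i _; exact: e_bound.
rewrite sumr_const -[leLHS]mulr_natl ler_wpM2r// ler_nat; apply: card_near.
by rewrite addr_ge0// ltW.
Qed.

Let mass_e i : Int (fun x => `|e i x|) <= Lam * (2 * (sigma + C')) ^+ d * h ^+ d.
Proof.
have K0 : 0 <= (sigma + C') * h by nonneg.
have mc := measurable_cube (xv i) K0.
rewrite -lee_fin bmf_IntE//; last exact: bmf_norm.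
apply: (@le_trans _ _ (\int[mu]_(x in Omega) (cst Lam%:E \_ (cube (xv i) ((sigma + C') * h))) x)%E).
  apply: ge0_le_integral => //.
  - by apply/measurable_EFinP; exact: (bmf_norm (be i)).1.
  - by apply: measurable_funTS; apply: (measurable_restrictT _ mc).1.
  - move=> x Ox; rewrite /patch; case: ifPn => [_|]; first by rewrite lee_fin e_bound.
    rewrite notin_setE /cube/= => /negP far; suff -> : e i x = 0 by rewrite normr0.
    by apply/eqP; apply: contraNT far; exact: e_support.
rewrite -integral_mkcondr integral_cst; last exact: measurableI.
rewrite -mulrA EFinM; apply: lee_wpmul2l; first by rewrite lee_fin.
rewrite -exprMn -mulrA -(lebesgue_cube (xv i) K0) le_measure ?inE//.
exact: measurableI.
Qed.

(** Each [i] is a vertex of an uncut cell, whose inscribed cube lies in Omega and near that vertex.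
    This supplies the hypothesis of the scaled Poincaré inequality. *)
Let vertex_cube (i : 'I_nI) : exists z',
  cube z' (kap * h) `<=` Omega `&` cube (xv i) ((sigma + C') * h).
Proof.
have := enum_valP i => /bigcupP[T TI iT].
have Tm := fintype.subsetP (ThI_cells Omega m) _ TI.
have [z' hz'] := cell_contains_cube sigma0 regular Tm.
exists z' => x /hz' xT; split.
  by move: TI; rewrite inE => /andP[_ /asboolP]; apply.
apply: (@le_trans _ _ (sigma * h)); last by rewrite ler_pM2r// lerDl.
have [dT _ _] := regular Tm; apply: le_trans dT.
by apply: simplex_diam => //; exact: simplex_vert.
Qed.

Variables (Cp K' Cs : R).
Hypotheses (Cp0 : 0 <= Cp) (K'0 : 0 <= K') (Cs0 : 0 <= Cs).
Hypothesis poincare : forall z z',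
  cube z' (kap * h) `<=` Omega `&` cube z ((sigma + C') * h) ->
  forall f g, upper_gradient Omega f g ->
  exists c, (\int[mu]_(x in Omega `&` cube z ((sigma + C') * h)) ((f x - c) ^+ 2)%:E <=
    (Cp * h ^+ 2)%:E *
    \int[mu]_(x in Omega `&` cube z (K' * h)) (g x)%:E)%E.
Hypothesis stable : forall a : 'cV[R]_nI,
  h ^+ d * \sum_i a i ord0 ^+ 2 <=
  Cs * fem_inner Omega (Defs.expand S kappa a) (Defs.expand S kappa a).

Let gsq v x := dot (pw_grad Th v x) (pw_grad Th v x).

Let bgsq v : bmf Omega (gsq v).
Proof.
split.
  apply: measurable_funTS.
  exact: (@measurable_pw_grad _ _ _ _ tri Th v (fun g => dot g g) (Th_cells Omega m)).
exists (\sum_(T : cell) dot (v T).2 (v T).2) => x _.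
rewrite ger0_norm ?dot_ge0// /gsq /pw_grad; case: cell_at => [T|].
  by rewrite (bigD1 T)//= lerDl; apply: sumr_ge0 => T' _; exact: dot_ge0.
by rewrite dot0l; apply: sumr_ge0 => T _; exact: dot_ge0.
Qed.

Let grad_norm_sqr v : fem_grad_norm Omega v ^+ 2 = Int (gsq v).
Proof. by rewrite sqr_sqrtr//; apply: Rintegral_ge0 => x _; exact: dot_ge0. Qed.

Let N' := packing_number d sigma K'.

(** Bounded overlap: a point belongs to at most [N'] of the cubes around the vertices. *)
Let sum_local_grad v :
  (\sum_i \int[mu]_(x in Omega `&` cube (xv i) (K' * h)) (gsq v x)%:E <=
   N'%:R%:E * (Int (gsq v))%:E)%E.
Proof.
have K'h : 0 <= K' * h by nonneg.
under eq_bigr do rewrite integral_mkcondr.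
have mg : measurable_fun Omega (EFin \o gsq v) by apply/measurable_EFinP; exact: (bgsq v).1.
have mpatch i : measurable_fun Omega ((fun x => (gsq v x)%:E) \_ (cube (xv i) (K' * h))).
  apply/measurable_restrict => //; first exact: measurable_cube.
  by apply: measurable_funS mg => //; exact: subIsetl.
rewrite -ge0_integral_sum//; last first.
  by move=> i x _; rewrite /patch; case: ifP => // _; rewrite lee_fin dot_ge0.
rewrite bmf_IntE// -ge0_integralZl//; last first.
  by move=> x _; rewrite lee_fin dot_ge0.
apply: ge0_le_integral => //.
- move=> x _; apply: sume_ge0 => i _; rewrite /patch; case: ifP => // _.
  by rewrite lee_fin dot_ge0.
- exact: emeasurable_sum.
- exact: measurable_funeM.
move=> x _; pose A := [set i : 'I_nI | `|xv i - x| <= K' * h]%SET.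
rewrite (eq_bigr (fun i => (if i \in A then gsq v x else 0)%:E)); last first.
  move=> i _; rewrite /patch /A inE distrC.
  rewrite (_ : (x \in cube _ _) = (`|x - xv i| <= K' * h)); last first.
    by apply/idP/idP; rewrite inE.
  by case: ifP.
rewrite sumEFin -EFinM lee_fin -big_mkcond sumr_const -[leLHS]mulr_natl.
by rewrite ler_wpM2r ?dot_ge0// ler_nat; exact: card_near.
Qed.

(** On Omega, [e i] is bounded by [Lam] and vanishes outside the cube around its vertex, so the
    local Poincaré inequality applies to each term; the local gradients are then summed with bounded
    overlap. *)
Let local_deviation v : VhE Omega S kappa v -> exists c : 'I_nI -> R,
  \sum_i Int (fun x => `|e i x| * (pw_val Th v x - c i) ^+ 2) <=
  Lam * (Cp * h ^+ 2) * (N'%:R * fem_grad_norm Omega v ^+ 2).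
Proof.
move=> Vv; have cv := consistent_VhE tri Vv.
have ug := upper_gradient_pw tri (Th_cells Omega m) cv OmegaTh.
have /choice[c hc] : forall i : 'I_nI, exists c,
    (\int[mu]_(x in Omega `&` cube (xv i) ((sigma + C') * h))
       ((pw_val Th v x - c) ^+ 2)%:E <=
    (Cp * h ^+ 2)%:E *
    \int[mu]_(x in Omega `&` cube (xv i) (K' * h)) (gsq v x)%:E)%E.
  by move=> i; have [z' hz'] := vertex_cube i; exact: (poincare hz' ug).
exists c; rewrite grad_norm_sqr.
have mv : measurable_fun setT (pw_val Th v) by exact: (measurable_pw_val tri _ (Th_cells Omega m)).
have msq c0 : measurable_fun setT (fun x => (pw_val Th v x - c0) ^+ 2).
  by apply: measurable_funX; exact: measurable_funB.
have bv : bmf Omega (pw_val Th v).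
  split; first exact: measurable_funTS.
  exists (\sum_i `|coef Omega S kappa v i ord0| * Lam) => x Ox.
  rewrite {1}(VhE_coef tri Vv) pw_val_expand (le_trans (ler_norm_sum _ _ _))//.
  by apply: ler_sum => i _; rewrite normrM ler_wpM2l//; exact: e_bound.
have bdev i : bmf Omega (fun x => `|e i x| * (pw_val Th v x - c i) ^+ 2).
  apply: bmfM; first exact: bmf_norm.
  by apply: bmf_sqr; apply: bmfD => //; exact: bmf_cst.
have K0 : 0 <= (sigma + C') * h by nonneg.
rewrite -lee_fin -sumEFin.
apply: (@le_trans _ _ (\sum_i (Lam * (Cp * h ^+ 2))%:E *
    \int[mu]_(x in Omega `&` cube (xv i) (K' * h)) (gsq v x)%:E)%E).
  apply: lee_sum => i _; rewrite bmf_IntE// EFinM -muleA.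
  apply: (@le_trans _ _ (Lam%:E * \int[mu]_(x in Omega `&` cube (xv i) ((sigma + C') * h))
       ((pw_val Th v x - c i) ^+ 2)%:E)%E); last by apply: lee_wpmul2l; rewrite ?lee_fin.
  have mc := measurable_cube (xv i) K0.
  have mOc : measurable (Omega `&` cube (xv i) ((sigma + C') * h)) by exact: measurableI.
  have mEsq A : measurable_fun A (fun x => ((pw_val Th v x - c i) ^+ 2)%:E).
    by apply: measurable_funTS; apply/measurable_EFinP.
  rewrite -ge0_integralZl//; last by move=> x _; rewrite lee_fin sqr_ge0.
  rewrite integral_mkcondr; apply: ge0_le_integral => //.
  - by move=> x _; rewrite lee_fin mulr_ge0// sqr_ge0.
  - by apply/measurable_EFinP; exact: (bdev i).1.
  - apply: measurable_funTS; apply: (measurable_restrictT _ mc).1.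
    exact: measurable_funeM.
  - move=> x Ox; rewrite /patch; case: ifPn => [_|].
      by rewrite -EFinM lee_fin ler_wpM2r ?sqr_ge0// e_bound.
    rewrite notin_setE /cube/= => /negP far; suff -> : e i x = 0 by rewrite normr0 mul0r.
    by apply/eqP; apply: contraNT far; exact: e_support.
rewrite -ge0_sume_distrr; last first.
  by move=> i _; apply: integral_ge0 => x _; rewrite lee_fin dot_ge0.
rewrite [leRHS]EFinM; apply: lee_wpmul2l; first by rewrite lee_fin; nonneg.
by rewrite [leRHS]EFinM; exact: sum_local_grad.
Qed.

(** The constant of [mass_weighted_differences], with the mass bound of [mass_e], times the one of
    [local_deviation] without [h ^+ 2]. *)
Definition lumping_cst : R :=
  8 * P * (Lam * (2 * (sigma + C')) ^+ d * Cs * P + 1) * (Lam * Cp * N'%:R).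

Let fem_inner_expand (a b : 'cV[R]_nI) :
  fem_inner Omega (Defs.expand S kappa a) (Defs.expand S kappa b) =
  \sum_i \sum_j a i ord0 * b j ord0 * mass_mx Omega S kappa i j.
Proof.
have bij i j : bmf Omega (fun x => a i ord0 * b j ord0 * (e i x * e j x)).
  by apply: bmfM; [exact: bmf_cst|exact: bmfM].
transitivity (Int (fun x => \sum_i \sum_j a i ord0 * b j ord0 * (e i x * e j x))).
  apply: eq_Rintegral => x _; rewrite !pw_val_expand big_distrlr/=.
  by apply: eq_bigr => i _; apply: eq_bigr => j _; ring.
rewrite bmf_Int_sum//; last by move=> i; exact: bmf_sum.
apply: eq_bigr => i _; rewrite bmf_Int_sum//; apply: eq_bigr => j _.
by rewrite bmf_IntZ//; [rewrite mxE|exact: bmfM].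
Qed.

Lemma mass_matrix_differences v : VhE Omega S kappa v ->
  \sum_i \sum_j `|mass_mx Omega S kappa i j| *
    (coef Omega S kappa v i ord0 - coef Omega S kappa v j ord0) ^+ 2 <=
  lumping_cst * (h * fem_grad_norm Omega v) ^+ 2.
Proof.
move=> Vv; set a := coef Omega S kappa v; have [c hc] := local_deviation Vv.
have := @mass_weighted_differences _ _ _ mu Omega mO muO nI e (fun i => a i ord0) c P
  (h ^+ d) Cs (Lam * (2 * (sigma + C')) ^+ d)
  (Lam * (Cp * h ^+ 2) * (N'%:R * fem_grad_norm Omega v ^+ 2)) be sum_norm_e sum_e P0 Cs0.
have -> : lumping_cst * (h * fem_grad_norm Omega v) ^+ 2 =
  8 * P * (Lam * (2 * (sigma + C')) ^+ d * Cs * P + 1) *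
  (Lam * (Cp * h ^+ 2) * (N'%:R * fem_grad_norm Omega v ^+ 2)).
  by rewrite /lumping_cst; ring.
under [X in _ -> is_true (X <= _)]eq_bigr do under eq_bigr do rewrite mxE.
apply=> //.
- nonneg.
- move=> b; have := stable (\col_i b i).
  under eq_bigr do rewrite mxE.
  move=> /le_trans; apply; apply: ler_wpM2l => //.
  rewrite le_eqVlt; apply/orP; left; apply/eqP; apply: eq_Rintegral => x _.
  by rewrite !pw_val_expand -expr2; congr (_ ^+ 2); apply: eq_bigr => i _; rewrite mxE.
- apply: le_trans hc; rewrite le_eqVlt; apply/orP; left; apply/eqP.
  apply: eq_bigr => i _; apply: eq_Rintegral => x _.
  by rewrite [in RHS](VhE_coef tri Vv) pw_val_expand.
Qed.

Lemma lumping_error_fixed_mesh v w :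
  VhE Omega S kappa v -> VhE Omega S kappa w ->
  `|fem_inner Omega v w - lumped_inner Omega S kappa v w| <=
  lumping_cst / 2 * h ^+ 2 * fem_grad_norm Omega v * fem_grad_norm Omega w.
Proof.
move=> Vv Vw; set a := coef Omega S kappa v; set b := coef Omega S kappa w.
have L0 : 0 <= lumping_cst by rewrite /lumping_cst; nonneg.
have g0 (u : dpw m) : 0 <= fem_grad_norm Omega u by exact: sqrtr_ge0.
pose A (u : dpw m) := Num.sqrt lumping_cst * (h * fem_grad_norm Omega u).
have A0 u : 0 <= A u by rewrite mulr_ge0 ?sqrtr_ge0// mulr_ge0// ltW.
have A2 u : A u ^+ 2 = lumping_cst * (h * fem_grad_norm Omega u) ^+ 2.
  by rewrite exprMn sqr_sqrtr.
have := @lumping_error_le R nI (mass_mx Omega S kappa) (fun i => a i ord0)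
  (fun i => b i ord0) (A v) (A w) _ (A0 v) (A0 w).
rewrite !A2 => /(_ _ (mass_matrix_differences Vv) (mass_matrix_differences Vw)).
rewrite -fem_inner_expand -(VhE_coef tri Vv) -(VhE_coef tri Vw) => err.
have -> : lumped_inner Omega S kappa v w =
    \sum_i (\sum_l mass_mx Omega S kappa i l) * a i ord0 * b i ord0.
  apply: eq_bigr => i _; rewrite /lumped_mass_mx mul_diag_mx !mxE.
  by congr (_ * _ * _); apply: eq_bigr => l _; rewrite !mxE.
apply: le_trans (err _) _.
  by move=> i j; rewrite !mxE; apply: eq_Rintegral => x _; rewrite mulrC.
rewrite le_eqVlt; apply/orP; left; apply/eqP.
rewrite (_ : A v * A w = Num.sqrt lumping_cst ^+ 2 *
  (h ^+ 2 * fem_grad_norm Omega v * fem_grad_norm Omega w)); last by rewrite /A; ring.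
by rewrite sqr_sqrtr//; field.
Qed.

End fixed_mesh.

Theorem lemma3p3 (R : realType) (d : nat) (hd : (2 <= d)%N)
  (Omega Omega0 : set 'rV[R]_d) (h0 : R) (M : R -> mesh R d)
  (S : forall h, {set 'I_(nvert (M h))} -> {set 'I_(nvert (M h))})
  (kappa : forall h, {set 'I_(nvert (M h))} -> 'I_(nvert (M h)) -> R)
  (Omega_domain : domain Omega) (Omega_bounded : bounded_set Omega)
  (Omega_smooth : smooth_boundary Omega)
  (Omega0_polygonal : polygonal_domain Omega0)
  (Omega_sub : Omega `<=` Omega0) (h0_gt0 : 0 < h0)
  (M_triangulation : forall h, 0 < h <= h0 -> triangulation (M h) Omega0)
  (M_quasi_uniform : quasi_uniform h0 M)
  (S_extension : forall h, 0 < h <= h0 -> extension_map Omega (S h))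
  (S_local : local_extension Omega h0 S)
  (kappa_weights : forall h, 0 < h <= h0 ->
    averaging_weights Omega (kappa h))
  (basis_stable : stable_extended_basis Omega h0 S kappa) :
  exists C : R, forall h, 0 < h <= h0 ->
    forall v w, VhE Omega (S h) (kappa h) v -> VhE Omega (S h) (kappa h) w ->
      `| fem_inner Omega v w - lumped_inner Omega (S h) (kappa h) v w |
        <= C * h ^+ 2 * fem_grad_norm Omega v * fem_grad_norm Omega w.
Proof.
have [oO cO O0] := Omega_domain.
have [sigma sigma0 regular] := M_quasi_uniform.
have [C0 C00 Sloc] := S_local.
have [Cs Cs0 stable] := basis_stable.
(* The distance from [T] to [S T] is needed for all active cells: on cut cells [C0] bounds it, and
   on uncut cells, where [S T = T], [sigma] does. *)
pose C' := sigma + C0.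
have C'0 : 0 <= C' by rewrite addr_ge0// ltW.
have K0 : 0 < sigma + C' by rewrite ltr_wpDr.
have [Cp [K' [Cp0 K'0 poincare]]] := poincare_scaled oO Omega_bounded Omega_smooth h0
  cO O0 K0 (kappa_in_gt0 d sigma0).
exists (lumping_cst d sigma C' Cp K' Cs / 2) => h hh v w Vv Vw.
have tri := M_triangulation h hh.
have [hgt0 _] := andP hh.
(* The mesh covers the closure of Omega0, and a cell containing a point of Omega is active. *)
have OTh : Omega `<=` region (Th Omega (M h)).
  move=> x Ox; have [_ _ _ cov] := tri.
  have : closure Omega0 x by apply: subset_closure; exact: Omega_sub.
  rewrite -cov => -[T Tm xT]; exists T => //=.
  by rewrite inE; apply/andP; split=> //; apply/asboolP; exists x.
apply: (@lumping_error_fixed_mesh _ _ _ _ _ tri _ _ (S_extension h hh)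
  (kappa_weights h hh) oO Omega_bounded OTh sigma h C' sigma0 hgt0 C'0) => //.
- exact: regular.
- move=> T x x' TTh xT x'ST; have [_ Sid] := S_extension h hh.
  have Tm := fintype.subsetP (Th_cells Omega (M h)) _ TTh.
  rewrite /C' mulrDl; have [TI|TI] := boolP (T \in ThI Omega (M h)).
    rewrite (Sid _ TI) in x'ST; apply: ler_wpDr; first by rewrite mulr_ge0// ltW.
    by have [dT _ _] := regular h hh T Tm; apply: le_trans dT; exact: simplex_diam.
  apply: ler_wpDl; first by rewrite mulr_ge0// ltW.
  have TB : T \in ThB Omega (M h) by rewrite finset.in_setD TI.
  by apply: le_trans (Sloc h hh T TB); exact: simplexU_diam.
- exact: ltW.
- move=> z z' hz f g ug; exact: (poincare h hh z z' hz f g ug).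
- exact: stable.
Qed.
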